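(* Let $f_1\in\mathcal F_1$ and $$T^{(n)}_{f_1}(\theta,\sigma):=\frac1{\sqrt{n\gamma(f_1)}}\sum_{i=1}^n\phi_{f_1}(Z_i(\theta,\sigma))\big(Z_i^2(\theta,\sigma)-\kappa(f_1)\big),\qquad Z_i(\theta,\sigma)=\sigma^{-1}(X_i^{(n)}-\theta).$$ Then: (i) $T^{(n)}_{f_1}(\hat\theta_\#,\hat\sigma_\#)=T^{(n)}_{f_1}(\theta,\sigma)+o_{\mathrm P}(1)$ is asymptotically normal, with mean zero under $\mathrm P^{(n)}_{\theta,\sigma,0;f_1}$, mean $\tau\gamma^{1/2}(f_1)$ under $\mathrm P^{(n)}_{\theta,\sigma,n^{-1/2}\tau;f_1}$, and variance one under both. (ii) The sequence of tests rejecting the null hypothesis of symmetry (with standardized density $f_1$) whenever $T^{(n)}_{f_1}(\theta,\hat\sigma_\#)$ (resp., $T^{(n)}_{f_1}(\hat\theta_\#,\hat\sigma_\#)$) exceeds the $(1-\alpha)$ standard normal quantile $z_\alpha$ is locally asymptotically most powerful at asymptotic level $\alpha$ for $\mathcal H^{(n)}_{\theta;f_1}=\bigcup_{\sigma>0}\{\mathrm P^{(n)}_{\theta,\sigma,0;f_1}\}$ (resp., for $\mathcal H^{(n)}_{f_1}=\bigcup_{\theta\in\mathbb R}\bigcup_{\sigma>0}\{\mathrm P^{(n)}_{\theta,\sigma,0;f_1}\}$) against $\bigcup_{\xi>0}\bigcup_{\sigma>0}\{\mathrm P^{(n)}_{\theta,\sigma,\xi;f_1}\}$ (resp., $\bigcup_{\xi>0}\bigcup_{\theta\in\mathbb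 R}\bigcup_{\sigma>0}\{\mathrm P^{(n)}_{\theta,\sigma,\xi;f_1}\}$).
   Context: Densities are with respect to Lebesgue measure on $\mathbb R$. $\mathcal F_0$ is the set of densities $h_1$ with $h_1(-z)=h_1(z)$ for all $z\in\mathbb R$ and $\int_{-\infty}^1h_1(z)\,\mathrm dz=0.75$. $\mathcal F_1$ is the class of densities $f_1$ such that: (i) $f_1\in\mathcal F_0$; (ii) there exists $\dot f_1$ with $f_1(z_2)-f_1(z_1)=\int_{z_1}^{z_2}\dot f_1(z)\,\mathrm dz$ for all $z_1<z_2$; (iii) $z\mapsto\phi_{f_1}(z):=-\dot f_1(z)/f_1(z)$ is monotone increasing; (iv) $\mathcal K(f_1):=\int z^4\phi_{f_1}^2(z)f_1(z)\,\mathrm dz$ is finite, and hence so are $\mathcal I(f_1):=\int\phi_{f_1}^2(z)f_1(z)\,\mathrm dz$ and $\mathcal J(f_1):=\int z^2\phi_{f_1}^2(z)f_1(z)\,\mathrm dz$; (v) for some $\beta>0$, $\int_y^\infty f_1(z)\,\mathrm dz=O(y^{-\beta})$ as $y\to\infty$ and $\phi_{f_1}(z)=o(z^{\beta/2-2})$ as $z\to\infty$. Put $\kappa(f_1):=\mathcal J(f_1)/\mathcal I(f_1)$ and $\gamma(f_1):=\mathcal K(f_1)-\mathcal J^2(f_1)/\mathcal I(f_1)$. For $\theta\in\mathbb R$, $\sigma>0$, $\xi\in\mathbb R$, $\mathrm P^{(n)}_{\theta,\sigma,\xi;f_1}$ is the distribution of $(X_1^{(n)},\dots,X_n^{(n)})$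 when the $X_i^{(n)}$ are i.i.d. with density $$f(x)=\sigma^{-1}f_1\Big(\tfrac{x-\theta}\sigma\Big)-\xi\sigma^{-1}\dot f_1\Big(\tfrac{x-\theta}\sigma\Big)\Big(\big(\tfrac{x-\theta}\sigma\big)^2-\kappa(f_1)\Big)I[|x-\theta|\le\sigma|z^*|]$$ $$\qquad+\operatorname{sign}(\xi)\sigma^{-1}f_1\Big(\tfrac{x-\theta}\sigma\Big)\big\{I[x-\theta>\operatorname{sign}(-\xi)\sigma|z^*|]-I[x-\theta<\operatorname{sign}(\xi)\sigma|z^*|]\big\},$$ where $z^*$ is the solution of $f_1(z^* )=\xi\dot f_1(z^* )((z^* )^2-\kappa(f_1))$, unique for $|\xi|$ small enough (the family is only considered for such $\xi$). For $\xi=0$ the density is $\sigma^{-1}f_1((x-\theta)/\sigma)$. Here $\tau\in\mathbb R$ is a constant and $\alpha\in(0,1)$. Estimators: $\hat\theta_\#$ and $\hat\sigma_\#$ denote estimators of $\theta$ and $\sigma$ that are, under the null distributions $\mathrm P^{(n)}_{\theta,\sigma,0;f_1}$: (C1) root-$n$-consistent, $\hat\theta_\#-\theta=O_{\mathrm P}(n^{-1/2})$, $\hat\sigma_\#-\sigma=O_{\mathrm P}(n^{-1/2})$; (C2) asymptotically discrete: the number of possible values of the estimator in balls with $O(n^{-1/2})$ radius centered at the true parameter value is bounded as $n\to\infty$. $o_{\mathrm P}(1)$ is under $\mathrm P^{(n)}_{\theta,\sigma,0;f_1}$, as $n\to\infty$. Optimality: a sequence of tests $\varphi^{(n)}$ has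 asymptotic level $\alpha$ for a null hypothesis if $\limsup_n\mathrm E[\varphi^{(n)}]\le\alpha$ under each fixed null parameter value (and standardized density). It is locally asymptotically most powerful at asymptotic level $\alpha$ against $\bigcup_{\xi>0}\bigcup\{\mathrm P^{(n)}_{\theta,\sigma,\xi;f_1}\}$ if it has asymptotic level $\alpha$ and, for any other sequence $\psi^{(n)}$ of asymptotic level $\alpha$ for the same null hypothesis, $\limsup_n(\mathrm E[\psi^{(n)}]-\mathrm E[\varphi^{(n)}])\le0$ under $\mathrm P^{(n)}_{\theta,\sigma,n^{-1/2}\tau;f_1}$, for all $\tau>0$ and all $(\theta,\sigma)$ allowed by the alternative. *)

(* Defs.v *)
(* MathComp-Analysis: R is an arbitrary realType, and samples of size n are
   points of n.-tuple R with the sigma-algebra generated by the coordinates. *)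
From HB Require Import structures.
From mathcomp Require Import all_boot all_order all_algebra.
From mathcomp Require Import all_classical all_reals all_analysis.

Set Implicit Arguments.
Unset Strict Implicit.
Unset Printing Implicit Defensive.

Import Order.TTheory GRing.Theory Num.Theory.
Import numFieldNormedType.Exports.

Local Open Scope classical_set_scope.
Local Open Scope ring_scope.

Canonical pinfty_filter_on (R : numFieldType) :=
  FilterType (pinfty_nbhs R) (@filter_filter R _ proper_pinfty_nbhs).

Section density_classes.
Context {R : realType}.
Local Notation leb := (@lebesgue_measure R).

Definition is_density (h : R -> R) : Prop :=
  [/\ measurable_fun [set: R] h, forall z, 0 <= h z
    & (\int[leb]_z (h z)%:E = 1)%E].

Definition classF0 (h : R -> R) : Prop :=
  [/\ is_density h, forall z, h (- z) = h z
    & (\int[leb]_(z in `]-oo, 1%R]) (h z)%:E = (3 / 4 : R)%:E)%E].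

Definition phi (f1 df1 : R -> R) (z : R) : R := - df1 z / f1 z.

Definition calI (f1 df1 : R -> R) : R :=
  \int[leb]_z (phi f1 df1 z ^+ 2 * f1 z).

Definition calJ (f1 df1 : R -> R) : R :=
  \int[leb]_z (z ^+ 2 * phi f1 df1 z ^+ 2 * f1 z).

Definition calK (f1 df1 : R -> R) : R :=
  \int[leb]_z (z ^+ 4 * phi f1 df1 z ^+ 2 * f1 z).

Definition kappa (f1 df1 : R -> R) : R := calJ f1 df1 / calI f1 df1.

Definition gamma (f1 df1 : R -> R) : R :=
  calK f1 df1 - calJ f1 df1 ^+ 2 / calI f1 df1.

(* classF1 f1 df1: f1 is in F_1, with df1 as a version of its a.e. derivative
   for which phi is monotone.  As x / 0 = 0 here, F1_monotone forces f1 > 0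
   everywhere: at a zero of f1 one has phi = 0, so f1 would be nondecreasing
   before this point and nonincreasing after it, hence identically zero. *)
Record classF1 (f1 df1 : R -> R) : Prop := ClassF1 {
  F1_F0 : classF0 f1 ;
  F1_integrable : forall z1 z2, z1 < z2 ->
    leb.-integrable `[z1, z2] (EFin \o df1) ;
  F1_primitive : forall z1 z2, z1 < z2 ->
    f1 z2 - f1 z1 = \int[leb]_(z in `[z1, z2]) df1 z ;
  F1_monotone : {homo phi f1 df1 : z1 z2 / z1 <= z2} ;
  F1_finiteK : leb.-integrable [set: R]
    (fun z => (z ^+ 4 * phi f1 df1 z ^+ 2 * f1 z)%:E) ;
  F1_tails : exists2 beta : R, 0 < beta &
    ((fun y : R => \int[leb]_(z in `]y, +oo[) f1 z : R^o)
       =O_ (pinfty_nbhs R) (fun y : R => y `^ (- beta) : R^o)) /\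
    ((fun z : R => phi f1 df1 z : R^o)
       =o_ (pinfty_nbhs R) (fun z : R => z `^ (beta / 2 - 2) : R^o)) }.

End density_classes.

Section model.
Context {R : realType}.

Definition zstar_set (f1 df1 : R -> R) (xi : R) : set R :=
  [set z | f1 z = xi * df1 z * (z ^+ 2 - kappa f1 df1)].

Definition zstar (f1 df1 : R -> R) (xi : R) : R := get (zstar_set f1 df1 xi).

(* At xi = 0 the density below does not involve zstar. *)
Definition admissible (f1 df1 : R -> R) (xi : R) : Prop :=
  xi = 0 \/ exists! z, zstar_set f1 df1 xi z.

(* Booleans are cast to R to serve as indicators. *)
Definition skew_density (f1 df1 : R -> R) (theta sigma xi : R) (x : R) : R :=
  let z := (x - theta) / sigma in
  let c := sigma * `|zstar f1 df1 xi| in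
  sigma^-1 * f1 z
  - xi * sigma^-1 * df1 z * (z ^+ 2 - kappa f1 df1) * (`|x - theta| <= c)%R%:R
  + Num.sg xi * sigma^-1 * f1 z *
      ((Num.sg (- xi) * c < x - theta)%R%:R
       - (x - theta < Num.sg xi * c)%R%:R).

(* The density is not required to be nonnegative: for small xi > 0,
   skew_density is negative at the single point x = theta + sigma * zstar. *)
Definition iid_with_density (n : nat) (f : R -> R)
    (Q : probability (n.-tuple R) R) : Prop :=
  forall A : 'I_n -> set R, (forall i, measurable (A i)) ->
  Q [set x | forall i, A i (tnth x i)] =
  (\prod_(i < n) \int[lebesgue_measure]_(x in A i) (f x)%:E)%E.

(* P^(n)_{theta,sigma,xi;f1}: the law characterized by iid_with_density, with
   an arbitrary default value when skew_density is not a density. *)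
Definition Pn (f1 df1 : R -> R) (n : nat) (theta sigma xi : R) :
    probability (n.-tuple R) R :=
  xget (dirac [tuple of nseq n (0 : R)] : probability (n.-tuple R) R)
    [set Q | iid_with_density (skew_density f1 df1 theta sigma xi) Q].

Definition local_xi (tau : R) (n : nat) : R := tau / Num.sqrt n%:R.

Definition local_admissible (f1 df1 : R -> R) (tau : R) : Prop :=
  \forall n \near \oo, admissible f1 df1 (local_xi tau n).

Definition Tn (f1 df1 : R -> R) (n : nat) (x : n.-tuple R)
    (theta sigma : R) : R :=
  (Num.sqrt (n%:R * gamma f1 df1))^-1 *
  \sum_(i < n) (let Z := sigma^-1 * (tnth x i - theta) in
                phi f1 df1 Z * (Z ^+ 2 - kappa f1 df1)).

End model.

Section asymptotics.
Context {R : realType}.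

Definition oP1 (P : forall n, probability (n.-tuple R) R)
    (D : forall n, n.-tuple R -> R) : Prop :=
  forall e : R, 0 < e -> P n [set x | e < `|D n x|] @[n --> \oo] --> 0%E.

Definition asymptotically_normal (P : forall n, probability (n.-tuple R) R)
    (S : forall n, n.-tuple R -> R) (m s : R) : Prop :=
  forall r : R, P n [set x | S n x <= r] @[n --> \oo] -->
    normal_prob m s `]-oo, r].

Definition estimator := forall n, {mfun n.-tuple R >-> R}.

Definition root_n_consistent (P : forall n, probability (n.-tuple R) R)
    (est : estimator) (target : R) : Prop :=
  forall e : R, 0 < e -> exists M : R, \forall n \near \oo,
  (P n [set x | (M < Num.sqrt n%:R * `|est n x - target|)%R] <= e%:E)%E.

Definition asymptotically_discrete (est : estimator) (target : R) : Prop :=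
  forall c : R, 0 < c -> exists M : nat, \forall n \near \oo,
  (range (est n) `&` [set t | `|t - target| <= c / Num.sqrt n%:R]%R
     #<= `I_M)%card.

End asymptotics.

Section optimality.
Context {R : realType}.
Variables (f1 df1 : R -> R).

(* Parameter sets are sets of pairs (theta, sigma). *)
Definition params : set (R * R) := [set p | 0 < p.2].

Definition params_at (theta : R) : set (R * R) :=
  [set p | p.1 = theta /\ 0 < p.2].

Definition C1C2 (target : R * R -> R) (Theta : set (R * R)) (est : estimator) :
    Prop :=
  forall p, Theta p ->
  root_n_consistent (fun n => Pn f1 df1 n p.1 p.2 0) est (target p) /\
  asymptotically_discrete est (target p).

Definition is_test (psi : forall n, n.-tuple R -> R) : Prop :=
  forall n, measurable_fun [set: n.-tuple R] (psi n) /\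
            forall x, 0 <= psi n x <= 1.

Definition asymptotic_level (Theta : set (R * R)) (alpha : R)
    (psi : forall n, n.-tuple R -> R) : Prop :=
  is_test psi /\
  forall p, Theta p ->
  (limn_esup (fun n => 'E_(Pn f1 df1 n p.1 p.2 0)[psi n]) <= alpha%:E)%E.

Definition locally_asymptotically_most_powerful (Theta : set (R * R))
    (alpha : R) (varphi : forall n, n.-tuple R -> R) : Prop :=
  asymptotic_level Theta alpha varphi /\
  forall psi, asymptotic_level Theta alpha psi ->
  forall p tau, Theta p -> 0 < tau -> local_admissible f1 df1 tau ->
  (limn_esup (fun n => 'E_(Pn f1 df1 n p.1 p.2 (local_xi tau n))[psi n]
                     - 'E_(Pn f1 df1 n p.1 p.2 (local_xi tau n))[varphi n])
   <= 0)%E.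

End optimality.

(* Main.v *)
Require Import Defs.
From HB Require Import structures.
From mathcomp Require Import all_boot all_order all_algebra.
From mathcomp Require Import all_classical all_reals all_analysis.
From mathcomp Require Import measurable_realfun ring lra.

Set Implicit Arguments.
Unset Strict Implicit.
Unset Printing Implicit Defensive.

Import Order.TTheory GRing.Theory Num.Theory.
Import numFieldNormedType.Exports.

Local Open Scope classical_set_scope.
Local Open Scope ring_scope.

(** Let psi z = phi z * (z^2 - kappa), which has mean 0 and variance gamma under
    f1.  As phi is monotone and odd off a countable set, for small xi the points
    beyond |z*| are those where |xi psi| >= 1, and the skewed density is almost
    everywhere f1 (1 + clamp (xi psi)) in standardized form, clamp being the
    truncation to [-1, 1].  Hence for xi = tau / sqrt n the likelihood ratio of
    the sample has bounded second moment, which gives contiguity, and its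
    logarithm is tau sqrt gamma T - tau^2 gamma / 2 + o_P(1), T being T^(n) at
    the true parameters.  A Lindeberg argument for triangular arrays, smoothing
    by a Gaussian, yields the limit law of T under both laws, and comparing the
    likelihood ratio with exp (tau sqrt gamma z_alpha - tau^2 gamma / 2) as in
    the Neyman-Pearson lemma yields optimality.

    Replacing (theta, sigma) by a deterministic sequence at distance
    O(n^(-1/2)) changes T by o_P(1): by Chebyshev's inequality it suffices that
    the perturbed score converges in L^2 (f1) and that its mean is o(n^(-1/2)),
    psi being orthogonal to the location score by the choice of kappa and to the
    scale score by parity.  The dominations come from the decay of f1 beyond all
    powers and the polynomial growth of phi.  An asymptotically discrete
    estimator runs through finitely many such sequences. *)

(** * Real-valued integrals *)

(** The score may jump, so it cannot be expanded in (theta, sigma). A substitution turns the mean of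
    the perturbed score under f1 into an integral of the unperturbed score against a perturbed f1.
    At points where phi is continuous, f1 is differentiable with uniformity in both endpoints, which
    suits the simultaneous motion of location and scale. The law of T under the alternatives does
    not go through a joint limit of T and the log-likelihood ratio: the central limit theorem is
    proved for laws that vary with n, and only the mean of the score under the alternative is
    computed. Contiguity has one task, to carry events that are negligible under the null laws over
    to the alternatives: the remainder of the estimated statistic, and the set where the expansion
    of the log-likelihood fails. For optimality, the Neyman-Pearson inequality between the
    differences of power and of size survives up to a small error, because rejection by T and a
    likelihood ratio above its critical value agree up to a factor close to 1. The size of the test
    tends to exactly alpha, that of a competitor is asymptotically at most alpha. *)

Section real_integral.
Context d (T : measurableType d) {R : realType}.
Variable mu : {measure set T -> \bar R}.
Implicit Types f g : T -> R.

Definition intg f := mu.-integrable [set: T] (EFin \o f).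

Lemma intg_measurable f : intg f -> measurable_fun [set: T] f.
Proof. by move=> /integrableP[/measurable_EFinP]. Qed.

Lemma intgD f g : intg f -> intg g -> intg (fun x => f x + g x).
Proof. by move=> If Ig; exact: (integrableD measurableT If Ig). Qed.

Lemma intgB f g : intg f -> intg g -> intg (fun x => f x - g x).
Proof. by move=> If Ig; exact: (integrableB measurableT If Ig). Qed.

Lemma intgZ k f : intg f -> intg (fun x => k * f x).
Proof. by move=> If; exact: (integrableZl measurableT k If). Qed.

Lemma intg_le f g : measurable_fun [set: T] f -> (forall x, `|f x| <= g x) ->
  intg g -> intg f.
Proof.
move=> mf fg Ig; apply: (le_integrable measurableT _ _ Ig).
  exact/measurable_EFinP.
by move=> x _ /=; rewrite lee_fin (le_trans (fg x)) ?ler_norm.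
Qed.

Lemma intg_ge0 f : measurable_fun [set: T] f -> (forall x, 0 <= f x) ->
  (\int[mu]_x (f x)%:E < +oo)%E -> intg f.
Proof.
move=> mf f0 fy; apply/integrableP; split; first exact/measurable_EFinP.
by under eq_integral => x _ do rewrite /= ger0_norm//.
Qed.

Lemma intg_norm f : intg f -> intg (fun x => `|f x|).
Proof. by move=> If; exact: integrable_norm. Qed.

Lemma intg_EFin f : intg f -> (\int[mu]_x (f x)%:E = (\int[mu]_x f x)%:E)%E.
Proof. by move=> If; rewrite fineK//; exact: integrable_fin_num. Qed.

Lemma RintD f g : intg f -> intg g ->
  \int[mu]_x (f x + g x) = \int[mu]_x f x + \int[mu]_x g x.
Proof. by move=> If Ig; rewrite RintegralD. Qed.

Lemma RintB f g : intg f -> intg g ->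
  \int[mu]_x (f x - g x) = \int[mu]_x f x - \int[mu]_x g x.
Proof. by move=> If Ig; rewrite RintegralB. Qed.

Lemma RintZ k f : intg f -> \int[mu]_x (k * f x) = k * \int[mu]_x f x.
Proof. by move=> If; rewrite RintegralZl. Qed.

Lemma le_Rint f g : intg f -> intg g -> (forall x, f x <= g x) ->
  \int[mu]_x f x <= \int[mu]_x g x.
Proof. by move=> If Ig fg; apply: le_Rintegral. Qed.

Lemma le_norm_Rint f g : intg f -> intg g -> (forall x, `|f x| <= g x) ->
  `|\int[mu]_x f x| <= \int[mu]_x g x.
Proof.
move=> If Ig fg; apply: (le_trans (le_normr_Rintegral _ If)) => //.
by apply: le_Rint => //; exact: intg_norm.
Qed.

End real_integral.

Section probability_integral.
Context d (T : measurableType d) {R : realType}.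
Variable P : probability T R.
Implicit Types f g : T -> R.

Lemma integral_prob_cst (c : \bar R) : (\int[P]_x c = c)%E.
Proof.
rewrite integral_cst// -[RHS]mule1; congr (_ * _)%E.
exact: probability_setT.
Qed.

Lemma intg_cst (c : R) : intg P (fun=> c).
Proof. exact: finite_measure_integrable_cst. Qed.

Lemma Rint_cst (c : R) : \int[P]_x c = c.
Proof. by rewrite /Rintegral integral_prob_cst. Qed.

Lemma intg_bounded f M : measurable_fun [set: T] f -> (forall x, `|f x| <= M) ->
  intg P f.
Proof. by move=> mf fM; apply: intg_le (intg_cst M). Qed.

Lemma Rint_affine2 a b c f g : intg P f -> intg P g ->
  \int[P]_x (a + b * f x + c * g x) =
  a + b * \int[P]_x f x + c * \int[P]_x g x.
Proof.
move=> If Ig; rewrite RintD; [|by apply: intgD; [exact: intg_cst|exact: intgZ]|exact: intgZ].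
rewrite RintD; [|exact: intg_cst|exact: intgZ].
by rewrite Rint_cst !RintZ.
Qed.

End probability_integral.

(** * Change of variables with a weight, for signed integrands *)

Section transfer.
Context d1 d2 (T1 : measurableType d1) (T2 : measurableType d2) {R : realType}.
Variables (mu : {measure set T1 -> \bar R}) (nu : {measure set T2 -> \bar R}).
Variables (t : T2 -> T1) (w : T2 -> R).
Hypotheses (mt : measurable_fun [set: T2] t) (mw : measurable_fun [set: T2] w).
Hypothesis w0 : forall x, 0 <= w x.
Hypothesis munu : forall h : T1 -> R, measurable_fun [set: T1] h ->
  (forall x, 0 <= h x) ->
  (\int[mu]_x (h x)%:E = \int[nu]_x (h (t x) * w x)%:E)%E.

Lemma intg_transfer (f : T1 -> R) : measurable_fun [set: T1] f ->
  intg nu (fun x => f (t x) * w x) -> intg mu f.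
Proof.
move=> mf If; apply/integrableP; split; first exact/measurable_EFinP.
rewrite (munu (_ : measurable_fun _ (fun x => `|f x|)))//; last first.
  exact: measurableT_comp.
under eq_integral => x _ do rewrite -(ger0_norm (w0 x)) -normrM.
by have /integrableP[_] := If.
Qed.

(** The identity [munu] for nonnegative functions is applied to the positive and negative parts.
    Changes of density, affine substitutions, reflection and the passage to standardized variables
    are all instances. *)
Lemma Rint_transfer (f : T1 -> R) : measurable_fun [set: T1] f ->
  intg nu (fun x => f (t x) * w x) ->
  \int[mu]_x f x = \int[nu]_x (f (t x) * w x).
Proof.
move=> mf If.
have nn (g : T1 -> R) : measurable_fun [set: T1] g -> (forall x, 0 <= g x) ->
    \int[mu]_x g x = \int[nu]_x (g (t x) * w x).
  by move=> mg g0; rewrite /Rintegral munu.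
pose p x := Num.max (f x) 0; pose q x := Num.max (- f x) 0.
have mp : measurable_fun [set: T1] p by exact: measurable_maxr.
have mq : measurable_fun [set: T1] q.
  by apply: measurable_maxr => //; exact: measurableT_comp.
have p0 x : 0 <= p x by rewrite /p le_max lexx orbT.
have q0 x : 0 <= q x by rewrite /q le_max lexx orbT.
have fpq x : f x = p x - q x.
  by rewrite /p /q; case: (leP (f x) 0); case: (leP (- f x) 0); lra.
have pf x : p x <= `|f x| by rewrite /p ge_max normr_ge0 ler_norm.
have qf x : q x <= `|f x| by rewrite /q ge_max normr_ge0 andbT -normrN ler_norm.
have dom (g : T1 -> R) : measurable_fun [set: T1] g -> (forall x, 0 <= g x) ->
    (forall x, g x <= `|f x|) -> intg nu (fun x => g (t x) * w x).
  move=> mg g0 gf; apply: (intg_le _ _ (intg_norm If)).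
    by apply: measurable_funM => //; exact: measurableT_comp.
  by move=> x; rewrite !normrM ler_wpM2r// ger0_norm.
have Ip := dom _ mp p0 pf; have Iq := dom _ mq q0 qf.
under eq_Rintegral => x _ do rewrite fpq.
rewrite RintB ?nn//; [|exact: intg_transfer|exact: intg_transfer].
rewrite -RintB//.
by apply: eq_Rintegral => x _; rewrite fpq mulrBl.
Qed.

End transfer.

(** * Taylor bounds and the normal distribution function *)

Section taylor.
Context {R : realType}.
Implicit Types f df ddf : R -> R.

(** Hypotheses on a ball about [a] make the statement symmetric, so that the Taylor bounds can use
    increments of either sign. *)
Lemma mvt_norm f df (a b M : R) :
  (forall x, `|x - a| <= `|b - a| -> is_derive x (1 : R) f (df x)) ->
  (forall x, `|x - a| <= `|b - a| -> `|df x| <= M) ->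
  `|f b - f a| <= M * `|b - a|.
Proof.
move=> dfE dfM.
have cont x y : (forall z, z \in `[x, y] -> `|z - a| <= `|b - a|) ->
    {within `[x, y], continuous f}.
  move=> zab; apply: derivable_within_continuous => z /zab zxy.
  exact: @ex_derive _ _ _ _ _ _ _ (dfE z zxy).
have [ab|ba|->] := ltgtP a b; last by rewrite !subrr normr0 mulr0.
- have abz z : z \in `[a, b] -> `|z - a| <= `|b - a|.
    by rewrite in_itv/= => /andP[az zb]; rewrite !ger0_norm ?subr_ge0//; lra.
  have [c cab ->] := MVT ab (fun x xab => dfE x (abz x (subset_itv_oo_cc xab)))
    (cont _ _ abz).
  by rewrite normrM ler_wpM2r// dfM// abz// subset_itv_oo_cc.
- have abz z : z \in `[b, a] -> `|z - a| <= `|b - a|.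
    by rewrite in_itv/= => /andP[az zb]; rewrite !ler0_norm ?subr_le0//; lra.
  have [c cab] := MVT ba (fun x xab => dfE x (abz x (subset_itv_oo_cc xab)))
    (cont _ _ abz).
  rewrite distrC => ->; rewrite normrM (distrC b a) ler_wpM2r// dfM// abz//.
  exact: subset_itv_oo_cc.
Qed.

(** The remainder is treated as a function of the endpoint: its derivative is a remainder of one
    order less, to which the same inequality applies. The factorials of the sharp constants are
    given up. *)
Lemma taylor2 f df ddf (M : R) :
  (forall x, is_derive x (1 : R) f (df x)) ->
  (forall x, is_derive x (1 : R) df (ddf x)) ->
  (forall x, `|ddf x| <= M) ->
  forall a h, `|f (a + h) - f a - h * df a| <= M * h ^+ 2.
Proof.
move=> dfE ddfE ddfM a h.
pose F x := f x - (x - a) * df a.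
have dF x : is_derive x (1 : R) F (df x - df a).
  by apply: is_derive_eq; rewrite /GRing.scale/=; ring.
have -> : f (a + h) - f a - h * df a = F (a + h) - F a by rewrite /F; ring.
have M0 : 0 <= M by apply: le_trans (ddfM 0).
rewrite -real_normK ?num_real// expr2 mulrA.
have {3}-> : h = a + h - a by ring.
apply: (@mvt_norm _ _ _ _ _ (fun x _ => dF x)) => x xa.
apply: (@le_trans _ _ (M * `|x - a|)).
  by apply: (@mvt_norm _ _ _ _ _ (fun x _ => ddfE x)) => *; exact: ddfM.
by rewrite ler_wpM2l//; apply: le_trans xa _; rewrite addrAC subrr add0r.
Qed.

Lemma taylor3 f df ddf dddf (M : R) :
  (forall x, is_derive x (1 : R) f (df x)) ->
  (forall x, is_derive x (1 : R) df (ddf x)) ->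
  (forall x, is_derive x (1 : R) ddf (dddf x)) ->
  (forall x, `|dddf x| <= M) ->
  forall a h,
    `|f (a + h) - f a - h * df a - h ^+ 2 / 2 * ddf a| <= M * `|h| ^+ 3.
Proof.
move=> dfE ddfE dddfE dddfM a h.
pose F x := f x - (x - a) * df a - (x - a) ^+ 2 / 2 * ddf a.
have dF x : is_derive x (1 : R) F (df x - df a - (x - a) * ddf a).
  by apply: is_derive_eq; rewrite /GRing.scale/=; field.
have -> : f (a + h) - f a - h * df a - h ^+ 2 / 2 * ddf a = F (a + h) - F a.
  by rewrite /F; ring.
have M0 : 0 <= M by apply: le_trans (dddfM 0).
rewrite exprSr mulrA.
have {3}-> : h = a + h - a by ring.
apply: (@mvt_norm _ _ _ _ _ (fun x _ => dF x)) => x xa.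
have := @taylor2 _ _ _ _ ddfE dddfE dddfM a (x - a).
rewrite (_ : a + (x - a) = x); last by ring.
move/le_trans; apply.
rewrite ler_wpM2l// -[leLHS]real_normK ?num_real// lerXn2r ?nnegrE//.
by apply: le_trans xa _; rewrite addrAC subrr add0r.
Qed.

(** The remainder has derivative x^2 / (1 + x), and 1 + x >= 1/2 gives the factor 2. *)
Lemma ln1p_taylor (a : R) : `|a| <= 2^-1 ->
  `|ln (1 + a) - a + a ^+ 2 / 2| <= 2 * `|a| ^+ 3.
Proof.
move=> a2; pose F x : R := ln (1 + x) - x + x ^+ 2 / 2.
have sm x : `|x - 0| <= `|a - 0| -> 2^-1 <= 1 + x /\ `|x| <= `|a|.
  rewrite !subr0 => xa; split => //.
  by have := le_trans xa a2; rewrite ler_norml => /andP[]; lra.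
have dF x : `|x - 0| <= `|a - 0| -> is_derive x (1 : R) F (x ^+ 2 / (1 + x)).
  move=> /sm[x0 _]; have x1 : 0 < 1 + x by lra.
  have ? : is_derive x (1 : R) (fun y : R => ln (1 + y)) (1 + x)^-1.
    have ? := is_derive1_ln x1.
    rewrite (_ : (fun _ => _) = (@ln R) \o (fun y => 1 + y))//.
    by apply: is_derive_eq; rewrite /GRing.scale/=; ring.
  by apply: is_derive_eq; rewrite /GRing.scale/=; field; rewrite gt_eqF.
have -> : ln (1 + a) - a + a ^+ 2 / 2 = F a - F 0.
  by rewrite /F addr0 ln1; ring.
rewrite exprSr mulrA -{3}(subr0 a).
apply: (mvt_norm dF) => x /sm[x0 xa].
rewrite normrM normrX normfV mulrC ler_pM//.
  rewrite gtr0_norm; last by lra.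
  by rewrite invf_ple ?posrE; lra.
by rewrite lerXn2r ?nnegrE.
Qed.

End taylor.

(** * The normal distribution function and the heat equation *)

Section normal_cdf.
Context {R : realType}.
Implicit Types x y s : R.

Definition gpdf : R -> R := normal_pdf 0 1.

Definition gcdf (x : R) : R := fine (normal_prob 0 1 `]-oo, x]).

Lemma gpdfE x : gpdf x = normal_peak 1 * expR (- x ^+ 2 / 2).
Proof.
by rewrite /gpdf normal_pdfE ?oner_neq0// /normal_fun subr0 expr1n.
Qed.

Lemma gcdfE x : (normal_prob 0 1 `]-oo, x] = (gcdf x)%:E)%E.
Proof. by rewrite fineK// fin_num_measure. Qed.

Lemma gcdf_ge0 x : 0 <= gcdf x.
Proof. exact: fine_ge0. Qed.

Lemma gcdf_le1 x : gcdf x <= 1.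
Proof. by rewrite -lee_fin -gcdfE probability_le1. Qed.

Lemma gcdf_nd : {homo gcdf : x y / x <= y}.
Proof.
move=> x y xy; rewrite -lee_fin -!gcdfE le_measure ?inE//.
by apply: subset_itvl; rewrite bnd_simp.
Qed.

(** The limits of a distribution function are stated for random variables; the identity is one with
    law [normal_prob]. *)
Let idR : measurableTypeR R -> R := idfun.
HB.instance Definition _ :=
  @isMeasurableFun.Build _ _ _ _ idR (@measurable_id _ _ setT).

Lemma gcdf_cvgy : gcdf x @[x --> +oo] --> (1 : R).
Proof.
exact: fine_cvg (@cvg_cdfy1 _ _ _ (normal_prob (0 : R) 1)
  (idR : {mfun _ >-> _})).
Qed.

Lemma gcdf_cvgNy : gcdf x @[x --> -oo] --> (0 : R).
Proof.
exact: fine_cvg (@cvg_cdfNy0 _ _ _ (normal_prob (0 : R) 1)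
  (idR : {mfun _ >-> _})).
Qed.

Lemma is_derive_gcdf x : is_derive x 1 gcdf (gpdf x).
Proof.
have [] := @continuous_FTC1 R gpdf -oo%O x (x + 1) _ _ _ _.
- by rewrite ltrDl.
- by apply: integrableS (integrable_normal_pdf 0 1).
- by rewrite ltNyr.
- exact: continuous_normal_pdf.
by move=> dG <-; rewrite derive1E; exact: derivableP.
Qed.

Lemma is_derive_gpdf x : is_derive x 1 gpdf (- x * gpdf x).
Proof.
rewrite (_ : gpdf = fun x => normal_peak 1 * expR (- x ^+ 2 / 2)); last first.
  by apply/funext => y; rewrite gpdfE.
apply: is_derive_eq; by rewrite /GRing.scale/=; field.
Qed.

(** Squaring 1 + t <= exp t at t = x^2 / 4 gives exp (x^2 / 2) >= (1 + x^2 / 4)^2 >= (1 + x^4) / 16.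
    This one bound covers all the derivatives estimated below, which are [gpdf] times polynomials
    dominated by 1 + x^4. *)
Lemma gpdf_poly x : (1 + x ^+ 4) * gpdf x <= 16 * normal_peak 1.
Proof.
rewrite gpdfE mulrCA mulrC ler_wpM2r ?normal_peak_ge0//.
rewrite mulNr expRN ler_pdivrMr ?expR_gt0//.
have -> : x ^+ 2 / 2 = x ^+ 2 / 4 + x ^+ 2 / 4 by field.
rewrite expRD -expr2.
have h : 1 + x ^+ 2 / 4 <= expR (x ^+ 2 / 4) by exact: expR_ge1Dx.
have := sqr_ge0 x => x0.
apply: (@le_trans _ _ (16 * (1 + x ^+ 2 / 4) ^+ 2)).
  have -> : x ^+ 4 = (x ^+ 2) ^+ 2 by ring.
  nra.
rewrite ler_wpM2l// lerXn2r ?nnegrE ?expR_ge0//; lra.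
Qed.


Local Notation M := (16 * normal_peak (1 : R)).

Lemma gpdf_ge0 x : 0 <= gpdf x.
Proof. exact: normal_pdf_ge0. Qed.

Let poly_gpdf_le x y : `|y| <= 1 + x ^+ 4 -> `|y * gpdf x| <= M.
Proof.
move=> h; rewrite normrM (ger0_norm (gpdf_ge0 x)).
by apply: le_trans (gpdf_poly x); rewrite ler_wpM2r ?gpdf_ge0.
Qed.

Lemma gcdf_taylor w h :
  `|gcdf (w + h) - gcdf w - h * gpdf w - h ^+ 2 / 2 * (- w * gpdf w)|
    <= M * `|h| ^+ 3.
Proof.
apply: (@taylor3 R gcdf gpdf (fun x => - x * gpdf x)
  (fun x => (x ^+ 2 - 1) * gpdf x) M _ _ _ _ w h).
- exact: is_derive_gcdf.
- exact: is_derive_gpdf.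
- move=> x; have := is_derive_gpdf x => ?.
  by apply: is_derive_eq; rewrite /GRing.scale/=; ring.
- move=> x; apply: poly_gpdf_le; rewrite ler_norml; have := sqr_ge0 x.
  by rewrite (_ : x ^+ 4 = (x ^+ 2) ^+ 2); [nra|ring].
Qed.

(** Here v is the logarithm of a variance. In this parameter the derivatives depend on b and v only
    through y = b exp (-v / 2): they are -(y / 2) gpdf y and (y - y^3) / 4 gpdf y, so the bound is
    uniform in b and v. *)
Lemma gcdf_expR_taylor b v h :
  `|gcdf (b * expR (- (v + h) / 2)) - gcdf (b * expR (- v / 2))
    - h * (- (b * expR (- v / 2) / 2 * gpdf (b * expR (- v / 2))))|
    <= M * h ^+ 2.
Proof.
apply: (@taylor2 R (fun v => gcdf (b * expR (- v / 2)))
  (fun v => - (b * expR (- v / 2) / 2 * gpdf (b * expR (- v / 2))))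
  (fun v => let y := b * expR (- v / 2) in (y - y ^+ 3) / 4 * gpdf y)
  M _ _ _ v h).
- move=> x; have := is_derive_gcdf (b * expR (- x / 2)) => ?.
  have ? : is_derive x 1 (fun v => b * expR (- v / 2)) (- (b * expR (- x / 2)) / 2).
    by apply: is_derive_eq; rewrite /GRing.scale/=; field.
  have -> : (fun v0 : R => gcdf (b * expR (- v0 / 2))) =
    gcdf \o (fun v => b * expR (- v / 2)) by [].
  by apply: is_derive_eq; rewrite /GRing.scale/=; field.
- move=> x; have := is_derive_gpdf (b * expR (- x / 2)) => ?.
  have ? : is_derive x 1 (fun v => b * expR (- v / 2)) (- (b * expR (- x / 2)) / 2).
    by apply: is_derive_eq; rewrite /GRing.scale/=; field.
  have ? : is_derive x 1 (fun v => gpdf (b * expR (- v / 2)))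
     ((- (b * expR (- x / 2)) * gpdf (b * expR (- x / 2))) * (- (b * expR (- x / 2)) / 2)).
    have -> : (fun v0 : R => gpdf (b * expR (- v0 / 2))) =
      gpdf \o (fun v => b * expR (- v / 2)) by [].
    by apply: is_derive_eq; rewrite /GRing.scale/=; field.
  by apply: is_derive_eq; rewrite /GRing.scale/=; field.
- move=> x; set y := b * _ => /=; apply: poly_gpdf_le.
  have h1 := sqr_ge0 (y ^+ 2); have h2 := sqr_ge0 (y * (y - 1)).
  have h3 := sqr_ge0 (y * (y + 1)); have h4 := sqr_ge0 (y - 1).
  have h5 := sqr_ge0 (y + 1).
  rewrite ler_norml; apply/andP; split; nra.
Qed.

(* [heat s x] is P(sqrt s * N <= x) for N standard normal: replacing one summand
   by a Gaussian of variance d in Lindeberg's argument is a time step d. *)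
Definition heat s x := gcdf (x / Num.sqrt s).

(** A second-order expansion in space and a first-order one in time. By the heat equation the time
    derivative is half the second space derivative, which is why a single [B] multiplies y^2 - d:
    the term has mean zero once y has variance d. *)
Lemma heat_expansion e : 0 < e -> exists2 C, 0 <= C &
  forall s d x, e <= s -> 0 <= d -> exists A B, `|B| <= C /\
  forall y, `|heat s (x - y) - heat (s + d) x - (A * y + B * (y ^+ 2 - d))|
    <= C * (`|y| ^+ 3 + d ^+ 2).
Proof.
move=> e0; have M0 : 0 <= M by rewrite mulr_ge0// normal_peak_ge0.
have se0 : 0 < Num.sqrt e by rewrite sqrtr_gt0.
have C1 : 0 <= M / e by rewrite divr_ge0// ltW.
have C2 : 0 <= M / e ^+ 2 by rewrite divr_ge0// exprn_ge0// ltW.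
have C3 : 0 <= M / (Num.sqrt e) ^+ 3 by rewrite divr_ge0// exprn_ge0// ltW.
(* [M / e] bounds [B]; the two terms in e^2 bound the time remainder and the cost of replacing the
   logarithmic step [h] by d / s; the last one bounds the space remainder. *)
exists (M / e + 2 * (M / e ^+ 2) + M / (Num.sqrt e) ^+ 3); first lra.
move=> s d x es d0; have s0 : 0 < s by apply: lt_le_trans es.
have ss0 : 0 < Num.sqrt s by rewrite sqrtr_gt0.
set q := (Num.sqrt s)^-1; set w := x * q.
have q0 : 0 < q by rewrite invr_gt0.
have q2 : q ^+ 2 = s^-1 by rewrite /q exprVn sqr_sqrtr// ltW.
have expln t : 0 < t -> expR (- ln t / 2) = (Num.sqrt t)^-1.
  move=> t0; rewrite mulNr expRN; congr (_^-1).
  by rewrite -powR12_sqrt ?ltW// /powR gt_eqF// mulrC.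
set a := d / s; set h := ln (s + d) - ln s.
have a0 : 0 <= a by rewrite divr_ge0// ltW.
have hE : h = ln (1 + a).
  rewrite /h -ln_div ?posrE//; last by rewrite ltr_wpDr.
  by congr ln; rewrite /a; field; rewrite gt_eqF.
have h0 : 0 <= h by rewrite hE ln_ge0// lerDl.
have ha : h <= a by rewrite hE le_ln1Dx// (lt_le_trans _ a0)// ltrN10.
(* From ln (1 / (1 + a)) <= - a / (1 + a), hence h >= a / (1 + a) >= a - a^2. With h <= a, the
   logarithmic step is a = d / s up to a^2. *)
have ah : a - a ^+ 2 <= h.
  have := @le_ln1Dx R (- (a / (1 + a))).
  have -> : 1 + - (a / (1 + a)) = (1 + a)^-1 by field; rewrite gt_eqF// ltr_wpDr.
  rewrite lnV ?posrE ?ltr_wpDr// -hE ltrN2 ltr_pdivrMr ?ltr_wpDr//.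
  rewrite mul1r ltrDr ltr01 => /(_ isT).
  rewrite lerN2; apply: le_trans; rewrite ler_pdivlMr ?ltr_wpDr//.
  by have := mulr_ge0 a0 (mulr_ge0 a0 a0); nra.
have T1 y := gcdf_taylor w (- (y * q)).
have T2 := gcdf_expR_taylor x (ln s) h.
have vh : ln s + h = ln (s + d) by rewrite /h addrC subrK.
rewrite vh !expln ?ltr_wpDr// -/q -/w in T2.
set m := w * gpdf w.
have mM : `|m| <= M.
  apply: poly_gpdf_le; rewrite ler_norml; have := sqr_ge0 (w ^+ 2).
  have := sqr_ge0 (w - 1); have := sqr_ge0 (w + 1); have := sqr_ge0 (w ^+ 2 - 1).
  by rewrite -exprM; nra.
(* The first space derivative, with the sign of the increment -y, and half the second one. *)
exists (- q * gpdf w), (- m / (2 * s)).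
have dsE : d = a * s by rewrite /a divfK// gt_eqF.
split.
  rewrite normrM normrN (ger0_norm (_ : 0 <= (2 * s)^-1)); last first.
    by rewrite invr_ge0 mulr_ge0// ltW.
  apply: (@le_trans _ _ (M / e)); last by lra.
  rewrite ler_pM// ?invr_ge0 ?mulr_ge0 ?ltW//.
  by rewrite ltf_pV2 ?posrE ?mulr_gt0//; lra.
move=> y.
have {}T1 := T1 y.
have aM : `|(h - a) * m / 2| <= M * a ^+ 2.
  rewrite -mulrA normrM (mulrC M) ler_pM//.
    by rewrite ler_norml; apply/andP; split; lra.
  by rewrite normrM (@ger0_norm _ 2^-1) ?invr_ge0//; lra.
have Mh : M * h ^+ 2 <= M * a ^+ 2.
  by rewrite ler_wpM2l// lerXn2r ?nnegrE.
have a2 : M * a ^+ 2 <= M / e ^+ 2 * d ^+ 2.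
  have -> : M * a ^+ 2 = M / s ^+ 2 * d ^+ 2.
    by rewrite /a; field; rewrite gt_eqF.
  rewrite ler_wpM2r ?sqr_ge0// ler_wpM2l// lef_pV2 ?posrE ?exprn_gt0//.
  by rewrite lerXn2r ?nnegrE// ltW.
have y3 : M * `|- (y * q)| ^+ 3 <= M / (Num.sqrt e) ^+ 3 * `|y| ^+ 3.
  have -> : M * `|- (y * q)| ^+ 3 = M / Num.sqrt s ^+ 3 * `|y| ^+ 3.
    by rewrite normrN normrM (gtr0_norm q0) /q; field; rewrite gt_eqF.
  rewrite ler_wpM2r ?exprn_ge0// ler_wpM2l// lef_pV2 ?posrE ?exprn_gt0//.
  by rewrite lerXn2r ?nnegrE ?(ltW se0) ?(ltW ss0)// ler_wsqrtr.
rewrite /heat mulrBl -/q -/w.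
set P := gcdf (w + _) in T1.
have -> : w - y * q = w + - (y * q) by [].
rewrite -/P; set Q := gcdf (x / Num.sqrt (s + d)); rewrite -/Q in T2.
have -> : P - Q - (- q * gpdf w * y + - m / (2 * s) * (y ^+ 2 - d)) =
  (P - gcdf w - - (y * q) * gpdf w - (- (y * q)) ^+ 2 / 2 * (- w * gpdf w))
  - (Q - gcdf w - h * - (w / 2 * gpdf w)) + (h - a) * m / 2.
  rewrite sqrrN exprMn q2 /m dsE; field; by rewrite gt_eqF.
apply: le_trans (ler_normD _ _) _.
apply: le_trans (lerD (ler_normB _ _) aM) _.
have y0 : 0 <= `|y| ^+ 3 by rewrite exprn_ge0.
have d20 : 0 <= d ^+ 2 by rewrite sqr_ge0.
by nra.
Qed.

End normal_cdf.

(** * Product laws *)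

Section iid_product.
Context d (T : measurableType d) {R : realType}.
Local Open Scope ereal_scope.

Definition cons_prod n (z : T * n.-tuple T) : n.+1.-tuple T :=
  [the n.+1.-tuple T of z.1 :: z.2].

Lemma measurable_cons_prod n : measurable_fun [set: T * n.-tuple T] (@cons_prod n).
Proof. by apply: (@measurable_cons _ _ _ _ fst n snd). Qed.

HB.instance Definition _ n :=
  @isMeasurableFun.Build _ _ _ _ (@cons_prod n) (@measurable_cons_prod n).

(** The recursive form makes an integral over n + 1 coordinates an iterated one with the first
    coordinate outermost, the shape of every induction on n below. *)
Fixpoint iid (P : probability T R) (n : nat) : probability (n.-tuple T) R :=
  match n with
  | 0 => (dirac [tuple] : probability _ R)
  | n.+1 => distribution ((P \x iid P n)%E : probability _ R) (@cons_prod n)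
  end.

Variable P : probability T R.

Lemma measurable_consx n (y : T) :
  measurable_fun [set: n.-tuple T] (fun z => cons_prod (y, z)).
Proof. by apply: (@measurable_cons _ _ _ _ (cst y) n id). Qed.

Lemma measurable_integral_iid n (F : n.+1.-tuple T -> \bar R) :
  measurable_fun [set: n.+1.-tuple T] F -> (forall z, 0 <= F z) ->
  measurable_fun [set: T] (fun y => \int[iid P n]_z F (cons_prod (y, z))).
Proof.
move=> mF F0.
apply: (@measurable_fun_fubini_tonelli_F _ _ _ _ _ _ (F \o @cons_prod n)) => //.
  exact: measurableT_comp.
by move=> x; exact: F0.
Qed.

Lemma iid_tonelli n (F : n.+1.-tuple T -> \bar R) :
  measurable_fun [set: n.+1.-tuple T] F -> (forall z, 0 <= F z) ->
  \int[iid P n.+1]_z F z = \int[P]_y \int[iid P n]_z F (cons_prod (y, z)).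
Proof.
move=> mF F0 /=; rewrite ge0_integral_distribution//.
rewrite fubini_tonelli1//; first exact: measurableT_comp.
by move=> x; exact: F0.
Qed.

Lemma iid0_integral (F : 0.-tuple T -> \bar R) :
  measurable_fun [set: 0.-tuple T] F -> \int[iid P 0]_z F z = F [tuple].
Proof. by move=> mF /=; rewrite integral_dirac// diracT mul1e. Qed.

Lemma measurable_rect n (A : 'I_n -> set T) : (forall i, measurable (A i)) ->
  measurable [set z : n.-tuple T | forall i, A i (tnth z i)].
Proof.
move=> mA; rewrite (_ : [set _ | _] =
    \bigcap_(i in [set: 'I_n]) ((fun z => tnth z i) @^-1` A i)); last first.
  by apply/seteqP; split => z /= h i => [_|]; exact: h.
apply: fin_bigcap_measurable => // i _; rewrite -[X in measurable X]setTI.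
exact: measurable_tnth.
Qed.

Lemma iid_rect n (A : 'I_n -> set T) : (forall i, measurable (A i)) ->
  iid P n [set z | forall i, A i (tnth z i)] = \prod_(i < n) P (A i).
Proof.
elim: n A => [|n IH] A mA.
  rewrite big_ord0 /= diracE mem_set//= => i; by case: i.
rewrite big_ord_recl -IH//= /distribution /pushforward.
rewrite -product_measure1E//; last first.
  by apply: (@measurable_rect n (fun i => A (lift ord0 i))) => i; exact: mA.
congr (_ _); apply/seteqP; split => -[y z]/=.
  move=> h; split; first by have := h ord0; rewrite tnth0.
  by move=> i; have := h (lift ord0 i); rewrite tnthS.
move=> [hy hz] i; case: (unliftP ord0 i) => [j|] ->; last by rewrite tnth0.
by rewrite tnthS.
Qed.

End iid_product.

(** * Laws with a density *)

Section density.
Context d (T : measurableType d) {R : realType}.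
Local Open Scope ereal_scope.

(** The change of variables holds with the Radon-Nikodym derivative, and [l] agrees with it almost
    everywhere because both integrate to [nu] on every measurable set. *)
Lemma ge0_integral_density (mu : {sigma_finite_measure set T -> \bar R})
    (nu : probability T R) (l : T -> R) :
  measurable_fun [set: T] l -> (forall x, 0 <= l x)%R ->
  (forall A, measurable A -> nu A = \int[mu]_(x in A) (l x)%:E) ->
  forall h : T -> \bar R, measurable_fun [set: T] h -> (forall x, 0 <= h x) ->
  \int[nu]_x h x = \int[mu]_x (h x * (l x)%:E).
Proof.
move=> ml l0 nuE h mh h0.
have numu : nu `<< mu.
  apply/null_content_dominatesP => A mA muA; rewrite nuE//.
  apply: null_set_integral => //; apply/measurable_EFinP.
  exact: measurable_funTS.
rewrite -(Radon_Nikodym_SigmaFinite.change_of_variables numu)//.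
have ae : ae_eq mu setT (Radon_Nikodym_SigmaFinite.f nu mu) (EFin \o l).
  apply: integral_ae_eq => //.
  - exact: Radon_Nikodym_SigmaFinite.f_integrable.
  - exact/measurable_EFinP.
  - move=> E _ mE; rewrite -(Radon_Nikodym_SigmaFinite.f_integral numu)//.
    exact: nuE.
apply: ge0_ae_eq_integral => //.
- apply: emeasurable_funM => //.
  by have /integrableP[] := Radon_Nikodym_SigmaFinite.f_integrable numu.
- by apply: emeasurable_funM => //; exact/measurable_EFinP.
- by move=> x _; rewrite mule_ge0// Radon_Nikodym_SigmaFinite.f_ge0.
- by move=> x _; rewrite mule_ge0// lee_fin.
- exact: ae_eqe_mul2l.
Qed.

Section density_prob.
Variables (mu : {measure set T -> \bar R}) (l : T -> R).
Hypotheses (ml : measurable_fun [set: T] l) (l0 : forall x, (0 <= l x)%R).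
Hypothesis l1 : \int[mu]_x (l x)%:E = 1.

(** The hypotheses are arguments of the set function so that the measure and probability structures,
    whose proofs rest on them, can be attached to it. *)
Definition density_prob_of & measurable_fun [set: T] l & (forall x, (0 <= l x)%R)
  & \int[mu]_x (l x)%:E = 1 : set T -> \bar R :=
  fun A => \int[mu]_(x in A) (l x)%:E.

Local Notation density_prob := (density_prob_of ml l0 l1).

Let density0 : density_prob set0 = 0.
Proof. by rewrite /density_prob_of integral_set0. Qed.

Let density_ge0 A : 0 <= density_prob A.
Proof. by apply: integral_ge0 => x _; rewrite lee_fin. Qed.

Let density_additive : semi_sigma_additive density_prob.
Proof.
move=> /= A mA tA mUA.
rewrite /density_prob_of ge0_integral_bigcup//=.
- apply: is_cvg_ereal_nneg_natsum_cond => n _ _.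
  by apply: integral_ge0 => /= x ?; rewrite lee_fin.
- exact/measurable_EFinP/measurable_funTS.
- by move=> x _; rewrite lee_fin.
Qed.

HB.instance Definition _ := isMeasure.Build _ _ _ density_prob
  density0 density_ge0 density_additive.

HB.instance Definition _ :=
  @Measure_isProbability.Build _ _ R density_prob l1.

Lemma exists_density_prob : exists nu : probability T R,
  forall A, measurable A -> nu A = \int[mu]_(x in A) (l x)%:E.
Proof. by exists density_prob. Qed.

End density_prob.

End density.

Section iid_theory.
Context d (T : measurableType d) {R : realType}.
Variable P : probability T R.
Local Open Scope ereal_scope.

(** Rectangles are stable under intersection, and they generate the sigma-algebra since an event on
    one coordinate is a rectangle with full sides elsewhere. As [iid_with_density] speaks of
    rectangles only, this is what identifies [Pn]. *)
Lemma iid_unique n (Q : probability (n.-tuple T) R) :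
  (forall A : 'I_n -> set T, (forall i, measurable (A i)) ->
    Q [set z | forall i, A i (tnth z i)] = \prod_(i < n) P (A i)) ->
  forall A, measurable A -> Q A = iid P n A.
Proof.
move=> QE; pose G := [set B | exists2 A : 'I_n -> set T,
  forall i, measurable (A i) & B = [set z | forall i, A i (tnth z i)]].
apply: (measure_unique G (fun=> setT)).
- apply/seteqP; split.
    apply: smallest_sub; first exact: smallest_sigma_algebra.
    move=> B; rewrite -bigcup_seq => -[/= i _ [A mA <-]].
    apply: sub_sigma_algebra; exists (fun j => if j == i then A else setT).
      by move=> j; case: ifP.
    apply/seteqP; split => z /=.
      by move=> [_ Az] j; case: eqP => // ->.
    by move=> /(_ i); rewrite eqxx.
  apply: smallest_sub; first exact: sigma_algebra_measurable.
  by move=> B [A mA ->]; exact: measurable_rect.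
- move=> A B [A' mA ->] [B' mB ->]; exists (fun i => A' i `&` B' i).
    by move=> i; exact: measurableI.
  apply/seteqP; split => z /=; first by move=> [h1 h2] i; split.
  by move=> h; split => i; have [] := h i.
- move=> _; exists (fun=> setT) => //.
  by apply/seteqP; split.
- by apply/seteqP; split => // x _; exists 0%N.
- by move=> A [A' mA ->]; have := QE _ mA; have := iid_rect P mA => <-.
- by move=> _; apply: le_lt_trans (probability_le1 Q measurableT) _; rewrite ltry.
Qed.

Lemma measurable_iid_sum n (g : T -> R) : measurable_fun [set: T] g ->
  measurable_fun [set: n.-tuple T] (fun z => \sum_(i < n) g (tnth z i))%R.
Proof.
move=> mg; apply: measurable_sum => i.
by apply: measurableT_comp => //; exact: measurable_tnth.
Qed.

Lemma measurable_iid_prod n (g : T -> R) : measurable_fun [set: T] g ->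
  measurable_fun [set: n.-tuple T] (fun z => \prod_(i < n) g (tnth z i))%R.
Proof.
move=> mg; apply: measurable_prod => i _.
by apply: measurableT_comp => //; exact: measurable_tnth.
Qed.

Lemma cons_prod_sum n (g : T -> R) y (z : n.-tuple T) :
  (\sum_(i < n.+1) g (tnth (cons_prod (y, z)) i) =
   g y + \sum_(i < n) g (tnth z i))%R.
Proof.
rewrite big_ord_recl tnth0; congr (_ + _)%R.
by apply: eq_bigr => i _; rewrite tnthS.
Qed.

Lemma cons_prod_prod n (g : T -> R) y (z : n.-tuple T) :
  (\prod_(i < n.+1) g (tnth (cons_prod (y, z)) i) =
   g y * \prod_(i < n) g (tnth z i))%R.
Proof.
rewrite big_ord_recl tnth0; congr (_ * _)%R.
by apply: eq_bigr => i _; rewrite tnthS.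
Qed.

(** Induction on n by Tonelli: the density of the first coordinate is a constant for the inner
    integral and joins the product. *)
Lemma iid_density (Q : probability T R) (l : T -> R) :
  measurable_fun [set: T] l -> (forall x, 0 <= l x)%R ->
  (forall A, measurable A -> Q A = \int[P]_(x in A) (l x)%:E) ->
  forall n (F : n.-tuple T -> \bar R), measurable_fun [set: n.-tuple T] F ->
  (forall z, 0 <= F z) ->
  \int[iid Q n]_z F z =
  \int[iid P n]_z (F z * (\prod_(i < n) l (tnth z i))%R%:E).
Proof.
move=> ml l0 QE; have L0 n (z : n.-tuple T) : 0 <= (\prod_(i < n) l (tnth z i))%R%:E.
  by rewrite lee_fin prodr_ge0.
have mFL n (F : n.-tuple T -> \bar R) : measurable_fun [set: n.-tuple T] F ->
    measurable_fun [set: n.-tuple T] (fun z => F z * (\prod_(i < n) l (tnth z i))%R%:E).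
  move=> mF; apply: emeasurable_funM => //.
  by apply/measurable_EFinP; exact: measurable_iid_prod.
elim=> [|n IH] F mF F0.
  rewrite !iid0_integral ?big_ord0 ?mule1//; exact: mFL.
rewrite !iid_tonelli//; [|exact: mFL|by move=> z; rewrite mule_ge0].
rewrite (ge0_integral_density ml l0 QE); last 2 first.
- exact: measurable_integral_iid.
- by move=> y; exact: integral_ge0.
have mFc y : measurable_fun [set: n.-tuple T] (fun z => F (cons_prod (y, z))).
  by apply: measurableT_comp => //; exact: measurable_consx.
apply: eq_integral => y _; rewrite IH//.
rewrite -ge0_integralZr ?lee_fin//; [|exact: mFL|].
  apply: eq_integral => z _; rewrite cons_prod_prod -muleA -EFinM.
  by rewrite [in RHS]mulrC.
by move=> z _; rewrite mule_ge0.
Qed.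

Lemma iid_prod_le n (h : T -> R) (c : R) : measurable_fun [set: T] h ->
  (forall x, 0 <= h x)%R -> \int[P]_x (h x)%:E <= c%:E ->
  \int[iid P n]_z (\prod_(i < n) h (tnth z i))%R%:E <= (c ^+ n)%:E.
Proof.
move=> mh h0 hc.
have c0 : (0 <= c)%R.
  by rewrite -lee_fin (le_trans _ hc)// integral_ge0// => x _; rewrite lee_fin.
have mp k : measurable_fun [set: k.-tuple T]
    (fun z => (\prod_(i < k) h (tnth z i))%R%:E).
  by apply/measurable_EFinP; exact: measurable_iid_prod.
elim: n => [|n IH]; first by rewrite iid0_integral// big_ord0 expr0.
rewrite iid_tonelli//; last by move=> z; rewrite lee_fin prodr_ge0.
set I := \int[iid P n]_z _ in IH.
have I0 : 0 <= I by rewrite integral_ge0// => z _; rewrite lee_fin prodr_ge0.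
rewrite (eq_integral (fun y => (h y)%:E * I)); last first.
  move=> y _; under eq_integral => z _ do rewrite cons_prod_prod EFinM.
  rewrite ge0_integralZl ?lee_fin//.
    exact: mp.
  by move=> z _; rewrite lee_fin prodr_ge0.
rewrite ge0_integralZr//; [|exact/measurable_EFinP| ].
- by rewrite exprS EFinM lee_pmul// integral_ge0// => z _; rewrite lee_fin.
- by move=> x _; rewrite lee_fin.
Qed.

Lemma iid_sum_le n (h : T -> R) (c : R) : measurable_fun [set: T] h ->
  (forall x, 0 <= h x)%R -> \int[P]_x (h x)%:E <= c%:E ->
  \int[iid P n]_z (\sum_(i < n) h (tnth z i))%R%:E <= (n%:R * c)%:E.
Proof.
move=> mh h0 hc.
have mp k : measurable_fun [set: k.-tuple T]
    (fun z => (\sum_(i < k) h (tnth z i))%R%:E).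
  by apply/measurable_EFinP; exact: measurable_iid_sum.
have s0 k (z : k.-tuple T) : 0 <= (\sum_(i < k) h (tnth z i))%R%:E.
  by rewrite lee_fin sumr_ge0.
elim: n => [|n IH]; first by rewrite iid0_integral// big_ord0 mul0r.
rewrite iid_tonelli//.
set I := \int[iid P n]_z _ in IH.
have I0 : 0 <= I by exact: integral_ge0.
rewrite (eq_integral (fun y => (h y)%:E + I)); last first.
  move=> y _; under eq_integral => z _ do rewrite cons_prod_sum EFinD.
  rewrite ge0_integralD ?lee_fin//=; [| |exact: mp].
    by rewrite integral_prob_cst.
  by move=> z _; exact: s0.
rewrite ge0_integralD//=; last 2 first.
- by move=> x _; rewrite lee_fin.
- exact/measurable_EFinP.
rewrite integral_prob_cst.
by rewrite -natr1 mulrDl mul1r addrC EFinD leeD.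
Qed.

End iid_theory.

(** * Lindeberg's central limit theorem for triangular arrays *)

Section heat_measurable.
Context {R : realType}.

Lemma continuous_gcdf : continuous (@gcdf R).
Proof.
move=> x; apply: differentiable_continuous; apply/derivable1_diffP.
exact: (@ex_derive _ _ _ _ _ _ _ (is_derive_gcdf x)).
Qed.

Lemma measurable_gcdf : measurable_fun [set: R] (@gcdf R).
Proof. exact: (continuous_measurable_fun continuous_gcdf). Qed.

Lemma heat_bound (s x : R) : `|heat s x| <= 1.
Proof. by rewrite ger0_norm /heat ?gcdf_ge0 ?gcdf_le1. Qed.

Lemma measurable_heat (s : R) : measurable_fun [set: R] (heat s).
Proof.
apply: measurableT_comp; first exact: measurable_gcdf.
exact: measurable_funM.
Qed.

End heat_measurable.

Section lindeberg.
Context d (T : measurableType d) {R : realType}.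
(** Integrating [heat_expansion]: the linear term vanishes by centering, and the term in [B] leaves
    the mismatch between the variance and [dl]. The constant is chosen before the law and the
    function because both change with n in a triangular array. *)
Lemma heat_step (e : R) : 0 < e -> exists2 C, 0 <= C &
  forall (P : probability T R) (g : T -> R) s dl x,
  intg P g -> intg P (fun y => g y ^+ 2) -> intg P (fun y => `|g y| ^+ 3) ->
  \int[P]_y g y = 0 -> e <= s -> 0 <= dl ->
  `|\int[P]_y heat s (x - g y) - heat (s + dl) x| <=
  C * (`|\int[P]_y (g y ^+ 2) - dl| + \int[P]_y (`|g y| ^+ 3) + dl ^+ 2).
Proof.
move=> e0; have [C C0 HC] := heat_expansion e0; exists C => // P g s dl x I1 I2 I3 g0 es dl0.
have mg := intg_measurable I1.
have [A [B [BC AB]]] := HC s dl x es dl0.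
have Ih : intg P (fun y => heat s (x - g y)).
  apply: (@intg_bounded _ _ _ _ _ 1) => [|y]; last exact: heat_bound.
  apply: measurableT_comp; first exact: measurable_heat.
  exact: measurable_funB.
set v := \int[P]_y (g y ^+ 2).
set K := heat (s + dl) x.
have E1 : \int[P]_y (heat s (x - g y) - (K - B * dl + A * g y + B * g y ^+ 2)) =
    \int[P]_y heat s (x - g y) - K - B * (v - dl).
  rewrite RintB//; last first.
    by do 2 (apply: intgD; last exact: intgZ); exact: intg_cst.
  by rewrite Rint_affine2// g0 -/v; ring.
have -> : \int[P]_y heat s (x - g y) - K =
    (\int[P]_y heat s (x - g y) - K - B * (v - dl)) + B * (v - dl) by ring.
rewrite -E1; apply: (le_trans (ler_normD _ _)).
rewrite -(addrA _ _ (dl ^+ 2)) (mulrDr C) [leLHS]addrC; apply: lerD.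
  by rewrite normrM ler_wpM2r.
have -> : C * (\int[P]_y (`|g y| ^+ 3) + dl ^+ 2) =
   \int[P]_y (C * dl ^+ 2 + C * `|g y| ^+ 3 + 0 * g y).
  by rewrite Rint_affine2//; ring.
apply: le_norm_Rint.
- apply: intgB => //.
  by do 2 (apply: intgD; last exact: intgZ); exact: intg_cst.
- by do 2 (apply: intgD; last exact: intgZ); exact: intg_cst.
- move=> y; have := AB (g y).
  rewrite -/K (_ : heat s (x - g y) - K - _ =
    heat s (x - g y) - (K - B * dl + A * g y + B * g y ^+ 2)); last by ring.
  by move/le_trans; apply; rewrite mulrDr mul0r addr0 addrC.
Qed.

(** Lindeberg replacement by induction on n. For a fixed first coordinate y the other n summands are
    replaced at the point x - g y, which advances the time to s + n dl; then [heat_step] from that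
    time replaces y itself. Each summand costs the same error. *)
Lemma iid_heat (e : R) : 0 < e -> exists2 C, 0 <= C &
  forall (P : probability T R) (g : T -> R) dl,
  intg P g -> intg P (fun y => g y ^+ 2) -> intg P (fun y => `|g y| ^+ 3) ->
  \int[P]_y g y = 0 -> 0 <= dl -> forall n s x, e <= s ->
  `|\int[iid P n]_z heat s (x - \sum_(i < n) g (tnth z i)) - heat (s + n%:R * dl) x|
  <= n%:R * (C * (`|\int[P]_y (g y ^+ 2) - dl| + \int[P]_y (`|g y| ^+ 3) + dl ^+ 2)).
Proof.
move=> e0; have [C C0 HC] := heat_step e0; exists C => // P g dl I1 I2 I3 g0 dl0.
have mg := intg_measurable I1.
set D := C * _.
have mh n s x : measurable_fun [set: n.-tuple T]
    (fun z => (heat s (x - \sum_(i < n) g (tnth z i)))%:E).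
  apply/measurable_EFinP; apply: measurableT_comp; first exact: measurable_heat.
  by apply: measurable_funB => //; exact: measurable_iid_sum.
have h0 s x : (0%E <= (heat s x)%:E)%E by rewrite lee_fin gcdf_ge0.
have Iiid n s x : intg (iid P n) (fun z => heat s (x - \sum_(i < n) g (tnth z i))).
  apply: (@intg_bounded _ _ _ _ _ 1) => [|y]; last exact: heat_bound.
  by apply/measurable_EFinP; exact: mh.
elim=> [|n IH] s x es.
  by rewrite /Rintegral iid0_integral//= big_ord0 !mul0r !(subr0,addr0) subrr normr0.
pose H y := \int[iid P n]_z heat s (x - g y - \sum_(i < n) g (tnth z i)).
have HE y : (\int[iid P n]_z
    (heat s (x - \sum_(i < n.+1) g (tnth (cons_prod (y, z)) i)))%:E = (H y)%:E)%E.
  rewrite -(intg_EFin (Iiid n s (x - g y))); apply: eq_integral => z _.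
  by rewrite cons_prod_sum opprD addrA.
have H1 y : `|H y| <= 1.
  rewrite (le_trans (le_norm_Rint (Iiid _ _ _) (intg_cst (iid P n) 1) _))//.
    by move=> z; exact: heat_bound.
  by rewrite Rint_cst.
have mH : measurable_fun [set: T] H.
  apply/measurable_EFinP.
  rewrite (_ : _ \o _ = fun y => \int[iid P n]_z
    (heat s (x - \sum_(i < n.+1) g (tnth (cons_prod (y, z)) i)))%:E)%E.
    exact: (measurable_integral_iid P (mh n.+1 s x)).
  by apply/funext => y; rewrite HE.
have -> : \int[iid P n.+1]_z heat s (x - \sum_(i < n.+1) g (tnth z i)) = \int[P]_y H y.
  rewrite /Rintegral (iid_tonelli P (mh n.+1 s x))//; congr fine.
  by apply: eq_integral => y _; rewrite HE.
have IH' : intg P H by apply: intg_bounded H1.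
have es' : e <= s + n%:R * dl by rewrite (le_trans es)// lerDl mulr_ge0.
have Ih : intg P (fun y => heat (s + n%:R * dl) (x - g y)).
  apply: (@intg_bounded _ _ _ _ _ 1) => [|y]; last exact: heat_bound.
  apply: measurableT_comp; first exact: measurable_heat.
  exact: measurable_funB.
(* The first bracket is the induction hypothesis integrated over y, the second is a single
   [heat_step]. *)
have -> : \int[P]_y H y - heat (s + n.+1%:R * dl) x =
  \int[P]_y (H y - heat (s + n%:R * dl) (x - g y)) +
  (\int[P]_y heat (s + n%:R * dl) (x - g y) - heat (s + n%:R * dl + dl) x).
  rewrite RintB// -natr1 mulrDl mul1r addrA; ring.
apply: (le_trans (ler_normD _ _)); rewrite -natr1 mulrDl mul1r lerD//.
  rewrite -[leRHS](Rint_cst P); apply: le_norm_Rint; [exact: intgB|exact: intg_cst|].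
  by move=> y; exact: IH.
exact: HC.
Qed.

End lindeberg.

(** * From smoothed to true distribution functions *)

Section clt.
Context {R : realType}.

Lemma cvg_invn : n%:R^-1 @[n --> \oo] --> (0 : R).
Proof.
apply/gtr0_cvgV0; last exact: cvgr_idn.
by exists 1%N => // n /= n0; rewrite ltr0n.
Qed.

(** Both [e] and [eta] must be small while eta / sqrt e is large. Taking e = eta^4 gives eta / sqrt
    e = 1 / eta, and the first two bounds become continuity at 0 of the single function [K]. *)
Lemma gcdf_smoothing (r eps : R) : 0 < eps -> exists e eta : R,
  [/\ 0 < e, 0 < eta,
   gcdf ((r + eta) / Num.sqrt (e + 1)) <= gcdf r + eps,
   gcdf r - eps <= gcdf ((r - eta) / Num.sqrt (e + 1)) &
   1 - gcdf (eta / Num.sqrt e) <= eps /\ gcdf (- eta / Num.sqrt e) <= eps].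
Proof.
move=> eps0.
pose K (eta : R) := gcdf ((r + eta) / Num.sqrt (eta ^+ 4 + 1)).
have cK : continuous K.
  move=> x; apply: (@cvg_comp _ _ _ (fun eta : R => (r + eta) / Num.sqrt (eta ^+ 4 + 1)) gcdf).
    2: exact: continuous_gcdf.
  apply: cvgM.
    by apply: cvgD; [exact: cvg_cst|exact: cvg_id].
  apply: cvgV.
    by rewrite gt_eqF// sqrtr_gt0 ltr_wpDl// exprn_even_ge0.
  apply: (@cvg_comp _ _ _ (fun eta : R => eta ^+ 4 + 1) Num.sqrt).
    2: exact: sqrt_continuous.
  apply: cvgD; last exact: cvg_cst.
  exact: exprn_continuous.
have K0 : K 0 = gcdf r by rewrite /K addr0 expr0n/= add0r sqrtr1 divr1.
have [M [_ HM]] : \forall x \near +oo, `|1 - gcdf x| < eps.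
  exact: (@cvgr_dist_lt _ R^o _ _ _ _ _ gcdf_cvgy).
have [N [_ HN]] : \forall x \near -oo, `|0 - gcdf x| < eps.
  exact: (@cvgr_dist_lt _ R^o _ _ _ _ _ gcdf_cvgNy).
have [/= del del0 Hdel] : \forall x \near (0 : R), `|K 0 - K x| < eps.
  exact: (@cvgr_dist_lt _ R^o _ _ _ _ _ (cK 0)).
(* [A] is the inverse of the shift: A > M and - A < N reach the two tails, and the last term makes
   A^-1 < del. *)
pose A := `|M| + `|N| + 1 + 2 * del^-1.
have A1 : 1 <= A.
  by rewrite /A -addrA addrCA lerDl !addr_ge0// mulr_ge0// invr_ge0 ltW.
have A0 : 0 < A by rewrite (lt_le_trans _ A1).
have dinv : 0 < del^-1 by rewrite invr_gt0.
have AM : M < A.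
  have := ler_norm M; have := normr_ge0 N; rewrite /A; lra.
have AN : - A < N.
  have := ler_norm (- N); rewrite normrN; have := normr_ge0 M; rewrite /A; lra.
have Adel : A^-1 < del.
  rewrite invf_plt ?posrE// /A.
  have := normr_ge0 M; have := normr_ge0 N; lra.
exists (A^-1 ^+ 4), A^-1.
have sq : A^-1 / Num.sqrt (A^-1 ^+ 4) = A.
  have -> : A^-1 ^+ 4 = (A^-1 ^+ 2) ^+ 2 by rewrite -exprM.
  rewrite sqrtr_sqr ger0_norm ?sqr_ge0//; field; by rewrite gt_eqF.
split.
- by rewrite exprn_gt0// invr_gt0.
- by rewrite invr_gt0.
- have := Hdel A^-1; rewrite /= sub0r normrN gtr0_norm ?invr_gt0// => /(_ Adel).
  rewrite K0 ltr_norml => /andP[h1 h2]; rewrite -/(K _); lra.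
- have := Hdel (- A^-1); rewrite /= sub0r !normrN gtr0_norm ?invr_gt0// => /(_ Adel).
  rewrite K0 ltr_norml => /andP[h1 h2].
  have -> : (r - A^-1) / Num.sqrt (A^-1 ^+ 4 + 1) =
    (r + - A^-1) / Num.sqrt ((- A^-1) ^+ 4 + 1) by rewrite exprNn -signr_odd/= expr0 mul1r.
  by rewrite -/(K _); lra.
- rewrite mulNr sq; split.
    by have /ltW := HM _ AM; rewrite ger0_norm// subr_ge0 gcdf_le1.
  by have /ltW := HN _ AN; rewrite sub0r normrN ger0_norm// gcdf_ge0.
Qed.

Lemma measurable_iid_le d (T : measurableType d) n (g : T -> R) r :
  measurable_fun [set: T] g ->
  measurable [set z : n.-tuple T | \sum_(i < n) g (tnth z i) <= r].
Proof.
move=> mg; rewrite (_ : [set _ | _] =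
  (fun z : n.-tuple T => \sum_(i < n) g (tnth z i)) @^-1` `]-oo, r]); last first.
  by apply/seteqP; split => z /=; rewrite in_itv.
rewrite -[X in measurable X]setTI; exact: measurable_iid_sum.
Qed.

Lemma fine_prob_Rint d (T : measurableType d) (P : probability T R) (A : set T) :
  measurable A -> fine (P A) = \int[P]_x (\1_A x).
Proof. by move=> mA; rewrite /Rintegral integral_indic// setIT. Qed.

(** Pointwise comparison: [heat e (r + eta - S)] is at least gcdf (eta / sqrt e), nearly 1, where S
    <= r, and [heat e (r - eta - S)] is at most gcdf (- eta / sqrt e), nearly 0, where S > r. *)
Lemma smoothing_sandwich d (T : measurableType d) (P : probability T R)
    (S : T -> R) (r eta e : R) :
  measurable_fun [set: T] S -> measurable [set z | S z <= r] ->
  0 < e -> 0 < eta ->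
  \int[P]_z heat e (r - eta - S z) - gcdf (- eta / Num.sqrt e)
    <= fine (P [set z | S z <= r])
    <= \int[P]_z heat e (r + eta - S z) + (1 - gcdf (eta / Num.sqrt e)).
Proof.
move=> mS mA e0 eta0.
have Ih c : intg P (fun z => heat e (c - S z)).
  apply: (@intg_bounded _ _ _ _ _ 1) => [|y]; last exact: heat_bound.
  apply: measurableT_comp; first exact: measurable_heat.
  exact: measurable_funB.
have Ii : intg P (\1_[set z | S z <= r] : T -> R).
  apply: (@intg_bounded _ _ _ _ _ 1) => [|y]; first exact: measurable_indic.
  by rewrite indicE; case: (_ \in _); rewrite ?normr1 ?normr0.
have se : 0 < Num.sqrt e by rewrite sqrtr_gt0.
set cl := gcdf (- _ / _); set cu := 1 - _.
have E1 : \int[P]_z heat e (r - eta - S z) - cl =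
    \int[P]_z (heat e (r - eta - S z) - cl).
  by rewrite (RintB (Ih _) (intg_cst P _)) Rint_cst.
have E2 : \int[P]_z heat e (r + eta - S z) + cu =
    \int[P]_z (heat e (r + eta - S z) + cu).
  by rewrite (RintD (Ih _) (intg_cst P _)) Rint_cst.
rewrite fine_prob_Rint//.
apply/andP; split; [rewrite [leLHS]E1|rewrite [leRHS]E2]; apply: le_Rint => //.
- by apply: intgB => //; exact: intg_cst.
- move=> z; rewrite indicE; case: (boolP (S z <= r)) => Sr.
    rewrite mem_set//=; rewrite lerBlDr (le_trans (gcdf_le1 _))//.
    by rewrite lerDl gcdf_ge0.
  rewrite memNset//=; last by apply/negP.
  rewrite subr_le0; apply: gcdf_nd; rewrite ler_pM2r ?invr_gt0//.
  by move: Sr; rewrite -ltNge; clear -eta0; lra.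
- by apply: intgD => //; exact: intg_cst.
- move=> z; rewrite indicE; case: (boolP (S z <= r)) => Sr.
    rewrite mem_set//= addrCA lerDl subr_ge0; apply: gcdf_nd.
    by rewrite ler_pM2r ?invr_gt0//; clear -eta0 Sr; lra.
  rewrite memNset//=; last by apply/negP.
  by rewrite addr_ge0 ?gcdf_ge0// subr_ge0 gcdf_le1.
Qed.

(** A Lyapunov condition on third moments. With time steps 1 / n the Gaussian replacement leads from
    time e to time e + 1, the variance of a standard normal variable plus that of the smoothing. *)
Lemma clt_array d (T : measurableType d) (P : nat -> probability T R)
    (g : nat -> T -> R) :
  (\forall n \near \oo, [/\ intg (P n) (g n), intg (P n) (fun y => g n y ^+ 2),
    intg (P n) (fun y => `|g n y| ^+ 3) & \int[P n]_y g n y = 0]) ->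
  n%:R * \int[P n]_y (g n y ^+ 2) @[n --> \oo] --> (1 : R) ->
  n%:R * \int[P n]_y (`|g n y| ^+ 3) @[n --> \oo] --> (0 : R) ->
  forall r, fine (iid (P n) n [set z | \sum_(i < n) g n (tnth z i) <= r])
    @[n --> \oo] --> gcdf r.
Proof.
move=> gP g2 g3 r; apply/cvgrPdist_le => /= eps eps0.
have eps3 : 0 < eps / 3 by rewrite divr_gt0.
have [e [eta [e0 eta0 h1 h2 [h3 h4]]]] := gcdf_smoothing r eps3.
pose D C n := n%:R * (C * (`|\int[P n]_y (g n y ^+ 2) - n%:R^-1|
   + \int[P n]_y (`|g n y| ^+ 3) + n%:R^-1 ^+ 2)).
have D0 C : D C n @[n --> \oo] --> (0 : R).
  have -> : (0 : R) = C * (`|1 - 1| + 0 + 0) by rewrite subrr normr0 !addr0 mulr0.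
  apply: cvg_trans (_ : C * (`|n%:R * (\int[P n]_y (g n y ^+ 2)) - 1| +
    n%:R * \int[P n]_y (`|g n y| ^+ 3) + n%:R^-1) @[n --> \oo] --> _).
    apply: near_eq_cvg; near=> n.
    have n0 : (n%:R : R) != 0 by rewrite pnatr_eq0 -lt0n; near: n; exists 1%N.
    rewrite /D.
    have -> : `|n%:R * (\int[P n]_y (g n y ^+ 2)) - 1| =
      `|n%:R : R| * `|\int[P n]_y (g n y ^+ 2) - n%:R^-1|.
      by rewrite -normrM mulrBr divff.
    by rewrite (ger0_norm (ler0n R n)); field.
  apply: cvgMr; apply: cvgD.
    apply: cvgD => //; apply: cvg_norm; apply: cvgB => //; exact: cvg_cst.
  exact: cvg_invn.
have [C C0 HC] := @iid_heat _ T R e e0.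
have D3 : \forall n \near \oo, D C n <= eps / 3.
  have /cvgrPdist_le /(_ _ eps3) := D0 C.
  by apply: filterS => n; rewrite sub0r normrN; apply: le_trans; exact: ler_norm.
near=> n.
have [I1 I2 I3 I0] : [/\ intg (P n) (g n), intg (P n) (fun y => g n y ^+ 2),
    intg (P n) (fun y => `|g n y| ^+ 3) & \int[P n]_y g n y = 0].
  by near: n; exact: gP.
have n0 : (n%:R : R) != 0 by rewrite pnatr_eq0 -lt0n; near: n; exists 1%N.
have Dn : D C n <= eps / 3 by near: n.
have key x : `|\int[iid (P n) n]_z heat e (x - \sum_(i < n) g n (tnth z i))
    - heat (e + 1) x| <= eps / 3.
  have := HC (P n) (g n) n%:R^-1 I1 I2 I3 I0 _ n e x (lexx e).
  rewrite invr_ge0 ler0n => /(_ isT); rewrite divff// => h.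
  exact: le_trans h Dn.
have mg := intg_measurable I1.
have /andP[lo hi] := smoothing_sandwich (iid (P n) n)
  (@measurable_iid_sum _ T R n _ mg) (@measurable_iid_le _ T n _ r mg) e0 eta0.
have := key (r - eta); have := key (r + eta); move: lo hi.
rewrite -/(heat _ _) in h1; rewrite -/(heat _ _) in h2.
set a := \int[_]_z _; set b := \int[_]_z _; set p := fine _.
move: h1 h2 h3 h4; clearbody a b p.
move: (heat (e + 1) _) (heat (e + 1) _) (gcdf (eta / _)) (gcdf (- eta / _)).
move=> u v w t h1 h2 h3 h4 lo hi; rewrite !ler_norml => /andP[k1 k2] /andP[k3 k4].
by apply/andP; split; lra.
Unshelve. all: by end_near. Qed.

End clt.

(** * Real-valued probabilities; Markov, Chebyshev and Slutsky *)

Section pr.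
Context d (T : measurableType d) {R : realType}.
Variable P : probability T R.
Implicit Types A B C : set T.

Definition pr A : R := fine (P A).

Lemma prE A : measurable A -> (P A = (pr A)%:E)%E.
Proof. by move=> mA; rewrite fineK// fin_num_measure. Qed.

Lemma pr_ge0 A : 0 <= pr A.
Proof. exact: fine_ge0. Qed.

Lemma le_pr A B : measurable A -> measurable B -> A `<=` B -> pr A <= pr B.
Proof. by move=> mA mB AB; rewrite -lee_fin -!prE// le_measure// inE. Qed.

Lemma pr_setU A B C : measurable A -> measurable B -> measurable C ->
  A `<=` B `|` C -> pr A <= pr B + pr C.
Proof.
move=> mA mB mC ABC; have mBC := measurableU _ _ mB mC.
apply: (le_trans (le_pr mA mBC ABC)).
rewrite -lee_fin EFinD -!prE//; exact: measureU2.
Qed.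

Lemma pr_setC A : measurable A -> pr (~` A) = 1 - pr A.
Proof.
move=> mA; apply: EFin_inj; rewrite -prE; last exact: measurableC.
by rewrite probability_setC// prE.
Qed.

Lemma pr_Rint A : measurable A -> pr A = \int[P]_x (\1_A x).
Proof. exact: fine_prob_Rint. Qed.

Lemma intg_indic A : measurable A -> intg P (\1_A : T -> R).
Proof.
move=> mA; apply: (@intg_bounded _ _ _ _ _ 1) => [|y]; first exact: measurable_indic.
by rewrite indicE; case: (_ \in _); rewrite ?normr1 ?normr0.
Qed.

Lemma markov_pr (f : T -> R) (c e : R) A : measurable A ->
  measurable_fun [set: T] f -> (forall x, 0 <= f x) -> 0 < e ->
  (\int[P]_x (f x)%:E <= c%:E)%E -> (forall x, A x -> e <= f x) ->
  pr A <= c / e.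
Proof.
move=> mA mf f0 e0 fc Af.
have If : intg P f by apply: intg_ge0 => //; rewrite (le_lt_trans fc)// ltry.
rewrite ler_pdivlMr// mulrC pr_Rint// -RintZ; last exact: intg_indic.
apply: (@le_trans _ _ (\int[P]_x f x)); last by rewrite -lee_fin -intg_EFin.
apply: le_Rint => //; first by apply: intgZ; exact: intg_indic.
move=> x; rewrite indicE; case: (boolP (x \in A)); last by rewrite mulr0.
by rewrite inE mulr1; exact: Af.
Qed.

End pr.

Section density_Rint.
Context d (T : measurableType d) {R : realType}.
Variables (P Q : probability T R) (l : T -> R).
Hypotheses (ml : measurable_fun [set: T] l) (l0 : forall x, 0 <= l x).
Hypothesis QE : forall A, measurable A -> (Q A = \int[P]_(x in A) (l x)%:E)%E.

Let transferE (h : T -> R) : measurable_fun [set: T] h -> (forall x, 0 <= h x) ->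
  (\int[Q]_x (h x)%:E = \int[P]_x (h (idfun x) * l x)%:E)%E.
Proof.
move=> mh h0; rewrite (ge0_integral_density ml l0 QE)//.
exact/measurable_EFinP.
Qed.

Lemma intg_density (f : T -> R) : measurable_fun [set: T] f ->
  intg P (fun x => f x * l x) -> intg Q f.
Proof. by move=> mf If; exact: (intg_transfer l0 transferE mf If). Qed.

Lemma Rint_density (f : T -> R) : measurable_fun [set: T] f ->
  intg P (fun x => f x * l x) ->
  \int[Q]_x f x = \int[P]_x (f x * l x).
Proof. by move=> mf If; exact: (Rint_transfer (@measurable_id _ _ _) ml l0 transferE mf If). Qed.

End density_Rint.

Section chebyshev.
Context d (T : measurableType d) {R : realType}.
Variable P : probability T R.

(** The offset [c] makes the induction work: it absorbs the value at the coordinate that is peeled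
    off. *)
Lemma iid_sum_sq (g : T -> R) n c : intg P g -> intg P (fun x => g x ^+ 2) ->
  (\int[iid P n]_z ((c + \sum_(i < n) g (tnth z i)) ^+ 2)%:E =
   ((c + n%:R * \int[P]_x g x) ^+ 2 +
    n%:R * (\int[P]_x (g x ^+ 2) - (\int[P]_x g x) ^+ 2))%:E)%E.
Proof.
move=> I1 I2; have mg := intg_measurable I1.
set m := \int[P]_x g x; set v := \int[P]_x (g x ^+ 2).
have mS k b : measurable_fun [set: k.-tuple T]
    (fun z => ((b + \sum_(i < k) g (tnth z i)) ^+ 2)%:E).
  apply/measurable_EFinP; apply: measurable_funX.
  by apply: measurable_funD => //; exact: measurable_iid_sum.
elim: n c => [|n IH] c.
  by rewrite iid0_integral//= big_ord0 !mul0r !addr0.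
rewrite iid_tonelli//; last by move=> z; rewrite lee_fin sqr_ge0.
rewrite (eq_integral (fun y => (((c + n%:R * m) ^+ 2 + n%:R * (v - m ^+ 2))
    + 2 * (c + n%:R * m) * g y + 1 * g y ^+ 2)%:E)); last first.
  move=> y _.
  under eq_integral => z _ do rewrite cons_prod_sum addrA.
  by rewrite IH; congr EFin; ring.
rewrite intg_EFin; last first.
  by do 2 (apply: intgD; last exact: intgZ); exact: intg_cst.
by rewrite Rint_affine2// -/m -/v -natr1; congr EFin; ring.
Qed.

(** Here [g] need not be centered. With e of order sqrt n, the squared mean term asks for a mean of
    order o(n^(-1/2)), the condition met by the perturbed score. *)
Lemma chebyshev_iid (g : T -> R) n e A : intg P g ->
  intg P (fun x => g x ^+ 2) -> 0 < e -> measurable A ->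
  (forall z : n.-tuple T, A z -> e <= `|\sum_(i < n) g (tnth z i)|) ->
  pr (iid P n) A <=
    (n%:R * \int[P]_x (g x ^+ 2) + (n%:R * \int[P]_x g x) ^+ 2) / e ^+ 2.
Proof.
move=> I1 I2 e0 mA Ae; have mg := intg_measurable I1.
have mS : measurable_fun [set: n.-tuple T]
    (fun z => ((0 + \sum_(i < n) g (tnth z i)) ^+ 2)).
  apply: measurable_funX.
  by apply: measurable_funD => //; exact: measurable_iid_sum.
apply: (markov_pr mA mS) => //.
- by move=> z; rewrite sqr_ge0.
- by rewrite exprn_gt0.
- rewrite iid_sum_sq// lee_fin add0r addrC lerD2r ler_wpM2l//.
  by rewrite gerBl sqr_ge0.
- move=> z /Ae h; rewrite add0r -[leRHS]real_normK ?num_real//.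
  by rewrite lerXn2r// nnegrE ltW.
Qed.

End chebyshev.

Section slutsky.
Context d (T : nat -> measurableType d) {R : realType}.
Variables (M : forall n, probability (T n) R) (S S' : forall n, T n -> R).
Arguments S {n}.
Arguments S' {n}.
Hypotheses (mS : forall n, measurable_fun [set: T n] (@S n))
  (mS' : forall n, measurable_fun [set: T n] (@S' n)).

Lemma measurable_le_cst n (f : T n -> R) r : measurable_fun [set: T n] f ->
  measurable [set z | f z <= r].
Proof.
move=> mf; rewrite (_ : [set _ | _] = f @^-1` `]-oo, r]); last first.
  by apply/seteqP; split => z /=; rewrite in_itv.
rewrite -[X in measurable X]setTI; exact: mf.
Qed.

Lemma measurable_gt_cst n (f : T n -> R) r : measurable_fun [set: T n] f ->
  measurable [set z | r < f z].
Proof.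
move=> mf; rewrite (_ : [set _ | _] = f @^-1` `]r, +oo[); last first.
  by apply/seteqP; split => z /=; rewrite in_itv/= andbT.
rewrite -[X in measurable X]setTI; exact: mf.
Qed.

Lemma slutsky c :
  (forall r, pr (M n) [set z | S z <= r] @[n --> \oo] --> gcdf (r - c)) ->
  (forall e, 0 < e ->
    pr (M n) [set z | e < `|S' z - S z|] @[n --> \oo] --> (0 : R)) ->
  forall r, pr (M n) [set z | S' z <= r] @[n --> \oo] --> gcdf (r - c).
Proof.
move=> Sc SS r; apply/cvgrPdist_le => /= eps eps0.
have eps3 : 0 < eps / 3 by rewrite divr_gt0.
have [/= del del0 Hdel] : \forall x \near (r - c), `|gcdf (r - c) - gcdf x| < eps / 3.
  exact: (@cvgr_dist_lt _ R^o _ _ _ _ _ (@continuous_gcdf R (r - c))).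
have d2 : 0 < del / 2 by rewrite divr_gt0.
have g1 : `|gcdf (r - c) - gcdf (r + del / 2 - c)| < eps / 3.
  apply: Hdel; rewrite /= (_ : _ - _ = - (del / 2)); last by ring.
  by rewrite normrN gtr0_norm//; lra.
have g2 : `|gcdf (r - c) - gcdf (r - del / 2 - c)| < eps / 3.
  apply: Hdel; rewrite /= (_ : _ - _ = del / 2); last by ring.
  by rewrite gtr0_norm//; lra.
have mSS n e : measurable [set z : T n | e < `|S' z - S z|].
  apply: measurable_gt_cst; apply: measurableT_comp => //.
  exact: measurable_funB.
near=> n.
have h1 : `|gcdf (r + del / 2 - c) - pr (M n) [set z | S z <= r + del / 2]| <= eps / 3.
  near: n; have /cvgrPdist_le := Sc (r + del / 2); exact.
have h2 : `|gcdf (r - del / 2 - c) - pr (M n) [set z | S z <= r - del / 2]| <= eps / 3.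
  near: n; have /cvgrPdist_le := Sc (r - del / 2); exact.
have h3 : `|0 - pr (M n) [set z | del / 2 < `|S' z - S z|]| <= eps / 3.
  near: n; have /cvgrPdist_le := SS _ d2; exact.
rewrite sub0r normrN ger0_norm ?pr_ge0// in h3.
have u1 : pr (M n) [set z | S' z <= r] <=
  pr (M n) [set z | S z <= r + del / 2] + pr (M n) [set z | del / 2 < `|S' z - S z|].
  apply: pr_setU; [exact: measurable_le_cst|exact: measurable_le_cst|exact: mSS|].
  move=> z /= h; case: (leP `|S' z - S z| (del / 2)) => [|?]; last by right.
  by rewrite ler_norml => /andP[? ?]; left; lra.
have u2 : pr (M n) [set z | S z <= r - del / 2] <=
  pr (M n) [set z | S' z <= r] + pr (M n) [set z | del / 2 < `|S' z - S z|].
  apply: pr_setU; [exact: measurable_le_cst|exact: measurable_le_cst|exact: mSS|].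
  move=> z /= h; case: (leP `|S' z - S z| (del / 2)) => [|?]; last by right.
  by rewrite ler_norml => /andP[? ?]; left; lra.
move: g1 g2; rewrite !ltr_norml => /andP[? ?] /andP[? ?].
move: h1 h2; rewrite !ler_norml => /andP[? ?] /andP[? ?].
by apply/andP; split; lra.
Unshelve. all: by end_near. Qed.

End slutsky.

(** * Local asymptotic normality *)

(* Truncating [1 + xi n * psi] where it could be negative keeps the likelihood
   ratio nonnegative, and these points have probability o(1 / n). *)
Definition likelihood_ratios d (T : measurableType d) (R : realType)
    (P : probability T R) (psi : T -> R) (tau : R) (l : nat -> T -> R)
    (Q : nat -> probability T R) : Prop :=
  \forall n \near \oo, [/\ measurable_fun [set: T] (l n),
    forall x, 0 <= l n x,
    forall A, measurable A -> (Q n A = \int[P]_(x in A) (l n x)%:E)%E,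
    forall x, `|l n x - 1| <= `|local_xi tau n * psi x| &
    forall x, l n x - 1 = local_xi tau n * psi x \/ 1 <= `|local_xi tau n * psi x|].

Section alternative_clt.
Context d (T : measurableType d) {R : realType}.
Variables (P : probability T R) (psi : T -> R).
Hypotheses (mpsi : measurable_fun [set: T] psi).
Hypothesis I4 : intg P (fun x => psi x ^+ 4).
Hypothesis psi0 : \int[P]_x psi x = 0.
Let gam := \int[P]_x (psi x ^+ 2).
Hypothesis gam0 : 0 < gam.
Variables (tau : R) (l : nat -> T -> R) (Q : nat -> probability T R).
Local Notation xi := (local_xi tau).
Hypothesis lP : likelihood_ratios P psi tau l Q.

Let poly4 (x : R) : [/\ `|x| <= 1 + x ^+ 4, x ^+ 2 <= 1 + x ^+ 4 &
  `|x| ^+ 3 <= 1 + x ^+ 4].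
Proof.
have -> : x ^+ 2 = `|x| ^+ 2 by rewrite real_normK ?num_real.
have -> : x ^+ 4 = `|x| ^+ 4 by rewrite -normrX ger0_norm// exprn_even_ge0.
move: (normr_ge0 x); set y := `|x| => y0.
have [y1|/ltW y1] := leP y 1.
  have y2 : y ^+ 2 <= 1 by rewrite expr_le1.
  have y3 : y ^+ 3 <= 1 by rewrite expr_le1.
  have y4 : 0 <= y ^+ 4 by rewrite exprn_ge0.
  by split; lra.
have h k : (k <= 4)%N -> y ^+ k <= y ^+ 4 by move=> ?; exact: ler_weXn2l.
have := h 1%N isT; have := h 2%N isT; have := h 3%N isT; rewrite expr1.
by split; lra.
Qed.

Let Ipoly : intg P (fun x => 1 + psi x ^+ 4).
Proof. by apply: intgD => //; exact: intg_cst. Qed.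

Lemma intg_psi1 : intg P psi.
Proof. by apply: intg_le Ipoly => // x; have [] := poly4 (psi x). Qed.

Lemma intg_psi2 : intg P (fun x => psi x ^+ 2).
Proof.
apply: intg_le Ipoly => [|x]; first exact: measurable_funX.
by rewrite ger0_norm ?sqr_ge0//; have [] := poly4 (psi x).
Qed.

Lemma intg_psi3 : intg P (fun x => `|psi x| ^+ 3).
Proof.
apply: intg_le Ipoly => [|x].
  by apply: measurable_funX; exact: measurableT_comp.
by rewrite ger0_norm ?exprn_ge0//; have [] := poly4 (psi x).
Qed.

Lemma xi_sqr n : n != 0%N -> xi n ^+ 2 = tau ^+ 2 / n%:R.
Proof. by move=> n0; rewrite /local_xi exprMn exprVn sqr_sqrtr. Qed.

Lemma cvg_sqrt_invn : (Num.sqrt n%:R)^-1 @[n --> \oo] --> (0 : R).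
Proof.
rewrite -(@sqrtr0 R); apply: cvg_trans (_ : Num.sqrt (n%:R^-1 : R) @[n --> \oo] --> _).
  by apply: near_eq_cvg; apply: nearW => n; rewrite sqrtrV.
by apply: cvg_comp cvg_invn _; exact: sqrt_continuous.
Qed.

Lemma cvg_xi : xi n @[n --> \oo] --> (0 : R).
Proof.
by rewrite -(mulr0 tau); apply: cvgMr; exact: cvg_sqrt_invn.
Qed.


Let K4 := 2 * \int[P]_x (1 + psi x ^+ 4).

(** The difference of the integrals is that of f (l - 1) under P, and |l - 1| <= |xi psi|. A cubic
    bound on f and one more factor psi are within reach of the fourth moment. *)
Lemma Q_moment (f : T -> R) : measurable_fun [set: T] f ->
  (forall x, `|f x| <= 1 + `|psi x| ^+ 3) ->
  \forall n \near \oo, intg (Q n) f /\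
    `|\int[Q n]_x f x - \int[P]_x f x| <= `|xi n| * K4.
Proof.
move=> mf f3; apply: filterS lP => n [ml l0 QE l1 _].
have fpsi x : `|f x * psi x| <= 2 * (1 + psi x ^+ 4).
  rewrite normrM; have [p1 _ _] := poly4 (psi x).
  apply: (@le_trans _ _ ((1 + `|psi x| ^+ 3) * `|psi x|)).
    by rewrite ler_wpM2r.
  rewrite mulrDl mul1r -exprSr -normrX (@ger0_norm _ (psi x ^+ 4)) ?exprn_even_ge0//; lra.
have If : intg P f.
  apply: (intg_le mf _ (intgZ 2 Ipoly)) => x.
  have [_ _ p3] := poly4 (psi x); apply: (le_trans (f3 x)).
  have : 0 <= psi x ^+ 4 by rewrite exprn_even_ge0.
  lra.
have Ifl : intg P (fun x => f x * (l n x - 1)).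
  apply: (intg_le _ _ (intgZ `|xi n| (intgZ 2 Ipoly))).
    by apply: measurable_funM => //; exact: measurable_funB.
  move=> x; rewrite normrM; apply: (@le_trans _ _ (`|xi n| * `|f x * psi x|)).
    rewrite (_ : `|xi n| * _ = `|f x| * `|xi n * psi x|) ?ler_wpM2l//.
    by rewrite !normrM; ring.
  by rewrite ler_wpM2l.
have Ifl' : intg P (fun x => f x * l n x).
  rewrite (_ : (fun _ => _) = (fun x => f x * (l n x - 1) + f x)); last first.
    by apply/funext => x; rewrite mulrBr mulr1 subrK.
  exact: intgD.
split; first exact: (intg_density ml l0 QE).
rewrite (Rint_density ml l0 QE)// -RintB//.
rewrite /K4 -(RintZ 2 Ipoly) -RintZ; last exact: intgZ.
apply: le_norm_Rint.
- exact: intgB.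
- by do 2 apply: intgZ.
- move=> x; rewrite -{2}(mulr1 (f x)) -mulrBr normrM.
  apply: (@le_trans _ _ (`|xi n| * `|f x * psi x|)).
    rewrite (_ : `|xi n| * _ = `|f x| * `|xi n * psi x|) ?ler_wpM2l//.
    by rewrite !normrM; ring.
  by rewrite ler_wpM2l.
Qed.

Lemma Q_moment_cvg (f : T -> R) : measurable_fun [set: T] f ->
  (forall x, `|f x| <= 1 + `|psi x| ^+ 3) ->
  \int[Q n]_x f x @[n --> \oo] --> \int[P]_x f x.
Proof.
move=> mf f3; apply/cvgrPdist_le => e e0.
have : `|xi n| * K4 @[n --> \oo] --> 0.
  rewrite -(mul0r K4) -(@normr0 _ R); apply: cvgMl.
  by apply: cvg_norm; exact: cvg_xi.
move/cvgrPdist_le => /(_ _ e0) h.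
near=> n.
have [_ h1] : intg (Q n) f /\
    `|\int[Q n]_x f x - \int[P]_x f x| <= `|xi n| * K4.
  by near: n; exact: Q_moment.
rewrite distrC (le_trans h1)// (le_trans (ler_norm _))//.
have : `|0 - `|xi n| * K4| <= e by near: n.
by rewrite sub0r normrN.
Unshelve. all: by end_near. Qed.

(** Where l - 1 = xi psi the contribution is exactly xi psi^2; the remaining points have |xi psi| >=
    1 and contribute only to third order in xi. *)
Lemma Q_mean : \forall n \near \oo,
  `|\int[Q n]_x psi x - xi n * gam| <= 2 * `|xi n| ^+ 3 * \int[P]_x (psi x ^+ 4).
Proof.
apply: filterS lP => n [ml l0 QE l1 l2].
have p2 x : `|psi x * (l n x - 1)| <= `|xi n| * (psi x ^+ 2).
  rewrite normrM; apply: (@le_trans _ _ (`|psi x| * `|xi n * psi x|)).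
    by rewrite ler_wpM2l.
  by rewrite normrM mulrCA -expr2 real_normK ?num_real.
have Ipl : intg P (fun x => psi x * (l n x - 1)).
  apply: (intg_le _ p2); last by apply: intgZ; exact: intg_psi2.
  by apply: measurable_funM => //; exact: measurable_funB.
have Ifl' : intg P (fun x => psi x * l n x).
  rewrite (_ : (fun _ => _) = (fun x => psi x * (l n x - 1) + psi x)); last first.
    by apply/funext => x; rewrite mulrBr mulr1 subrK.
  by apply: intgD => //; exact: intg_psi1.
rewrite (Rint_density ml l0 QE)//.
rewrite -[X in X - _ * _]subr0 -psi0 -RintB//; last exact: intg_psi1.
rewrite -(RintZ _ intg_psi2) -(RintZ _ I4) -RintB; last 2 first.
- by apply: intgB => //; exact: intg_psi1.
- by apply: intgZ; exact: intg_psi2.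
apply: le_norm_Rint.
- apply: intgB; first by apply: intgB => //; exact: intg_psi1.
  by apply: intgZ; exact: intg_psi2.
- exact: intgZ.
move=> x.
have -> : psi x * l n x - psi x - xi n * psi x ^+ 2 =
  psi x * (l n x - 1 - xi n * psi x) by ring.
have [->|h] := l2 x.
  by rewrite subrr mulr0 normr0; apply: mulr_ge0; [apply: mulr_ge0; rewrite ?exprn_ge0|rewrite exprn_even_ge0].
rewrite normrM.
apply: (@le_trans _ _ (`|psi x| * (2 * `|xi n * psi x|))).
  rewrite ler_wpM2l// (le_trans (ler_normB _ _))//.
  by have := l1 x; lra.
(* The factor |xi psi|^2, at least 1 at this point, turns the crude bound into one by |xi|^3
   psi^4. *)
apply: (@le_trans _ _ (`|psi x| * (2 * `|xi n * psi x|) * `|xi n * psi x| ^+ 2)).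
  by rewrite ler_peMr ?mulr_ge0// exprn_ege1.
rewrite -(@ger0_norm _ (psi x ^+ 4)) ?exprn_even_ge0// normrX normrM.
rewrite le_eqVlt; apply/orP; left; apply/eqP; ring.
Qed.

Lemma sqrt_mean_cvg : Num.sqrt n%:R * \int[Q n]_x psi x @[n --> \oo] --> tau * gam.
Proof.
apply/cvgrPdist_le => e e0.
have : 2 * `|tau| * xi n ^+ 2 * \int[P]_x (psi x ^+ 4) @[n --> \oo] --> 0.
  rewrite -(mul0r (\int[P]_x (psi x ^+ 4))); apply: cvgMl.
  rewrite -(mulr0 (2 * `|tau|)); apply: cvgMr.
  rewrite (_ : 0 = 0 ^+ 2); last by rewrite expr0n.
  apply: (@cvg_comp _ _ _ xi (fun x => x ^+ 2) _ _ _ cvg_xi).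
  exact: (@exprn_continuous R 2 0).
move/cvgrPdist_le => /(_ _ e0) h; near=> n.
have n0 : (0 < n)%N by near: n; exists 1%N.
have s0 : 0 < Num.sqrt (n%:R : R) by rewrite sqrtr_gt0 ltr0n.
have h1 : `|\int[Q n]_x psi x - xi n * gam| <= 2 * `|xi n| ^+ 3 * \int[P]_x (psi x ^+ 4).
  by near: n; exact: Q_mean.
have -> : tau * gam - Num.sqrt n%:R * \int[Q n]_x psi x =
  - (Num.sqrt n%:R * (\int[Q n]_x psi x - xi n * gam)).
  by rewrite /local_xi; field; rewrite gt_eqF.
rewrite normrN normrM gtr0_norm//.
have : `|0 - 2 * `|tau| * xi n ^+ 2 * \int[P]_x (psi x ^+ 4)| <= e by near: n.
rewrite sub0r normrN => /(le_trans (ler_norm _)); apply: le_trans.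
have -> : 2 * `|tau| * xi n ^+ 2 * \int[P]_x (psi x ^+ 4) =
   Num.sqrt n%:R * (2 * `|xi n| ^+ 3 * \int[P]_x (psi x ^+ 4)).
  rewrite -(@real_normK _ (xi n)) ?num_real// /local_xi normrM normfV.
  by rewrite (gtr0_norm s0); field; rewrite gt_eqF.
by rewrite ler_wpM2l// ltW.
Unshelve. all: by end_near. Qed.

(** The statistic T at the true parameters, for an abstract score psi; [TnE] makes the link. *)
Definition scaled_sum n (z : n.-tuple T) : R :=
  (Num.sqrt (n%:R * gam))^-1 * \sum_(i < n) psi (tnth z i).

Lemma measurable_scaled_sum n : measurable_fun [set: n.-tuple T] (@scaled_sum n).
Proof. by apply: measurable_funM => //; exact: measurable_iid_sum. Qed.

(** The summands are centered by their own mean [m n] under [Q n], so [clt_array] applies under the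
    alternative itself; the limiting mean comes from sqrt n * m n tending to tau gam. The case tau =
    0 gives the null law. *)
Lemma clt_experiment r :
  pr (iid (Q n) n) [set z | scaled_sum z <= r] @[n --> \oo]
  --> gcdf (r - tau * Num.sqrt gam).
Proof.
have sg0 : 0 < Num.sqrt gam by rewrite sqrtr_gt0.
pose m n := \int[Q n]_x psi x.
pose k n := (Num.sqrt (n%:R * gam))^-1.
pose g n x := k n * (psi x - m n).
have mg n : measurable_fun [set: T] (g n).
  by apply: measurable_funM => //; exact: measurable_funB.
have c1 : m n @[n --> \oo] --> (0 : R).
  rewrite -psi0; apply: Q_moment_cvg => // x.
  apply: (@le_trans _ _ (`|psi x| + 0)); first by rewrite addr0.
  have := normr_ge0 (psi x); set y := `|psi x| => y0.
  have [y1|/ltW y1] := leP y 1; first by rewrite addr0 (le_trans y1)// lerDl exprn_ge0.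
  have : y <= y ^+ 3 by rewrite -{1}(expr1 y) ler_weXn2l.
  lra.
have c2 : \int[Q n]_x (psi x ^+ 2) @[n --> \oo] --> gam.
  apply: Q_moment_cvg => [|x]; first exact: measurable_funX.
  rewrite normrX; have := normr_ge0 (psi x); set y := `|psi x| => y0.
  have [y1|/ltW y1] := leP y 1.
    by rewrite (@le_trans _ _ 1)// ?expr_le1// lerDl exprn_ge0.
  have : y ^+ 2 <= y ^+ 3 by rewrite ler_weXn2l.
  lra.
have c3 : \int[Q n]_x (`|psi x| ^+ 3) @[n --> \oo] --> \int[P]_x (`|psi x| ^+ 3).
  apply: Q_moment_cvg => [|x].
    by apply: measurable_funX; exact: measurableT_comp.
  by rewrite normrX normr_id lerDr.
have IQ : \forall n \near \oo, [/\ intg (Q n) psi, intg (Q n) (fun x => psi x ^+ 2)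
    & intg (Q n) (fun x => `|psi x| ^+ 3)].
  have mp3 : measurable_fun [set: T] (fun x => `|psi x| ^+ 3).
    by apply: measurable_funX; exact: measurableT_comp.
  have : \forall n \near \oo, intg (Q n) (fun x => `|psi x| ^+ 3).
    have := Q_moment mp3.
    move=> /(_ _)/wrap[|h].
      by move=> x; rewrite normrX normr_id lerDr.
    by apply: filterS h => n [].
  apply: filterS => n I3.
  have I13 : intg (Q n) (fun x => 1 + `|psi x| ^+ 3).
    by apply: intgD => //; exact: intg_cst.
  split => //.
  - apply: (intg_le _ _ I13) => // x.
    have := normr_ge0 (psi x); set y := `|psi x| => y0.
    have [y1|/ltW y1] := leP y 1; first by rewrite (le_trans y1)// lerDl exprn_ge0.
    have : y <= y ^+ 3 by rewrite -{1}(expr1 y) ler_weXn2l.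
    lra.
  - apply: (intg_le _ _ I13) => [|x]; first exact: measurable_funX.
    rewrite normrX; have := normr_ge0 (psi x); set y := `|psi x| => y0.
    have [y1|/ltW y1] := leP y 1.
      by rewrite (@le_trans _ _ 1)// ?expr_le1// lerDl exprn_ge0.
    have : y ^+ 2 <= y ^+ 3 by rewrite ler_weXn2l.
    lra.
have cube_split (a b : R) : `|a - b| ^+ 3 <= 4 * `|a| ^+ 3 + 4 * `|b| ^+ 3.
  apply: (@le_trans _ _ ((`|a| + `|b|) ^+ 3)).
    by rewrite lerXn2r ?nnegrE ?addr_ge0// ler_normB.
  have := normr_ge0 a; have := normr_ge0 b.
  set x := `|a|; set y := `|b| => y0 x0.
  have : 0 <= (x + y) * (x - y) ^+ 2 by rewrite mulr_ge0 ?addr_ge0 ?sqr_ge0.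
  nra.
have gprop : \forall n \near \oo, [/\ intg (Q n) (g n), intg (Q n) (fun y => g n y ^+ 2),
    intg (Q n) (fun y => `|g n y| ^+ 3) & \int[Q n]_y g n y = 0] /\
   (n%:R * \int[Q n]_y (g n y ^+ 2) = (\int[Q n]_x (psi x ^+ 2) - m n ^+ 2) / gam
    /\ n%:R * \int[Q n]_y (`|g n y| ^+ 3) <=
     (Num.sqrt n%:R)^-1 * ((Num.sqrt gam ^+ 3)^-1 *
       (4 * \int[Q n]_x (`|psi x| ^+ 3) + 4 * `|m n| ^+ 3))).
  near=> n.
  have [I1 I2 I3] : [/\ intg (Q n) psi, intg (Q n) (fun x => psi x ^+ 2)
    & intg (Q n) (fun x => `|psi x| ^+ 3)] by near: n; exact: IQ.
  have n0 : (0 < n)%N by near: n; exists 1%N.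
  have nR0 : 0 < (n%:R : R) by rewrite ltr0n.
  have s0 : 0 < Num.sqrt (n%:R : R) by rewrite sqrtr_gt0.
  have k0 : 0 < k n by rewrite invr_gt0 sqrtr_gt0 mulr_gt0.
  have kE : k n = (Num.sqrt n%:R)^-1 * (Num.sqrt gam)^-1.
    by rewrite /k sqrtrM ?ler0n// invfM.
  have g1E : g n = fun x => k n * psi x - k n * m n.
    by apply/funext => x; rewrite /g mulrBr.
  have Ig : intg (Q n) (g n).
    by rewrite g1E; apply: intgB; [exact: intgZ|exact: intg_cst].
  have g2E : (fun y => g n y ^+ 2) = fun x => k n ^+ 2 * m n ^+ 2 +
      (- 2 * k n ^+ 2 * m n) * psi x + k n ^+ 2 * psi x ^+ 2.
    by apply/funext => x; rewrite /g; ring.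
  have Ig2 : intg (Q n) (fun y => g n y ^+ 2).
    rewrite g2E; do 2 (apply: intgD; last exact: intgZ); exact: intg_cst.
  have g3 x : `|g n x| ^+ 3 <= k n ^+ 3 * (4 * `|psi x| ^+ 3 + 4 * `|m n| ^+ 3).
    by rewrite /g normrM (gtr0_norm k0) exprMn ler_wpM2l// exprn_ge0// ltW.
  have Ib : intg (Q n) (fun x => k n ^+ 3 * (4 * `|psi x| ^+ 3 + 4 * `|m n| ^+ 3)).
    by apply: intgZ; apply: intgD; [exact: intgZ|exact: intg_cst].
  have Ig3 : intg (Q n) (fun y => `|g n y| ^+ 3).
    apply: (intg_le _ _ Ib) => [|x].
      by apply: measurable_funX; exact: measurableT_comp.
    by rewrite normrX normr_id.
  split; first split => //.
  - rewrite g1E RintB; [|exact: intgZ|exact: intg_cst].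
    by rewrite RintZ// Rint_cst -/(m n) subrr.
  split.
  - have -> : \int[Q n]_y (g n y ^+ 2) = k n ^+ 2 * m n ^+ 2 +
       (- 2 * k n ^+ 2 * m n) * m n + k n ^+ 2 * \int[Q n]_x (psi x ^+ 2).
      by rewrite -(Rint_affine2 _ _ _ I1 I2); congr Rintegral; exact: g2E.
    have k2 : k n ^+ 2 = (n%:R * gam)^-1.
      by rewrite /k exprVn sqr_sqrtr// mulr_ge0// ltW.
    by rewrite k2; field; rewrite !gt_eqF.
  - apply: (@le_trans _ _ (n%:R * (k n ^+ 3 * (4 * \int[Q n]_x (`|psi x| ^+ 3) + 4 * `|m n| ^+ 3)))).
      rewrite ler_wpM2l ?ler0n//.
      have -> : k n ^+ 3 * (4 * \int[Q n]_x `|psi x| ^+ 3 + 4 * `|m n| ^+ 3) =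
         \int[Q n]_x (k n ^+ 3 * (4 * `|psi x| ^+ 3 + 4 * `|m n| ^+ 3)).
        rewrite RintZ; last by apply: intgD; [exact: intgZ|exact: intg_cst].
        rewrite RintD; [|exact: intgZ|exact: intg_cst].
        by rewrite RintZ// Rint_cst.
      exact: le_Rint.
    rewrite le_eqVlt; apply/orP; left; apply/eqP.
    rewrite kE -{1}(@sqr_sqrtr _ n%:R) ?ler0n//.
    by field; rewrite !gt_eqF.
have key := @clt_array _ _ _ Q g.
have {}key : forall r, pr (iid (Q n) n) [set z | \sum_(i < n) g n (tnth z i) <= r]
    @[n --> \oo] --> gcdf (r - 0).
  move=> s; rewrite subr0; apply: key.
  - by apply: filterS gprop => n [].
  - rewrite [X in _ --> X](_ : _ = (gam - 0 ^+ 2) / gam); last first.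
      by rewrite expr0n subr0 divff// gt_eqF.
    apply: cvg_trans (_ : (\int[Q n]_x (psi x ^+ 2) - m n ^+ 2) / gam @[n --> \oo] --> _).
      by apply: near_eq_cvg; apply: filterS gprop => n [_ [-> _]].
    apply: cvgMl; apply: cvgB => //.
    apply: (@cvg_comp _ _ _ m (fun x => x ^+ 2) _ _ _ c1).
    exact: (@exprn_continuous R 2 0).
  - apply: (@squeeze_cvgr _ _ _ _ (cst 0) (fun n => (Num.sqrt n%:R)^-1 * ((Num.sqrt gam ^+ 3)^-1 *
       (4 * \int[Q n]_x (`|psi x| ^+ 3) + 4 * `|m n| ^+ 3)))).
    + apply: filterS gprop => n [_ [_ ->]]; rewrite andbT mulr_ge0//.
      by apply: Rintegral_ge0 => x _; rewrite exprn_ge0.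
    + exact: cvg_cst.
    + rewrite -[X in _ --> X](mul0r ((Num.sqrt gam ^+ 3)^-1 *
       (4 * \int[P]_x (`|psi x| ^+ 3) + 4 * `|0 : R| ^+ 3))).
      apply: cvgM; first exact: cvg_sqrt_invn.
      apply: cvgMr; apply: cvgD; apply: cvgMr => //.
      apply: (@cvg_comp _ _ _ (fun n => `|m n|) (fun x => x ^+ 3) _ (nbhs `|0 : R|)).
        exact: cvg_norm.
      exact: (@exprn_continuous R 3 `|0|).
(* The difference with the centered sum and its limiting mean does not depend on the sample, so the
   event in Slutsky's lemma is eventually empty. *)
have dE n (z : n.-tuple T) : (0 < n)%N ->
    scaled_sum z - (\sum_(i < n) g n (tnth z i) + tau * Num.sqrt gam) =
    (Num.sqrt n%:R * m n - tau * gam) / Num.sqrt gam.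
  move=> n0; have nR0 : 0 < (n%:R : R) by rewrite ltr0n.
  have s0 : 0 < Num.sqrt (n%:R : R) by rewrite sqrtr_gt0.
  have -> : \sum_(i < n) g n (tnth z i) =
      k n * (\sum_(i < n) psi (tnth z i) - n%:R * m n).
    by rewrite /g -mulr_sumr sumrB big_const_ord iter_addr_0 mulr_natl.
  have kE : k n = (Num.sqrt n%:R)^-1 * (Num.sqrt gam)^-1.
    by rewrite /k sqrtrM ?ler0n// invfM.
  rewrite /scaled_sum -/(k n) kE.
  set X := \sum_(i < n) _.
  rewrite -{3}(@sqr_sqrtr _ n%:R) ?ler0n// -{4}(@sqr_sqrtr _ gam) ?ltW//.
  by field; rewrite !gt_eqF.
have mS n : measurable_fun [set: n.-tuple T]
    (fun z => \sum_(i < n) g n (tnth z i) + tau * Num.sqrt gam).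
  by apply: measurable_funD => //; exact: measurable_iid_sum.
apply: (@slutsky _ (fun n => n.-tuple T) R (fun n => iid (Q n) n)
  (fun n z => \sum_(i < n) g n (tnth z i) + tau * Num.sqrt gam)
  (fun n z => scaled_sum z) mS measurable_scaled_sum).
  move=> s; have := key (s - tau * Num.sqrt gam); rewrite subr0.
  apply: cvg_trans; apply: near_eq_cvg; apply: nearW => n.
  by congr pr; apply/seteqP; split => z /=; rewrite lerBrDr.
move=> e e0; apply: cvg_near_cst.
have : (Num.sqrt n%:R * m n - tau * gam) / Num.sqrt gam @[n --> \oo] --> 0.
  rewrite -(mul0r (Num.sqrt gam)^-1); apply: cvgMl.
  by rewrite -(subrr (tau * gam)); apply: cvgB => //; [exact: sqrt_mean_cvg|exact: cvg_cst].
move/cvgrPdist_le => /(_ _ e0) h.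
near=> n.
have n0 : (0 < n)%N by near: n; exists 1%N.
rewrite (_ : [set _ | _] = set0); first by rewrite /pr measure0.
apply/seteqP; split => // z /=; rewrite dE//.
have : `|0 - (Num.sqrt n%:R * m n - tau * gam) / Num.sqrt gam| <= e by near: n.
by rewrite sub0r normrN leNgt => /negP.
Unshelve. all: by end_near. Qed.

End alternative_clt.

(** * Contiguity from the second moment of the likelihood ratio *)

Section contiguity.
Context d (T : measurableType d) {R : realType}.
Variables (P : probability T R) (psi : T -> R).
Hypotheses (mpsi : measurable_fun [set: T] psi).
Hypothesis I4 : intg P (fun x => psi x ^+ 4).
Hypothesis psi0 : \int[P]_x psi x = 0.
Let gam := \int[P]_x (psi x ^+ 2).
Hypothesis gam0 : 0 < gam.
Variables (tau : R) (l : nat -> T -> R) (Q : nat -> probability T R).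
Local Notation xi := (local_xi tau).
Hypothesis lP : likelihood_ratios P psi tau l Q.

Definition lik n (z : n.-tuple T) : R := \prod_(i < n) l n (tnth z i).

(** As l has mean 1, E l^2 = 1 + E (l - 1)^2 <= 1 + xi^2 gam. Its n-th power is at most exp (n xi^2
    gam) = exp (tau^2 gam), whatever n. *)
Lemma lik_density : \forall n \near \oo,
  [/\ measurable_fun [set: n.-tuple T] (@lik n),
   forall z : n.-tuple T, 0 <= lik z,
   forall A : set (n.-tuple T), measurable A ->
     (iid (Q n) n A = \int[iid P n]_(z in A) (lik z)%:E)%E &
   (\int[iid P n]_z (lik z ^+ 2)%:E <= (expR (tau ^+ 2 * gam))%:E)%E].
Proof.
near=> n.
have [ml l0 QE l1 _] : [/\ measurable_fun [set: T] (l n),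
  forall x, 0 <= l n x,
  forall A, measurable A -> (Q n A = \int[P]_(x in A) (l n x)%:E)%E,
  forall x, `|l n x - 1| <= `|xi n * psi x| &
  forall x, l n x - 1 = xi n * psi x \/ 1 <= `|xi n * psi x|].
  by near: n; exact: lP.
have n0 : (0 < n)%N by near: n; exists 1%N.
have mlik : measurable_fun [set: n.-tuple T] (@lik n) by exact: measurable_iid_prod.
split => //.
- by move=> z; exact: prodr_ge0.
- move=> A mA; have mA1 : measurable_fun [set: n.-tuple T] (fun z => (\1_A z)%:E : \bar R).
    by apply/measurable_EFinP; exact: measurable_indic.
  have := @iid_density _ _ _ P _ _ ml l0 QE n _ mA1 _.
  rewrite integral_indic// setIT => ->; last by move=> z; rewrite lee_fin indicE.
  rewrite [RHS]integral_mkcond; apply: eq_integral => z _.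
  rewrite /= patchE indicE; case: ifP => zA /=; first by rewrite mul1e.
  by rewrite mul0e.
- have I2 := intg_psi2 mpsi I4.
  have Ix : intg P (fun x => `|xi n * psi x|).
    by apply: intg_norm; apply: intgZ; exact: intg_psi1.
  have Il1 : intg P (fun x => l n x - 1).
    by apply: (intg_le _ l1) => //; exact: measurable_funB.
  have Il : intg P (l n).
    rewrite (_ : l n = fun x => (l n x - 1) + 1); last first.
      by apply/funext => x; rewrite subrK.
    by apply: intgD => //; exact: intg_cst.
  have il1 : \int[P]_x l n x = 1.
    rewrite /Rintegral -QE//.
    have -> : (Q n [set: T] = 1)%E by exact: probability_setT.
    by [].
  have sq x : (l n x - 1) ^+ 2 <= xi n ^+ 2 * psi x ^+ 2.
    rewrite -exprMn -[leLHS]real_normK ?num_real// -[leRHS]real_normK ?num_real//.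
    by rewrite lerXn2r ?nnegrE.
  have Ilq : intg P (fun x => (l n x - 1) ^+ 2).
    apply: (intg_le _ _ (intgZ (xi n ^+ 2) I2)).
      by apply: measurable_funX; exact: measurable_funB.
    by move=> x; rewrite ger0_norm ?sqr_ge0.
  have l2E x : l n x ^+ 2 = (-1) + 2 * l n x + 1 * (l n x - 1) ^+ 2 by ring.
  have Il2 : intg P (fun x => l n x ^+ 2).
    under eq_fun => x do rewrite l2E.
    do 2 (apply: intgD; last exact: intgZ); exact: intg_cst.
  have bd : \int[P]_x (l n x ^+ 2) <= 1 + xi n ^+ 2 * gam.
    under eq_Rintegral => x _ do rewrite l2E.
    rewrite Rint_affine2// il1 -(RintZ (xi n ^+ 2) I2) (_ : - 1 + 2 * 1 = 1); last by ring.
    by rewrite lerD2l mul1r; apply: le_Rint => //; exact: intgZ.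
  under eq_integral => z _ do rewrite /lik -prodrXl.
  have := @iid_prod_le _ _ _ P n (fun x => l n x ^+ 2) (1 + xi n ^+ 2 * gam) _ _ _.
  have xg : 0 <= xi n ^+ 2 * gam by rewrite mulr_ge0 ?sqr_ge0 ?ltW.
  move=> h; apply: (le_trans (h _ _ _)).
  + exact: measurable_funX.
  + by move=> x; rewrite sqr_ge0.
  + by rewrite intg_EFin.
  rewrite lee_fin (@le_trans _ _ (expR (xi n ^+ 2 * gam) ^+ n))//.
    by rewrite lerXn2r ?nnegrE ?expR_ge0 ?addr_ge0// expR_ge1Dx.
  rewrite -expRM_natl ler_expR xi_sqr -?lt0n// -mulr_natl.
  by rewrite le_eqVlt; apply/orP; left; apply/eqP; field; rewrite pnatr_eq0 -lt0n.
Unshelve. all: by end_near. Qed.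

(* Integrate L <= K + L^2 / K over A, with E L^2 <= exp (tau^2 gam). *)
Lemma contiguity_bound (K : R) : 0 < K ->
  \forall n \near \oo, forall A : set (n.-tuple T), measurable A ->
    pr (iid (Q n) n) A <= K * pr (iid P n) A + expR (tau ^+ 2 * gam) / K.
Proof.
move=> K0; apply: filterS lik_density => n [mL L0 LE L2] A mA.
have IL2 : intg (iid P n) (fun z => lik z ^+ 2).
  apply: intg_ge0; [exact: measurable_funX|by move=> z; rewrite sqr_ge0|].
  by rewrite (le_lt_trans L2)// ltry.
have I1 := intg_indic (iid P n) mA.
have le z : \1_A z * lik z <= K * \1_A z + K^-1 * lik z ^+ 2.
  rewrite indicE; case: (_ \in _); last first.
    by rewrite mul0r mulr0 add0r mulr_ge0 ?sqr_ge0// invr_ge0 ltW.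
  rewrite mul1r mulr1.
  have -> : K + K^-1 * lik z ^+ 2 = K^-1 * (K ^+ 2 + lik z ^+ 2).
    by field; rewrite gt_eqF.
  rewrite ler_pdivlMl//; have := L0 z; have := sqr_ge0 (K - lik z); nra.
have Ib : intg (iid P n) (fun z => K * \1_A z + K^-1 * lik z ^+ 2).
  by apply: intgD; exact: intgZ.
have IA : intg (iid P n) (fun z => \1_A z * lik z).
  apply: (intg_le _ _ Ib); first by apply: measurable_funM.
  by move=> z; rewrite ger0_norm// mulr_ge0 ?indicE.
rewrite pr_Rint// (Rint_density mL L0 LE)//.
apply: (le_trans (le_Rint IA Ib le)).
rewrite RintD ?RintZ//; [|exact: intgZ|exact: intgZ].
rewrite pr_Rint// lerD2l mulrC ler_wpM2r ?invr_ge0 ?(ltW K0)//.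
by rewrite -lee_fin -intg_EFin.
Qed.

Lemma contiguity (A : forall n, set (n.-tuple T)) :
  (\forall n \near \oo, measurable (A n)) ->
  pr (iid P n) (A n) @[n --> \oo] --> (0 : R) ->
  pr (iid (Q n) n) (A n) @[n --> \oo] --> (0 : R).
Proof.
move=> mA PA; apply/cvgrPdist_le => e e0.
have e2 : 0 < e / 2 by rewrite divr_gt0.
have E0 := expR_gt0 (tau ^+ 2 * gam); set E := expR _ in E0.
(* This makes the second term of [contiguity_bound] equal to e / 2. *)
pose K := 2 * E / e.
have K0 : 0 < K by rewrite divr_gt0 ?mulr_gt0.
have eK : 0 < e / 2 / K by rewrite divr_gt0.
move/cvgrPdist_le : PA => /(_ _ eK) PA.
near=> n.
have mAn : measurable (A n) by near: n.
rewrite sub0r normrN ger0_norm ?pr_ge0//.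
have : forall A : set (n.-tuple T), measurable A ->
    pr (iid (Q n) n) A <= K * pr (iid P n) A + E / K.
  by near: n; exact: contiguity_bound.
move=> /(_ _ mAn) /le_trans; apply.
have : `|0 - pr (iid P n) (A n)| <= e / 2 / K by near: n.
rewrite sub0r normrN ger0_norm ?pr_ge0// ler_pdivlMr// mulrC => h.
have -> : E / K = e / 2.
  by rewrite /K; field; rewrite !gt_eqF.
lra.
Unshelve. all: by end_near. Qed.

End contiguity.

(** * Expansion of the likelihood ratio and the Neyman-Pearson inequality *)

Section neyman_pearson.
Context d (T : measurableType d) {R : realType}.
Variables (P : probability T R) (psi : T -> R).
Hypotheses (mpsi : measurable_fun [set: T] psi).
Hypothesis I4 : intg P (fun x => psi x ^+ 4).
Hypothesis psi0 : \int[P]_x psi x = 0.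
Let gam := \int[P]_x (psi x ^+ 2).
Hypothesis gam0 : 0 < gam.
Variables (tau : R) (l : nat -> T -> R) (Q : nat -> probability T R).
Local Notation xi := (local_xi tau).
Hypothesis lP : likelihood_ratios P psi tau l Q.

Local Notation lik := (lik l).
Local Notation scaled_sum := (scaled_sum P psi).

(** Markov's inequality, as n |xi|^3 is |tau|^3 / sqrt n. This one event controls both the largest
    |xi psi|, hence the truncation, and the cubic remainder of the logarithm. *)
Lemma sum_psi3_small (eta : R) : 0 < eta ->
  pr (iid P n) [set z | eta <= \sum_(i < n) `|xi n * psi (tnth z i)| ^+ 3]
    @[n --> \oo] --> (0 : R).
Proof.
move=> eta0; pose C := \int[P]_x (`|psi x| ^+ 3).
have I3 := intg_psi3 mpsi I4.
have C0 : 0 <= C by apply: Rintegral_ge0 => x _; rewrite exprn_ge0.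
have m3 n : measurable_fun [set: T] (fun x => `|xi n * psi x| ^+ 3).
  by apply: measurable_funX; apply: measurableT_comp => //; exact: measurable_funM.
have mA n : measurable [set z : n.-tuple T | eta <= \sum_(i < n) `|xi n * psi (tnth z i)| ^+ 3].
  rewrite (_ : [set _ | _] = (fun z : n.-tuple T => \sum_(i < n) `|xi n * psi (tnth z i)| ^+ 3)
     @^-1` `[eta, +oo[); last by apply/seteqP; split => z /=; rewrite in_itv/= andbT.
  rewrite -[X in measurable X]setTI; exact: (measurable_iid_sum (m3 n)).
apply: (@squeeze_cvgr _ _ _ _ (cst 0) (fun n => `|tau| ^+ 3 * (Num.sqrt n%:R)^-1 * C / eta)).
- near=> n; rewrite pr_ge0/=.
  have n0 : (0 < n)%N by near: n; exists 1%N.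
  have s0 : 0 < Num.sqrt (n%:R : R) by rewrite sqrtr_gt0 ltr0n.
  have -> : `|tau| ^+ 3 * (Num.sqrt n%:R)^-1 * C / eta = (n%:R * (`|xi n| ^+ 3 * C)) / eta.
    rewrite /local_xi normrM normfV (gtr0_norm s0).
    rewrite -{2}(@sqr_sqrtr _ n%:R) ?ler0n//.
    by field; rewrite !gt_eqF.
  apply: (@markov_pr _ _ _ (iid P n) (fun z => \sum_(i < n) `|xi n * psi (tnth z i)| ^+ 3)) => //.
  + exact: mA.
  + exact: (measurable_iid_sum (m3 n)).
  + by move=> z; apply: sumr_ge0 => i _; rewrite exprn_ge0.
  + apply: (@iid_sum_le _ _ _ P n _ _ (m3 n)).
      by move=> x; rewrite exprn_ge0.
    rewrite (eq_integral (fun x => (`|xi n| ^+ 3 * `|psi x| ^+ 3)%:E)); last first.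
      by move=> x _; rewrite normrM exprMn.
    by rewrite intg_EFin ?RintZ//; exact: intgZ.
- exact: cvg_cst.
- rewrite -(mul0r eta^-1) -{1}(mul0r C) -{1}(mulr0 (`|tau| ^+ 3)).
  apply: cvgMl; apply: cvgMl; apply: cvgMr; exact: cvg_sqrt_invn.
Unshelve. all: by end_near. Qed.

Lemma sum_psi2_lln (del : R) : 0 < del ->
  pr (iid P n) [set z | n%:R * del <= `|\sum_(i < n) (psi (tnth z i) ^+ 2 - gam)|]
    @[n --> \oo] --> (0 : R).
Proof.
move=> del0; pose h x := psi x ^+ 2 - gam.
have I2 := intg_psi2 mpsi I4.
have h2E : (fun x => h x ^+ 2) = fun x => gam ^+ 2 + - 2 * gam * psi x ^+ 2 + 1 * psi x ^+ 4.
  by apply/funext => x; rewrite /h; ring.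
have Ih : intg P h by apply: intgB => //; exact: intg_cst.
have Ih2 : intg P (fun x => h x ^+ 2).
  rewrite h2E; do 2 (apply: intgD; last exact: intgZ); exact: intg_cst.
have h0 : \int[P]_x h x = 0.
  by rewrite /h RintB//; [rewrite Rint_cst subrr|exact: intg_cst].
have mh := intg_measurable Ih.
have mA n : measurable [set z : n.-tuple T | n%:R * del <= `|\sum_(i < n) h (tnth z i)|].
  rewrite (_ : [set _ | _] = (fun z : n.-tuple T => `|\sum_(i < n) h (tnth z i)|)
     @^-1` `[n%:R * del, +oo[); last by apply/seteqP; split => z /=; rewrite in_itv/= andbT.
  rewrite -[X in measurable X]setTI; apply: measurableT_comp => //.
  exact: measurable_iid_sum.
pose V := \int[P]_x (h x ^+ 2).
apply: (@squeeze_cvgr _ _ _ _ (cst 0) (fun n => n%:R^-1 * (V / del ^+ 2))).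
- near=> n; rewrite pr_ge0/=.
  have n0 : (0 < n)%N by near: n; exists 1%N.
  have nR0 : 0 < (n%:R : R) by rewrite ltr0n.
  have nd : 0 < n%:R * del by rewrite mulr_gt0.
  have := chebyshev_iid Ih Ih2 nd (mA n) (fun z Az => Az).
  rewrite h0 mulr0 expr0n addr0 -/V => /le_trans; apply.
  rewrite le_eqVlt; apply/orP; left; apply/eqP; field.
  by rewrite !gt_eqF.
- exact: cvg_cst.
- by rewrite -(mul0r (V / del ^+ 2)); apply: cvgMl; exact: cvg_invn.
Unshelve. all: by end_near. Qed.

(* Limit of the log-likelihood ratio; [lan_bad e] is the event on which the
   likelihood ratio differs from [expR lan] by a factor beyond [expR (- e), expR e]. *)
Definition lan n (z : n.-tuple T) : R :=
  tau * Num.sqrt gam * scaled_sum z - tau ^+ 2 * gam / 2.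

Definition lan_bad (e : R) n : set (n.-tuple T) :=
  [set z | 0 < expR (lan z - e) - lik z] `|` [set z | 0 < lik z - expR (lan z + e)].

Lemma measurable_lan n : measurable_fun [set: n.-tuple T] (@lan n).
Proof.
apply: measurable_funB => //; apply: measurable_funM => //.
exact: measurable_scaled_sum.
Qed.

(** Off the two events on the right no factor is truncated, the likelihood ratio is the product of
    the 1 + xi psi, and the second-order expansion of its logarithm holds sample by sample. *)
Lemma lan_bad_incl (e : R) : 0 < e -> exists eta del : R, [/\ 0 < eta, 0 < del &
  \forall n \near \oo, @lan_bad e n `<=`
    [set z | eta <= \sum_(i < n) `|xi n * psi (tnth z i)| ^+ 3] `|`
    [set z | n%:R * del <= `|\sum_(i < n) (psi (tnth z i) ^+ 2 - gam)|]].
Proof.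
(* A sum of cubes below 1 / 8 forces each |xi psi| <= 1 / 2. The cubic remainder is at most 2 eta <=
   e / 2, and the fluctuation of the quadratic term at most tau^2 / 2 * del <= e / 2. *)
move=> e0; pose eta := Num.min (8^-1) (e / 4); pose del := e / (tau ^+ 2 + 1).
have t0 := sqr_ge0 tau.
have eta0 : 0 < eta by rewrite /eta lt_min invr_gt0 divr_gt0// andbT ltr0n.
exists eta, del; split => //; first by rewrite divr_gt0// ltr_wpDl.
near=> n.
have [ml l0 _ l1 l2] : [/\ measurable_fun [set: T] (l n),
  forall x, 0 <= l n x,
  forall A, measurable A -> (Q n A = \int[P]_(x in A) (l n x)%:E)%E,
  forall x, `|l n x - 1| <= `|xi n * psi x| &
  forall x, l n x - 1 = xi n * psi x \/ 1 <= `|xi n * psi x|].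
  by near: n; exact: lP.
have n0 : (0 < n)%N by near: n; exists 1%N.
have nR0 : 0 < (n%:R : R) by rewrite ltr0n.
have s0 : 0 < Num.sqrt (n%:R : R) by rewrite sqrtr_gt0.
have sg0 : 0 < Num.sqrt gam by rewrite sqrtr_gt0.
move=> z bad; apply: contrapT => /not_orP[/negP]; rewrite -ltNge => h3.
move/negP; rewrite -ltNge => h2.
pose a i := xi n * psi (tnth z i).
have a3 i : `|a i| ^+ 3 < 8^-1.
  apply: (@lt_le_trans _ _ eta); last by rewrite /eta ge_min lexx.
  apply: le_lt_trans h3; rewrite (bigD1 i)//= lerDl.
  by apply: sumr_ge0 => j _; rewrite exprn_ge0.
have a2 i : `|a i| <= 2^-1.
  rewrite leNgt; apply/negP => h; have := a3 i; rewrite ltNge => /negP; apply.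
  have -> : (8^-1 : R) = 2^-1 ^+ 3 by field.
  by rewrite lerXn2r ?nnegrE ?invr_ge0// ltW.
have la i : l n (tnth z i) = 1 + a i.
  have [h|h] := l2 (tnth z i); first by rewrite -[X in _ + X]h addrC subrK.
  have := le_trans h (a2 i); lra.
have a1 i : 0 < 1 + a i.
  by have := a2 i; rewrite ler_norml => /andP[]; lra.
have likE : lik z = expR (\sum_(i < n) ln (1 + a i)).
  rewrite expR_sum /lik; apply: eq_bigr => i _.
  by rewrite lnK ?posrE// la.
pose s1 := \sum_(i < n) a i; pose s2 := \sum_(i < n) a i ^+ 2 / 2.
have b1 : `|\sum_(i < n) ln (1 + a i) - s1 + s2| <= 2 * eta.
  rewrite /s1 /s2 -sumrB -big_split/=.
  apply: (le_trans (ler_norm_sum _ _ _)).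
  apply: (@le_trans _ _ (\sum_(i < n) 2 * `|a i| ^+ 3)).
    by apply: ler_sum => i _; exact: ln1p_taylor.
  by rewrite -mulr_sumr ler_wpM2l// ltW.
have s1E : s1 = tau * Num.sqrt gam * scaled_sum z.
  rewrite /s1 /a -mulr_sumr /scaled_sum sqrtrM ?ler0n// /local_xi -/gam.
  by field; rewrite !gt_eqF.
have b2 : `|s2 - tau ^+ 2 * gam / 2| <= e / 2.
  have -> : s2 - tau ^+ 2 * gam / 2 =
     tau ^+ 2 / 2 * (n%:R^-1 * \sum_(i < n) (psi (tnth z i) ^+ 2 - gam)).
    rewrite sumrB big_const_ord iter_addr_0 -[gam *+ n]mulr_natl /s2.
    under eq_bigr => i _ do rewrite /a exprMn xi_sqr -?lt0n// mulrAC.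
    by rewrite -mulr_sumr; field; rewrite gt_eqF.
  rewrite normrM ger0_norm; last by rewrite divr_ge0.
  rewrite normrM gtr0_norm ?invr_gt0//.
  apply: (@le_trans _ _ (tau ^+ 2 / 2 * del)).
    rewrite ler_wpM2l ?divr_ge0// ler_pdivrMl//; exact: ltW.
  have del0 : 0 < del by rewrite divr_gt0// ltr_wpDl.
  have dE : del * (tau ^+ 2 + 1) = e.
    by rewrite /del divfK// gt_eqF// ltr_wpDl.
  by rewrite -dE; lra.
have eta4 : 2 * eta <= e / 2.
  have : eta <= e / 4 by rewrite /eta ge_min lexx orbT.
  lra.
case: bad => /=; rewrite subr_gt0 likE ltr_expR /lan -s1E.
  move: b1 b2; rewrite !ler_norml => /andP[? ?] /andP[? ?]; lra.
by move: b1 b2; rewrite !ler_norml => /andP[? ?] /andP[? ?]; lra.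
Unshelve. all: by end_near. Qed.

Lemma measurable_lan_bad (e : R) : \forall n \near \oo, measurable (@lan_bad e n).
Proof.
apply: filterS (lik_density mpsi I4 gam0 lP) => n [mL _ _ _].
have mE c : measurable_fun [set: n.-tuple T] (fun z => expR (lan z + c)).
  by apply: measurableT_comp => //; apply: measurable_funD => //; exact: measurable_lan.
by apply: measurableU; apply: (@measurable_gt_cst _ (fun n => n.-tuple T));
  exact: measurable_funB.
Qed.

Lemma lan_bad_cvg (e : R) : 0 < e ->
  pr (iid P n) (@lan_bad e n) @[n --> \oo] --> (0 : R).
Proof.
move=> e0; have [eta [del [eta0 del0 inc]]] := lan_bad_incl e0.
have mI2 : intg P (fun x => psi x ^+ 2 - gam).
  by apply: intgB; [exact: intg_psi2|exact: intg_cst].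
have c1 := sum_psi3_small eta0; have c2 := sum_psi2_lln del0.
apply: (@squeeze_cvgr _ _ _ _ (cst 0)); last first.
- by have := cvgD c1 c2; rewrite addr0; exact.
- exact: cvg_cst.
near=> n; rewrite pr_ge0/=; apply: pr_setU; last by near: n.
- by near: n; exact: measurable_lan_bad.
- rewrite (_ : [set _ | _] = (fun z : n.-tuple T => \sum_(i < n) `|xi n * psi (tnth z i)| ^+ 3)
     @^-1` `[eta, +oo[); last by apply/seteqP; split => z /=; rewrite in_itv/= andbT.
  rewrite -[X in measurable X]setTI; apply: (@measurable_iid_sum _ _ R n (fun x => `|xi n * psi x| ^+ 3)) => //.
  by apply: measurable_funX; apply: measurableT_comp => //; exact: measurable_funM.
- rewrite (_ : [set _ | _] = (fun z : n.-tuple T => `|\sum_(i < n) (psi (tnth z i) ^+ 2 - gam)|)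
     @^-1` `[n%:R * del, +oo[); last by apply/seteqP; split => z /=; rewrite in_itv/= andbT.
  rewrite -[X in measurable X]setTI; apply: measurableT_comp => //.
  exact: (measurable_iid_sum (intg_measurable mI2)).
Unshelve. all: by end_near. Qed.

(** With D = t - phi and L the likelihood ratio, D (L - k) <= 0 if phi rejects exactly when L > k.
    Here k is the value of exp (c S - tau^2 gam / 2) at S = [za], and this equivalence holds up to a
    factor within exp (- eps'), exp eps' off a set [B] negligible under both laws. The multiplier k
    is fixed before delta, so that the size difference can be made small afterwards. *)
Lemma neyman_pearson (S' t : forall n, n.-tuple T -> R) (za : R) : 0 < tau ->
  (forall n, measurable_fun [set: n.-tuple T] (S' n)) ->
  (forall e, 0 < e -> pr (iid P n) [set z | e < `|S' n z - scaled_sum z|]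
    @[n --> \oo] --> (0 : R)) ->
  (forall n, measurable_fun [set: n.-tuple T] (t n) /\ forall z, 0 <= t n z <= 1) ->
  let phi n (z : n.-tuple T) : R := (za < S' n z)%R%:R in
  exists2 k : R, 0 <= k & forall delta, 0 < delta -> \forall n \near \oo,
    \int[iid (Q n) n]_z t n z - \int[iid (Q n) n]_z phi n z <=
    k * (\int[iid P n]_z t n z - \int[iid P n]_z phi n z) + delta.
Proof.
move=> tau0 mS' SS' tP phi.
pose c := tau * Num.sqrt gam; pose k := expR (c * za - tau ^+ 2 * gam / 2).
have c0 : 0 < c by rewrite mulr_gt0// sqrtr_gt0.
have k0 : 0 < k by exact: expR_gt0.
exists k; first exact: ltW.
move=> delta delta0.
(* Since exp eps' - 1 <= 2 eps' for eps' <= 1 / 2, the cost k (exp eps' - 1) is at most delta / 3;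
   the other two thirds go to k P(B) and Q(B). *)
pose eps' := Num.min (2^-1) (delta / (6 * k)).
have eps'0 : 0 < eps' by rewrite /eps' lt_min invr_gt0 ltr0n divr_gt0// mulr_gt0.
(* The expansion of the log-likelihood costs [eps], and the replacement of [scaled_sum] by [S']
   costs c * eps. *)
pose eps := eps' / (1 + c).
have eps0 : 0 < eps by rewrite divr_gt0// addr_gt0.
have epsE : eps * (1 + c) = eps' by rewrite divfK// gt_eqF// addr_gt0.
have expb : k * (expR eps' - 1) <= delta / 3.
  have e2 : eps' <= 2^-1 by rewrite /eps' ge_min lexx.
  have e3 : eps' <= delta / (6 * k) by rewrite /eps' ge_min lexx orbT.
  have : expR eps' - 1 <= 2 * eps'.
    have h : (1 - eps') * expR eps' <= 1.
      rewrite -ler_pdivlMr ?expR_gt0// div1r -expRN; exact: expR_ge1Dx.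
    have := expR_gt0 eps'; move: h e2 eps'0; set x := expR eps'.
    by clear; nra.
  move: e3; rewrite ler_pdivlMr ?mulr_gt0// => e3 h.
  apply: (@le_trans _ _ (k * (2 * eps'))); first by rewrite ler_wpM2l// ltW.
  lra.
pose B n := @lan_bad eps n `|` [set z | eps < `|S' n z - scaled_sum z|].
have mB2 n : measurable [set z | eps < `|S' n z - scaled_sum z|].
  apply: (@measurable_gt_cst _ (fun n => n.-tuple T) _ n).
  apply: measurableT_comp => //; apply: measurable_funB; first exact: mS'.
  exact: measurable_scaled_sum.
have mB : \forall n \near \oo, measurable (B n).
  by apply: filterS (measurable_lan_bad eps) => n h;
  exact: (measurableU _ _ h (mB2 n)).
have PB : pr (iid P n) (B n) @[n --> \oo] --> (0 : R).
  apply: (@squeeze_cvgr _ _ _ _ (cst 0)); last first.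
  - by have := cvgD (lan_bad_cvg eps0) (SS' _ eps0); rewrite addr0; exact.
  - exact: cvg_cst.
  apply: filterS (measurable_lan_bad eps) => n h; rewrite pr_ge0/=.
  by apply: pr_setU; [exact: (measurableU _ _ h (mB2 n))|exact: h|exact: mB2|].
have QB := contiguity mpsi I4 gam0 lP mB PB.
have d3 : 0 < delta / 3 by rewrite divr_gt0.
have dk3 : 0 < delta / 3 / k by rewrite divr_gt0.
move/cvgrPdist_le : PB => /(_ _ dk3) PB; move/cvgrPdist_le : QB => /(_ _ d3) QB.
near=> n.
have [mL L0 LE L2] : [/\ measurable_fun [set: n.-tuple T] (@lik n),
   forall z : n.-tuple T, 0 <= lik z,
   forall A : set (n.-tuple T), measurable A ->
     (iid (Q n) n A = \int[iid P n]_(z in A) (lik z)%:E)%E &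
   (\int[iid P n]_z (lik z ^+ 2)%:E <= (expR (tau ^+ 2 * gam))%:E)%E].
  by near: n; exact: (lik_density mpsi I4 gam0 lP).
have mBn : measurable (B n) by near: n.
have hPB : pr (iid P n) (B n) <= delta / 3 / k.
  have : `|0 - pr (iid P n) (B n)| <= delta / 3 / k by near: n.
  by rewrite sub0r normrN ger0_norm ?pr_ge0.
have hQB : pr (iid (Q n) n) (B n) <= delta / 3.
  have : `|0 - pr (iid (Q n) n) (B n)| <= delta / 3 by near: n.
  by rewrite sub0r normrN ger0_norm ?pr_ge0.
have [mt t01] := tP n.
have mphi : measurable_fun [set: n.-tuple T] (phi n).
  rewrite (_ : phi n = \1_[set z | za < S' n z]).
    apply: measurable_indic.
    by apply: (@measurable_gt_cst _ (fun n => n.-tuple T) _ n); exact: mS'.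
  apply/funext => z; rewrite indicE /phi; case: (boolP (za < S' n z)) => h.
    by rewrite mem_set.
  by rewrite memNset//; apply/negP.
pose D z := t n z - phi n z.
have mD : measurable_fun [set: n.-tuple T] D by exact: measurable_funB.
have phi01 z : 0 <= phi n z <= 1 by rewrite /phi; case: (_ < _); rewrite ?lexx ?ler01.
have D1 z : `|D z| <= 1.
  by have := t01 z; have := phi01 z; rewrite /D ler_norml => /andP[? ?] /andP[? ?]; lra.
have It (Pr : probability (n.-tuple T) R) : intg Pr (t n).
  by apply: (@intg_bounded _ _ _ _ _ 1) => // z; have /andP[? ?] := t01 z; rewrite ger0_norm.
have Iphi (Pr : probability (n.-tuple T) R) : intg Pr (phi n).
  by apply: (@intg_bounded _ _ _ _ _ 1) => // z; have /andP[? ?] := phi01 z; rewrite ger0_norm.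
have ID (Pr : probability (n.-tuple T) R) : intg Pr D by exact: intgB.
have IL : intg (iid P n) (@lik n).
  apply: (@intg_le _ _ _ _ _ (fun z => 1 + lik z ^+ 2)) => //.
    by move=> z; rewrite ger0_norm//; have := L0 z; have := sqr_ge0 (lik z - 1); nra.
  apply: intgD; first exact: intg_cst.
  apply: intg_ge0; [exact: measurable_funX|by move=> z; rewrite sqr_ge0|].
  by rewrite (le_lt_trans L2)// ltry.
have IDL : intg (iid P n) (fun z => D z * lik z).
  apply: (intg_le _ _ IL); first exact: measurable_funM.
  by move=> z; rewrite normrM (ger0_norm (L0 z)) ler_piMl.
have IB := intg_indic (iid P n) mBn.
have IBL : intg (iid P n) (fun z => \1_(B n) z * lik z).
  apply: (intg_le _ _ IL); first by apply: measurable_funM.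
  move=> z; rewrite normrM (ger0_norm (L0 z)) ler_piMl// indicE.
  by case: (_ \in _); rewrite ?normr1 ?normr0.
rewrite -!RintB// -/(D _) (Rint_density mL L0 LE)//.
(* On [B] the trivial bounds D L <= L and - k <= k D suffice; after integration they give Q(B) and k
   P(B). *)
have key z : D z * lik z <= k * (expR eps' - 1) + k * D z + 1 * (\1_(B n) z * lik z + k * \1_(B n) z).
  have E1 : 1 <= expR eps' by rewrite -expR0 ler_expR ltW.
  have DL : D z * lik z <= `|D z| * lik z by rewrite ler_wpM2r// ler_norm.
  have := D1 z; rewrite ler_norml => /andP[Dl Du].
  have kE0 : 0 <= k * (expR eps' - 1) by rewrite mulr_ge0 ?subr_ge0// ltW.
  rewrite indicE; case: (boolP (z \in B n)) => [_|].
    rewrite !mul1r mulr1.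
    have : D z * lik z <= lik z by rewrite ler_piMl.
    have : - k <= k * D z by rewrite -[X in X <= _]mulrN1 ler_pM2l.
    lra.
  rewrite notin_setE => /not_orP[/not_orP[/negP + /negP]] + /negP.
  rewrite -!leNgt !subr_le0 => hl hu hs.
  rewrite mul0r mulr0 addr0 mulr0 addr0.
  have lanE : lan z = c * scaled_sum z - tau ^+ 2 * gam / 2 by [].
  move: hs; rewrite ler_norml => /andP[hs1 hs2].
  rewrite -lerBlDr (mulrC k (D z)) -mulrBr.
  have cS : c * (S' n z - eps) <= c * scaled_sum z <= c * (S' n z + eps).
    by rewrite !ler_pM2l//; clear -hs1 hs2; apply/andP; split; lra.
  have /andP[cS1 cS2] := cS.
  (* In the rejection region D <= 0 and L >= k exp (- eps'); elsewhere D >= 0 and L <= k exp eps'.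
     Either way D (L - k) <= k (exp eps' - 1). *)
  case: (ltP za (S' n z)) => hz.
    have Dneg : D z <= 0.
      rewrite /D (_ : phi n z = 1) ?subr_le0; last by rewrite /phi hz.
      by have /andP[] := t01 z.
    have cz : c * za <= c * S' n z by rewrite ler_pM2l// ltW.
    have Lk : k * expR (- eps') <= lik z.
      apply: le_trans hl; rewrite /k -expRD ler_expR lanE -epsE; lra.
    (* Gives 1 - exp (- eps') <= exp eps' - 1, so that both cases share one error term. *)
    have EE : 2 <= expR eps' + expR (- eps').
      have := expR_gt0 eps'; have := expR_gt0 (- eps').
      have := expRxMexpNx_1 eps'; set x := expR eps'; set y := expR _.
      by move=> xy y0 x0; have := sqr_ge0 (x - y); nra.
    have h1 : k - lik z <= k * (expR eps' - 1).
      by have : k * 2 <= k * (expR eps' + expR (- eps')); [rewrite ler_pM2l|lra].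
    have [h2|h2] := leP (k - lik z) 0.
      by have := mulr_ge0_le0; nra.
    have : D z * (lik z - k) <= k - lik z by nra.
    lra.
  have Dpos : 0 <= D z.
    by rewrite /D /phi ltNge hz/= subr0; have /andP[] := t01 z.
  have cz : c * S' n z <= c * za by rewrite ler_pM2l.
  have Lk : lik z <= k * expR eps'.
    apply: (le_trans hu); rewrite /k -expRD ler_expR lanE -epsE; lra.
  have [h2|h2] := leP (lik z - k) 0; first by nra.
  have : D z * (lik z - k) <= lik z - k by nra.
  lra.
have IG : intg (iid P n) (fun z => \1_(B n) z * lik z + k * \1_(B n) z).
  by apply: intgD => //; exact: intgZ.
have := le_Rint IDL _ key => /(_ _)/wrap[|].
  by do 2 (apply: intgD; last exact: intgZ); exact: intg_cst.
rewrite (Rint_affine2 _ _ _ (ID _) IG) (RintD IBL (intgZ k IB)) (RintZ k IB).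
rewrite -(Rint_density mL L0 LE _ IBL); last exact: measurable_indic.
rewrite -pr_Rint// -pr_Rint// mul1r.
have : k * pr (iid P n) (B n) <= delta / 3 by rewrite mulrC -ler_pdivlMr.
move: expb hQB.
set x1 := pr _ _; set x2 := pr _ _; set x3 := \int[_]_x _; set x4 := \int[_]_x _.
clear; lra.
Unshelve. all: by end_near. Qed.

End neyman_pearson.

(** * Regularity of the densities in the class F1 *)

Section monotone.
Context {R : realType}.

(** One-sided limits exist and enclose f x, so a point where they agree is a continuity point; the
    jumps are counted on each interval (-n, n). *)
Lemma countable_discontinuity_homo (f : R -> R) : {homo f : x y / x <= y} ->
  countable [set x | ~ {for x, continuous f}].
Proof.
move=> ndf.
apply: (@sub_countable _ _ _ (\bigcup_n
  [set x | x \in (`](- n%:R : R), n%:R[) /\ discontinuity f x])); last first.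
  apply: bigcup_countable => // n _; apply: discontinuity_countable.
  by move=> x y _ _; exact: ndf.
apply: subset_card_le => x /= ncx.
have [n xn] : exists n : nat, `|x| < n%:R.
  by exists (Num.truncn `|x|).+1; rewrite truncnS_gt.
exists n => //; split; first by rewrite in_itv/= -ltr_norml.
have cl : cvg (f x @[x --> x^'-]).
  apply: nondecreasing_at_left_is_cvgr.
    by near=> y => a b _ _; exact: ndf.
  near=> y; exists (f x) => _ [z /= + <-]; rewrite in_itv/= => /andP[_ zx].
  exact/ndf/ltW.
have cr : cvg (f x @[x --> x^'+]).
  apply: nondecreasing_at_right_is_cvgr.
    by near=> y => a b _ _; exact: ndf.
  near=> y; exists (f x) => _ [z /= + <-]; rewrite in_itv/= => /andP[xz _].
  exact/ndf/ltW.
split => //; apply/eqP => lr; apply: ncx.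
have l1 : lim (f x @[x --> x^'-]) <= f x.
  apply: limr_le => //; near=> y; apply/ndf/ltW; near: y; exact: nbhs_left_lt.
have l2 : f x <= lim (f x @[x --> x^'+]).
  apply: limr_ge => //; near=> y; apply/ndf/ltW; near: y; exact: nbhs_right_gt.
apply/left_right_continuousP; split.
- by rewrite (_ : f x = lim (f x @[x --> x^'-]))//; apply/eqP; rewrite eq_le l1 lr l2.
- by rewrite (_ : f x = lim (f x @[x --> x^'+]))//; apply/eqP; rewrite eq_le -lr l1 lr l2.
Unshelve. all: by end_near. Qed.

End monotone.

Section classF1_theory.
Context {R : realType}.
Variables (f1 df1 : R -> R).
Hypothesis hf : classF1 f1 df1.
Local Notation leb := (@lebesgue_measure R).
Local Notation ph := (phi f1 df1).

Lemma f1_ge0 z : 0 <= f1 z.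
Proof. by have [[_ ? _] _ _] := F1_F0 hf. Qed.

Lemma f1_even z : f1 (- z) = f1 z.
Proof. by have [_ ? _] := F1_F0 hf. Qed.

Lemma measurable_f1 : measurable_fun [set: R] f1.
Proof. by have [[? _ _] _ _] := F1_F0 hf. Qed.

Lemma integral_f1 : (\int[leb]_z (f1 z)%:E = 1)%E.
Proof. by have [[_ _ ?] _ _] := F1_F0 hf. Qed.

(** Since f1 is only a primitive of [df1], this bound and the next take the place of the mean value
    theorem. *)
Lemma f1_incr_le (u w M : R) : u <= w -> (forall t, u <= t <= w -> df1 t <= M) ->
  f1 w - f1 u <= M * (w - u).
Proof.
rewrite le_eqVlt => /predU1P[->|uw] dM; first by rewrite !subrr mulr0.
rewrite (F1_primitive hf uw).
have -> : M * (w - u) = \int[leb]_(t in `[u, w]) M.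
  rewrite Rintegral_cst//; congr (_ * _).
  by rewrite /= lebesgue_measure_itv/= lte_fin uw -EFinD.
apply: le_Rintegral => //.
- exact: (F1_integrable hf uw).
- apply: measurable_bounded_integrable => //.
    by rewrite /= lebesgue_measure_itv/= lte_fin uw -EFinD ltry.
  by exists `|M|; split; rewrite ?num_real// => x Mx y _ /=; exact: ltW.
Qed.

Lemma f1_incr_ge (u w m : R) : u <= w -> (forall t, u <= t <= w -> m <= df1 t) ->
  m * (w - u) <= f1 w - f1 u.
Proof.
rewrite le_eqVlt => /predU1P[->|uw] dM; first by rewrite !subrr mulr0.
rewrite (F1_primitive hf uw).
have -> : m * (w - u) = \int[leb]_(t in `[u, w]) m.
  rewrite Rintegral_cst//; congr (_ * _).
  by rewrite /= lebesgue_measure_itv/= lte_fin uw -EFinD.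
apply: le_Rintegral => //.
- apply: measurable_bounded_integrable => //.
    by rewrite /= lebesgue_measure_itv/= lte_fin uw -EFinD ltry.
  by exists `|m|; split; rewrite ?num_real// => x Mx y _ /=; exact: ltW.
- exact: (F1_integrable hf uw).
Qed.

Lemma continuous_f1 : continuous f1.
Proof.
move=> x; have ab : x - 1 < x + 1 by lra.
have cF := @parameterized_integral_continuous R (x - 1) (x + 1) df1 (ltW ab)
  (F1_integrable hf ab).
have : {within `[x - 1, x + 1], continuous f1}.
  apply: (@subspace_eq_continuous _ _ _
      (fun y => f1 (x - 1) + parameterized_integral leb (x - 1) y df1)).
    move=> y; rewrite inE/= in_itv/= le_eqVlt => /andP[/predU1P[<- _|xy _]].
      by rewrite /parameterized_integral set_itv1 Rintegral_set1 addr0.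
    by rewrite /from_subspace/= /parameterized_integral -(F1_primitive hf xy); ring.
  by move=> y; apply: cvgD; [exact: cvg_cst|exact: cF].
move/(continuous_within_itvP _ ab) => [h _ _]; apply: h.
by rewrite in_itv/=; lra.
Qed.

(** If f1 z1 > 0, let [a] be the supremum of the zeros in [z0, z1]. As phi z0 = 0 by the convention
    on division, phi >= 0 beyond z0 and f1 is nonincreasing on (a, z1], so f1 a >= f1 z1 > 0 by
    continuity. Yet zeros come arbitrarily close to [a]. *)
Let f1_zero_right (z0 z1 : R) : f1 z0 = 0 -> z0 < z1 -> f1 z1 = 0.
Proof.
move=> f0 z01; apply/eqP; rewrite eq_le f1_ge0 andbT leNgt; apply/negP => f1z1.
pose A := [set z | z0 <= z <= z1 /\ f1 z = 0].
have A0 : A z0 by split => //; rewrite lexx ltW.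
have ubA : ubound A z1 by move=> z [/andP[]].
have hsA : has_sup A by split; [exists z0|exists z1].
pose a := sup A.
have az1 : a <= z1 by apply: ge_sup => //; exists z0.
have z0a : z0 <= a by apply: ub_le_sup => //; exists z1.
have pos y : a < y -> y <= z1 -> 0 < f1 y.
  move=> ay yz1; rewrite lt0r f1_ge0 andbT; apply/eqP => fy.
  have : y <= a by apply: ub_le_sup; [exists z1|split => //; rewrite yz1 andbT; lra].
  lra.
have phz0 : ph z0 = 0 by rewrite /phi f0 invr0 mulr0.
have mon y : a < y -> y <= z1 -> f1 z1 <= f1 y.
  move=> ay yz1; have := @f1_incr_le y z1 0 yz1; rewrite mul0r subr_le0; apply.
  move=> t /andP[yt tz1]; have ft : 0 < f1 t by apply: pos => //; lra.
  have := F1_monotone hf (_ : z0 <= t); rewrite phz0 => /(_ _)/wrap[|]; first lra.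
  by rewrite /phi pmulr_lge0 ?invr_gt0// oppr_ge0.
have fa_ge : f1 z1 <= f1 a.
  move: az1; rewrite le_eqVlt => /predU1P[->//|az1].
  have ca : f1 y @[y --> a^'+] --> f1 a.
    by apply: cvg_at_right_filter; exact: continuous_f1.
  rewrite -(cvg_lim _ ca)//; apply: limr_ge; first by apply/cvg_ex; exists (f1 a).
  near=> y; apply: mon; near: y; first exact: nbhs_right_gt.
  exact: nbhs_right_le.
have fa0 : 0 < f1 a by exact: lt_le_trans f1z1 fa_ge.
have [/= d d0 Hd] : \forall y \near a, `|f1 a - f1 y| < f1 a.
  exact: (@cvgr_dist_lt _ R^o _ _ _ _ _ (@continuous_f1 a)).
have [y [/andP[z0y yz1] fy] ay] := sup_adherent d0 hsA.
have ya : y <= a by apply: ub_le_sup => //; [exists z1|split => //; rewrite z0y].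
have ya' : `|a - y| < d by rewrite ger0_norm ?subr_ge0//; rewrite -/a in ay; lra.
by have := Hd y ya'; rewrite fy subr0 (gtr0_norm fa0) ltxx.
Unshelve. all: by end_near. Qed.

(** A zero spreads to its right, and by evenness to its left, against the total mass 1. *)
Lemma f1_gt0 z : 0 < f1 z.
Proof.
rewrite lt0r f1_ge0 andbT; apply/eqP => fz.
have f0 y : f1 y = 0.
  have [yz|zy|->//] := ltgtP y z; last exact: f1_zero_right fz zy.
  rewrite -f1_even; apply: (@f1_zero_right (- z)); rewrite ?f1_even//; lra.
have := integral_f1.
rewrite (eq_integral (cst 0%E)) ?integral0; last by move=> y _; rewrite f0.
by move/eqP; rewrite eq_sym onee_eq0.
Qed.

Lemma df1E z : df1 z = - ph z * f1 z.
Proof. by rewrite /phi !mulNr opprK divfK// gt_eqF// f1_gt0. Qed.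

Lemma measurable_phi : measurable_fun [set: R] ph.
Proof. by apply: nondecreasing_measurable => // x y; exact: F1_monotone. Qed.

Lemma measurable_df1 : measurable_fun [set: R] df1.
Proof.
rewrite (_ : df1 = fun z => - ph z * f1 z); last by apply/funext => z; exact: df1E.
by apply: measurable_funM; [apply: measurableT_comp => //; exact: measurable_phi|exact: measurable_f1].
Qed.

Lemma continuous_df1 z : {for z, continuous ph} -> {for z, continuous df1}.
Proof.
move=> cz; rewrite (_ : df1 = fun z => - ph z * f1 z); last by apply/funext => y; exact: df1E.
by apply: cvgM; [apply: cvgN; exact: cz|exact: continuous_f1].
Qed.

(** Both endpoints are free because the linearization compares f1 at b z + a and at b z, which both
    move with n. *)
Lemma f1_strict_derivative z e : {for z, continuous ph} -> 0 < e ->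
  exists2 del, 0 < del & forall u w, `|u - z| < del -> `|w - z| < del ->
    `|f1 w - f1 u - (w - u) * df1 z| <= e * `|w - u|.
Proof.
move=> cz e0.
have [/= d d0 Hd] : \forall y \near z, `|df1 z - df1 y| < e.
  exact: (@cvgr_dist_lt _ R^o _ _ _ _ _ (continuous_df1 cz)).
exists d => //.
have main u w : `|u - z| < d -> `|w - z| < d -> u <= w ->
    `|f1 w - f1 u - (w - u) * df1 z| <= e * `|w - u|.
  move=> uz wz uw; rewrite (@ger0_norm _ (w - u)) ?subr_ge0//.
  have bd t : u <= t <= w -> df1 z - e <= df1 t <= df1 z + e.
    move=> /andP[ut tw]; have : `|df1 z - df1 t| < e.
      apply: Hd => /=; move: uz wz; rewrite !ltr_norml => /andP[? ?] /andP[? ?].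
      by apply/andP; split; lra.
    by rewrite ltr_norml => /andP[? ?]; apply/andP; split; lra.
  have h1 := @f1_incr_le u w (df1 z + e) uw (fun t ht => proj2 (andP (bd t ht))).
  have h2 := @f1_incr_ge u w (df1 z - e) uw (fun t ht => proj1 (andP (bd t ht))).
  by rewrite ler_norml; apply/andP; split; lra.
move=> u w uz wz; have [uw|/ltW wu] := leP u w; first exact: main.
have := main w u wz uz wu; rewrite (distrC u w).
rewrite -[X in X <= _]normrN.
by rewrite (_ : - (f1 u - f1 w - (u - w) * df1 z) = f1 w - f1 u - (w - u) * df1 z)//; ring.
Qed.

(* [df1] is only a version of the derivative, so phi is odd only off the
   countable set of its jumps and their opposites. *)
Definition good z := {for z, continuous ph} /\ {for - z, continuous ph}.

Lemma good_odd z : good z -> ph (- z) = - ph z.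
Proof.
move=> [c1 c2].
suff : df1 (- z) = - df1 z.
  by move=> h; rewrite /phi h f1_even !mulNr.
apply/eqP; rewrite -subr_eq0 opprK -normr_eq0 eq_le normr_ge0 andbT; apply/ler_addgt0Pr => e e0; rewrite add0r.
have e2 : 0 < e / 2 by rewrite divr_gt0.
have [d1 d10 H1] := f1_strict_derivative c1 e2.
have [d2 d20 H2] := f1_strict_derivative c2 e2.
pose h := Num.min d1 d2 / 2.
have h0 : 0 < h by rewrite divr_gt0// lt_min d10.
have md1 : Num.min d1 d2 <= d1 by rewrite ge_min lexx.
have md2 : Num.min d1 d2 <= d2 by rewrite ge_min lexx orbT.
have hd1 : h < d1 by rewrite /h; lra.
have hd2 : h < d2 by rewrite /h; lra.
have := H1 z (z + h); rewrite subrr normr0 addrAC subrr add0r (gtr0_norm h0).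
move=> /(_ d10 hd1) k1.
have := H2 (- z) (- z - h); rewrite subrr normr0 addrAC subrr add0r normrN (gtr0_norm h0).
move=> /(_ d20 hd2) k2.
(* By evenness the increments of f1 from z to z + h and from - z to - z - h coincide, so only the
   two linearization errors remain. *)
have -> : df1 (- z) + df1 z = h^-1 *
   ((f1 (- z - h) - f1 (- z) - - h * df1 (- z)) - (f1 (z + h) - f1 z - h * df1 z)).
  rewrite (_ : - z - h = - (z + h)); last by ring.
  by rewrite !f1_even; field; rewrite gt_eqF.
rewrite normrM gtr0_norm ?invr_gt0// ler_pdivrMl//.
by apply: (le_trans (ler_normB _ _)); lra.
Qed.

Lemma countable_not_good : countable [set z | ~ good z].
Proof.
have c1 := countable_discontinuity_homo (F1_monotone hf).
apply: (@sub_countable _ _ _ (\bigcup_(b in [set: bool])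
  (if b then [set x | ~ {for x, continuous ph}]
   else -%R @` [set x | ~ {for x, continuous ph}]))); last first.
  apply: bigcup_countable => // -[_|_] //.
  exact: sub_countable (card_image_le _ _) c1.
apply: subset_card_le => z /= /not_andP[h|h]; first by exists true.
by exists false => //; exists (- z); rewrite ?opprK.
Qed.

Lemma good_ae : {ae leb, forall z, good z}.
Proof.
have c := countable_not_good.
exists [set z | ~ good z]; split => //.
  exact: countable_measurable.
exact: countable_lebesgue_measure0.
Qed.

Lemma good_dense (a b : R) : a < b -> exists z, a < z < b /\ good z.
Proof.
move=> ab; apply: contrapT => /forallNP h.
have : (leb `]a, b[ <= 0)%E.
  rewrite -(countable_lebesgue_measure0 countable_not_good).
  apply: le_measure; rewrite ?inE//.
    exact: countable_measurable countable_not_good.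
  by move=> z /=; rewrite in_itv/= => zab gz; apply: (h z).
by rewrite /= lebesgue_measure_itv/= lte_fin ab -EFinD lee_fin; lra.
Qed.

End classF1_theory.

(** * Decay of f1 and growth of phi *)

Section classF1_growth.
Context {R : realType}.
Variables (f1 df1 : R -> R).
Hypothesis hf : classF1 f1 df1.
Local Notation leb := (@lebesgue_measure R).
Local Notation ph := (phi f1 df1).

(** Oddness holds at good points only; one of them between 0 and z has phi >= 0, and monotonicity
    carries the sign to z. *)
Lemma phi_ge0 z : 0 < z -> 0 <= ph z.
Proof.
move=> z0; have [w [/andP[w0 wz] gw]] := good_dense hf z0.
have : ph (- w) <= ph w by apply: (F1_monotone hf); lra.
rewrite (good_odd hf gw) => h.
have : ph w <= ph z by apply: (F1_monotone hf); exact: ltW.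
lra.
Qed.

Lemma f1_nonincreasing u w : 0 < u -> u <= w -> f1 w <= f1 u.
Proof.
move=> u0 uw; have := @f1_incr_le _ _ _ hf u w 0 uw.
rewrite mul0r subr_le0; apply => t /andP[ut _].
rewrite (df1E hf) mulNr oppr_le0 mulr_ge0 ?(f1_ge0 hf)// phi_ge0//; lra.
Qed.

Lemma f1_le_f10 z : f1 z <= f1 0.
Proof.
wlog z0 : z / 0 < z.
  move=> h; have [z0|z0|->//] := ltgtP z 0; last exact: h.
  by rewrite -(f1_even hf); apply: h; lra.
rewrite leNgt; apply/negP => h.
have h0 : 0 < f1 z - f1 0 by rewrite subr_gt0.
have [/= d d0 Hd] : \forall y \near (0 : R), `|f1 0 - f1 y| < f1 z - f1 0.
  exact: (@cvgr_dist_lt _ R^o _ _ _ _ _ (@continuous_f1 _ _ _ hf 0)).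
pose y := Num.min (d / 2) z.
have yz : y <= z by rewrite ge_min lexx orbT.
have yd : y <= d / 2 by rewrite ge_min lexx.
have y0 : 0 < y by rewrite lt_min z0 divr_gt0.
have yd' : `|0 - y| < d by rewrite sub0r normrN gtr0_norm//; lra.
have := Hd y yd'; have := f1_nonincreasing y0 yz; rewrite ltr_norml => ? /andP[? ?].
lra.
Qed.

(** Otherwise phi <= 0 on [1, +oo[, f1 is at least f1 1 > 0 there, and its mass on a long interval
    exceeds 1. *)
Lemma phi_pos_tail : exists z0 c : R, [/\ 1 <= z0, 0 < c &
  forall z, z0 <= z -> c <= ph z].
Proof.
have [[z0 z01 pz0]|h] := pselect (exists2 z, 1 <= z & 0 < ph z).
  by exists z0, (ph z0); split => // z; exact: (F1_monotone hf).
have ph0 z : 1 <= z -> ph z <= 0.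
  by move=> z1; rewrite leNgt; apply/negP => pz; apply: h; exists z.
have f1_cst z : 1 <= z -> f1 1 <= f1 z.
  move=> z1; have := @f1_incr_ge _ _ _ hf 1 z 0 z1; rewrite mul0r subr_ge0; apply.
  by move=> t /andP[t1 _]; rewrite (df1E hf) mulr_ge0 ?(f1_ge0 hf)// oppr_ge0 ph0.
have f10 := f1_gt0 hf 1.
pose n := (Num.truncn (f1 1)^-1).+1.
have n1 : 1 < f1 1 * n%:R by rewrite mulrC -ltr_pdivrMr// div1r truncnS_gt.
have : ((f1 1 * n%:R)%:E <= 1)%E.
  rewrite -[X in (_ <= X)%E](integral_f1 hf).
  apply: (@le_trans _ _ (\int[leb]_(z in `[1%R, (1 + n%:R)%R]) (f1 1)%:E)%E).
    rewrite integral_cst//= lebesgue_measure_itv/= lte_fin ltrDl ltr0n -EFinD.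
    by rewrite -EFinM lee_fin addrAC subrr add0r.
  apply: (@le_trans _ _ (\int[leb]_(z in `[1%R, (1 + n%:R)%R]) (f1 z)%:E)%E).
    apply: ge0_le_integral => //.
    - by move=> z _; rewrite lee_fin ltW.
    - by apply/measurable_EFinP; apply: measurable_funTS; exact: measurable_f1 hf.
    - by move=> z /=; rewrite in_itv/= => /andP[? _]; rewrite lee_fin f1_cst.
  apply: ge0_subset_integral => //.
    by apply/measurable_EFinP; exact: measurable_f1 hf.
  by move=> z _; rewrite lee_fin (f1_ge0 hf).
by rewrite lee_fin leNgt n1.
Qed.

(** On [z, 2 z] the derivative is at most - c f1 (2 z), whence c z f1 (2 z) <= f1 z. Each use of
    this doubling inequality gains one power of z, so induction on k reaches them all. *)
Lemma f1_decay k : exists C, forall z, (2 + `|z|) ^+ k * f1 z <= C.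
Proof.
have [z0 [c [z01 c0 hc]]] := phi_pos_tail.
have z00 : 0 < z0 by lra.
have dbl z : z0 <= z -> f1 (2 * z) * (c * z) <= f1 z.
  move=> zz; have zpos : 0 < z by lra.
  have := @f1_incr_le _ _ _ hf z (2 * z) (- c * f1 (2 * z)).
  have z2 : z <= 2 * z by lra.
  move=> /(_ z2 _)/wrap[|].
    move=> t /andP[zt t2]; rewrite (df1E hf) !mulNr lerN2 ler_pM//.
    - exact: ltW.
    - exact: f1_ge0 hf _.
    - by apply: hc; lra.
    - by apply: f1_nonincreasing => //; lra.
  have := f1_ge0 hf (2 * z); lra.
have tail : exists2 C, 0 <= C & forall z, z0 <= z -> z ^+ k * f1 z <= C.
  elim: k => [|k [C C0 IH]].
    by exists (f1 0); [exact: f1_ge0 hf _|move=> z _; rewrite expr0 mul1r f1_le_f10].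
  exists ((2 * z0) ^+ k.+1 * f1 0 + 2 ^+ k.+1 * C / c).
    by rewrite addr_ge0 ?mulr_ge0 ?exprn_ge0 ?invr_ge0 ?mulr_ge0 ?(f1_ge0 hf) ?(ltW c0) ?(ltW z00).
  move=> z zz; have [z2|z2] := leP z (2 * z0).
    apply: (@le_trans _ _ ((2 * z0) ^+ k.+1 * f1 0)).
      rewrite ler_pM ?exprn_ge0 ?(f1_ge0 hf) ?f1_le_f10//; try lra.
      by rewrite lerXn2r ?nnegrE; lra.
    by rewrite lerDl !mulr_ge0 ?invr_ge0 ?exprn_ge0// ltW.
  pose y := z / 2; have zE : z = 2 * y by rewrite /y; field.
  have y0 : 0 < y by rewrite /y; lra.
  have yz : z0 <= y by rewrite /y; lra.
  apply: (@le_trans _ _ (2 ^+ k.+1 * C / c)); last first.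
    by rewrite lerDr mulr_ge0 ?exprn_ge0 ?(f1_ge0 hf)//; lra.
  rewrite ler_pdivlMr// zE exprMn.
  have -> : 2 ^+ k.+1 * y ^+ k.+1 * f1 (2 * y) * c =
    2 ^+ k.+1 * (y ^+ k * (f1 (2 * y) * (c * y))) by rewrite exprSr (exprSr y); ring.
  rewrite ler_wpM2l ?exprn_ge0//; apply: le_trans (IH _ yz).
  by rewrite ler_wpM2l ?dbl// exprn_ge0// ltW.
have [C C0 HC] := tail.
exists ((2 + z0) ^+ k * f1 0 + 3 ^+ k * C) => z.
have z0k : 0 <= (2 + z0) ^+ k * f1 0 by rewrite mulr_ge0 ?exprn_ge0 ?(f1_ge0 hf)//; lra.
have Ck : 0 <= 3 ^+ k * C by rewrite mulr_ge0// exprn_ge0.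
have a0 := normr_ge0 z.
have [h|h] := leP z0 `|z|.
  have -> : f1 z = f1 `|z| by case: (ger0P z) => // _; rewrite (f1_even hf).
  apply: (@le_trans _ _ (3 ^+ k * (`|z| ^+ k * f1 `|z|))).
    rewrite mulrA -exprMn ler_wpM2r ?(f1_ge0 hf)// lerXn2r ?nnegrE; lra.
  have : 3 ^+ k * (`|z| ^+ k * f1 `|z|) <= 3 ^+ k * C.
    by rewrite ler_wpM2l ?exprn_ge0// HC.
  lra.
have : (2 + `|z|) ^+ k * f1 z <= (2 + z0) ^+ k * f1 0.
  rewrite ler_pM ?exprn_ge0 ?(f1_ge0 hf) ?f1_le_f10//; try lra.
  by rewrite lerXn2r ?nnegrE; lra.
lra.
Qed.

(** Condition (v) gives a power bound beyond some point, and monotonicity a constant before it. Any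
    other z is framed by a good w in ]|z|, |z| + 1[, as - phi w = phi (- w) <= phi z <= phi w; the
    factor 3^N pays for w instead of |z|. *)
Lemma phi_growth : exists K N, 0 <= K /\ forall z, `|ph z| <= K * (2 + `|z|) ^+ N.
Proof.
have [beta b0 [_ phio]] := F1_tails hf.
have [A [_ HA]] : \forall z \near +oo, `|ph z| <= `|z `^ (beta / 2 - 2)|.
  have /eqoP/(_ _ ltr01) := phio.
  by apply: filterS => z; rewrite mul1r.
pose N := (Num.truncn (beta / 2)).+1.
pose B := Num.max A 1 + 1.
have B2 : 2 <= B by rewrite /B; have : 1 <= Num.max A 1; [rewrite le_max lexx orbT|lra].
have AB : A < B by rewrite /B; have : A <= Num.max A 1; [rewrite le_max lexx|lra].
pose K := ph B + 1.
have pB : 0 <= ph B by apply: phi_ge0; lra.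
have pos z : 0 < z -> ph z <= K * (2 + z) ^+ N.
  move=> z0.
  have e1 : 1 <= (2 + z) ^+ N by rewrite exprn_ege1//; lra.
  have [zB|Bz] := leP z B.
    apply: (@le_trans _ _ K); last by rewrite ler_peMr// /K; lra.
    by rewrite /K; have := F1_monotone hf zB; lra.
  have zA : A < z by lra.
  have := HA z zA; rewrite ger0_norm ?phi_ge0// ger0_norm ?powR_ge0// => h.
  apply: (le_trans h).
  apply: (@le_trans _ _ (z `^ N%:R)).
    apply: ler_powR; first lra.
    have : beta / 2 < N%:R by rewrite truncnS_gt.
    lra.
  rewrite powR_mulrn; last exact: ltW.
  apply: (@le_trans _ _ ((2 + z) ^+ N)).
    by rewrite lerXn2r ?nnegrE; lra.
  by rewrite ler_peMl ?exprn_ge0//; rewrite /K; lra.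
have K0 : 0 <= K by rewrite /K; lra.
exists (K * 3 ^+ N), N; split; first by rewrite mulr_ge0 ?exprn_ge0.
have bd (z w : R) : `|z| < w -> w < `|z| + 1 -> ph w <= K * 3 ^+ N * (2 + `|z|) ^+ N.
  move=> zw wz; have a0 := normr_ge0 z.
  apply: (le_trans (pos w _)); first lra.
  rewrite -mulrA ler_wpM2l// -exprMn lerXn2r ?nnegrE; lra.
move=> z; have a0 := normr_ge0 z.
have [w [/andP[zw wz] gw]] : exists w, `|z| < w < `|z| + 1 /\ good f1 df1 w.
  by apply: (good_dense hf); lra.
have h1 : ph z <= ph w by apply: (F1_monotone hf); have := ler_norm z; lra.
have h2 : - ph w <= ph z.
  rewrite -(good_odd hf gw); apply: (F1_monotone hf).
  by have := ler_norm (- z); rewrite normrN; lra.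
rewrite ler_norml; have := bd z w zw wz.
by move=> h; apply/andP; split; lra.
Qed.

End classF1_growth.

Lemma aeS d (T : measurableType d) (R : realType)
    (mu : {measure set T -> \bar R}) (A B : T -> Prop) :
  (forall x, A x -> B x) -> {ae mu, forall x, A x} -> {ae mu, forall x, B x}.
Proof. exact: (@filterS _ _ (ae_filter_ringOfSetsType mu)). Qed.

(** * Lebesgue integrals: affine maps, parity, domination *)

Section lebesgue_affine.
Context {R : realType}.
Local Notation leb := (@lebesgue_measure R).

(** The rescaled image measure agrees with Lebesgue measure on half-open intervals, which determine
    it. *)
Lemma ge0_integral_lebesgue_affine (a b : R) : 0 < b ->
  forall h : R -> R, measurable_fun [set: R] h -> (forall x, 0 <= h x) ->
  (\int[leb]_x (h x)%:E = \int[leb]_x (h ((x - a) / b) * b^-1)%:E)%E.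
Proof.
move=> b0 h mh h0; have bV0 : 0 <= b^-1 by rewrite invr_ge0 ltW.
pose t (x : measurableTypeR R) : measurableTypeR R := (x - a) / b.
have mt : measurable_fun [set: measurableTypeR R] t.
  by apply: measurable_funM => //; exact: measurable_funB.
have lebE (A : set (measurableTypeR R)) : measurable A ->
    leb A = mscale (NngNum bV0) (pushforward leb t) A.
  move=> mA.
  apply: (@lebesgue_measure_unique R (mscale (NngNum bV0) (pushforward leb t))) => //.
  move=> _ [[u v]] _ <-.
  have tE : t @^-1` `]u, v]%classic = `]b * u + a, b * v + a]%classic.
    apply/seteqP; split => x /=; rewrite /t !in_itv/=;
      by rewrite ltr_pdivlMr// ler_pdivrMr// ltrBrDr lerBlDr [u * b]mulrC [v * b]mulrC.
  transitivity ((b^-1)%:E * leb `](b * u + a)%R, (b * v + a)%R])%E; last by rewrite -tE.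
  rewrite /= !lebesgue_measure_itv/= !lte_fin ltrD2r ltr_pM2l//.
  case: ifP => _; last by rewrite mule0.
  by rewrite -!EFinD -EFinM; congr EFin; field; rewrite gt_eqF.
have mhE : measurable_fun [set: R] (EFin \o h) by exact/measurable_EFinP.
rewrite (eq_measure_integral (mscale (NngNum bV0) (pushforward leb t))); last first.
  by move=> A mA _; exact: lebE.
rewrite ge0_integral_mscale//; last by move=> x _; rewrite lee_fin.
rewrite ge0_integral_pushforward//; last by move=> x _; rewrite lee_fin.
rewrite preimage_setT -ge0_integralZl//.
- by apply: eq_integral => x _; rewrite /= -EFinM mulrC.
- by apply/measurable_EFinP; exact: measurableT_comp.
- by move=> x _; rewrite lee_fin.
Qed.

Lemma ge0_integral_lebesgue_opp : forall h : R -> R,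
  measurable_fun [set: R] h -> (forall x, 0 <= h x) ->
  (\int[leb]_x (h x)%:E = \int[leb]_x (h (- x) * 1)%:E)%E.
Proof.
move=> h mh h0.
have mhE : measurable_fun [set: R] (EFin \o h) by exact/measurable_EFinP.
have mN : measurable_fun [set: measurableTypeR R] (-%R : measurableTypeR R -> measurableTypeR R).
  exact: measurable_funN.
rewrite (eq_measure_integral (pushforward leb (-%R : _ -> measurableTypeR R))); last first.
  by move=> A mA _; rewrite [RHS]lebesgue_measureN.
rewrite ge0_integral_pushforward//; last by move=> x _; rewrite lee_fin.
by rewrite preimage_setT; apply: eq_integral => x _; rewrite /= mulr1.
Qed.

Lemma measurable_affine (a b : R) : measurable_fun [set: R] (fun x : R => (x - a) / b).
Proof. by apply: measurable_funM => //; exact: measurable_funB. Qed.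

Lemma Rint_affine (a b : R) (f : R -> R) : 0 < b -> measurable_fun [set: R] f ->
  intg leb (fun x => f ((x - a) / b) * b^-1) ->
  \int[leb]_x f x = \int[leb]_x (f ((x - a) / b) * b^-1).
Proof.
move=> b0 mf If; have bV0 (x : R) : 0 <= b^-1 by rewrite invr_ge0 ltW.
exact: (@Rint_transfer _ _ _ _ R leb leb (fun x => (x - a) / b) (fun=> b^-1)
  (measurable_affine a b) (measurable_cst _) bV0
  (ge0_integral_lebesgue_affine a b0) f mf If).
Qed.

Lemma Rint_opp (f : R -> R) : measurable_fun [set: R] f -> intg leb f ->
  \int[leb]_x f x = \int[leb]_x f (- x).
Proof.
move=> mf If.
have mN : measurable_fun [set: R] (-%R : R -> R) by exact: measurable_funN.
have mfN : measurable_fun [set: R] (fun x => f (- x)) by exact: measurableT_comp.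
have tr := ge0_integral_lebesgue_opp.
have If' : intg leb (fun x => f (- x)).
  apply: (@intg_transfer _ _ _ _ R leb leb -%R (fun=> 1) (fun _ => ler01) tr) => //.
  by move: If; congr intg; apply/funext => x; rewrite opprK mulr1.
rewrite (@Rint_transfer _ _ _ _ R leb leb -%R (fun=> 1) mN (measurable_cst _) (fun _ => ler01) tr f mf).
  by apply: eq_Rintegral => x _; rewrite mulr1.
by move: If'; congr intg; apply/funext => x; rewrite mulr1.
Qed.

(** Oddness is asked almost everywhere, as phi is odd at good points only. *)
Lemma Rint_odd (f : R -> R) : measurable_fun [set: R] f -> intg leb f ->
  {ae leb, forall x, f (- x) = - f x} -> \int[leb]_x f x = 0.
Proof.
move=> mf If odd.
have mN : measurable_fun [set: R] (fun x => f (- x)).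
  by apply: measurableT_comp => //; exact: measurable_funN.
have : \int[leb]_x f x = - \int[leb]_x f x.
  rewrite {1}Rint_opp// -mulN1r -RintZ//; congr fine; apply: ae_eq_integral => //.
  - exact/measurable_EFinP.
  - by apply/measurable_EFinP; exact: measurable_funM.
  - by apply: aeS odd => x -> _; rewrite mulN1r.
lra.
Qed.

Lemma intg_inv_oneDsqr : intg leb (fun x : R => (1 + x ^+ 2)^-1).
Proof.
have cts : continuous (fun x : R => (1 + x ^+ 2)^-1).
  exact: continuous_oneDsqrV.
have ge0 x : 0 <= (1 + x ^+ 2)^-1 :> R by rewrite invr_ge0 addr_ge0// sqr_ge0.
apply: intg_ge0 => //; first exact: continuous_measurable_fun.
rewrite ge0_symfun_integralT//; last by move=> x /=; rewrite sqrrN.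
rewrite (_ : [set x | 0 <= x] = `[0, +oo[%classic); last first.
  by apply/seteqP; split => x /=; rewrite in_itv/= andbT.
by rewrite integral0y_oneDsqr -EFinM ltry.
Qed.

Lemma intg_quadratic_decay (C : R) (h : R -> R) : measurable_fun [set: R] h ->
  (forall z, (2 + `|z|) ^+ 2 * `|h z| <= C) -> intg leb h.
Proof.
move=> mh hC; apply: (intg_le _ _ (intgZ C intg_inv_oneDsqr)) => // z.
have q0 : 0 < 1 + z ^+ 2 by rewrite ltr_pwDl// sqr_ge0.
rewrite ler_pdivlMr//; apply: le_trans (hC z).
rewrite mulrC ler_wpM2r//.
have -> : z ^+ 2 = `|z| ^+ 2 by rewrite real_normK ?num_real.
have := normr_ge0 z; nra.
Qed.

End lebesgue_affine.

Section dct.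
Context d (T : measurableType d) {R : realType}.
Variable mu : {measure set T -> \bar R}.

Lemma dominated_Rint_cvg0 (f : nat -> T -> R) (g : T -> R) : intg mu g ->
  (\forall n \near \oo, measurable_fun [set: T] (f n) /\ forall x, `|f n x| <= g x) ->
  {ae mu, forall x, f n x @[n --> \oo] --> (0 : R)} ->
  \int[mu]_x f n x @[n --> \oo] --> (0 : R).
Proof.
move=> Ig [N _ HN] f0.
rewrite -(cvg_shiftn N).
pose F n x := (f (n + N)%N x)%:E.
have mF n : measurable_fun [set: T] (F n).
  by apply/measurable_EFinP; have [] := HN (n + N)%N (leq_addl _ _).
have F0 : {ae mu, forall x, [set: T] x -> F ^~ x @ \oo --> (cst 0%E : T -> \bar R) x}.
  apply: aeS f0 => x fx _; apply: cvg_EFin; first exact: nearW.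
  by have := fx; rewrite -(cvg_shiftn N).
have FG : {ae mu, forall x n, [set: T] x -> (`|F n x| <= (EFin \o g) x)%E}.
  apply: aeW => x n _; rewrite /F /= lee_fin.
  by have [_] := HN (n + N)%N (leq_addl _ _).
have [_ _] := dominated_convergence measurableT mF (measurable_cst _) F0 Ig FG.
rewrite integral0; exact: fine_cvg.
Qed.

End dct.

Section poly_bounded.
Context {R : realType}.
Implicit Types g h : R -> R.

(** A base of at least 1 lets exponents be raised freely, and 2 + |z| is at most multiplied by a
    constant under the affine maps that occur. Closure under sums and products reduces integrability
    against f1 to [f1_decay]. *)
Definition poly_bounded g :=
  exists K N, 0 <= K /\ forall z, `|g z| <= K * (2 + `|z|) ^+ N.

Let base_ge1 (z : R) : 1 <= 2 + `|z|.
Proof. by have := normr_ge0 z; lra. Qed.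

Lemma poly_boundedM g h : poly_bounded g -> poly_bounded h ->
  poly_bounded (fun z => g z * h z).
Proof.
move=> [K [N [K0 HK]]] [L [M [L0 HL]]]; exists (K * L), (N + M)%N; split.
  exact: mulr_ge0.
by move=> z; rewrite normrM exprD mulrACA ler_pM.
Qed.

Lemma poly_boundedD g h : poly_bounded g -> poly_bounded h ->
  poly_bounded (fun z => g z + h z).
Proof.
move=> [K [N [K0 HK]]] [L [M [L0 HL]]]; exists (K + L), (N + M)%N; split.
  exact: addr_ge0.
move=> z; rewrite (le_trans (ler_normD _ _))// mulrDl lerD//.
  by rewrite (le_trans (HK z))// ler_wpM2l// ler_weXn2l ?base_ge1// leq_addr.
by rewrite (le_trans (HL z))// ler_wpM2l// ler_weXn2l ?base_ge1// leq_addl.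
Qed.

Lemma poly_bounded_cst c : poly_bounded (fun=> c).
Proof. by exists `|c|, 0%N; split => // z; rewrite expr0 mulr1. Qed.

Lemma poly_bounded_id : poly_bounded id.
Proof. by exists 1, 1%N; split => // z; rewrite mul1r expr1; have := normr_ge0 z; lra. Qed.

Lemma poly_boundedX g n : poly_bounded g -> poly_bounded (fun z => g z ^+ n).
Proof.
move=> pg; elim: n => [|n IH]; first exact: poly_bounded_cst.
by under eq_fun do rewrite exprS; exact: poly_boundedM.
Qed.

End poly_bounded.

(** * Moments of the score; bounds uniform over small affine changes *)

Section score.
Context {R : realType}.
Variables (f1 df1 : R -> R).
Hypothesis hf : classF1 f1 df1.
Local Notation leb := (@lebesgue_measure R).
Local Notation ph := (phi f1 df1).
Local Notation kap := (kappa f1 df1).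

(** The function psi of the overview. *)
Definition score z := ph z * (z ^+ 2 - kap).

Lemma measurable_score : measurable_fun [set: R] score.
Proof.
apply: measurable_funM; first exact: measurable_phi hf.
by apply: measurable_funB => //; exact: measurable_funX.
Qed.

Lemma poly_bounded_phi : poly_bounded ph.
Proof. exact: phi_growth hf. Qed.

Lemma poly_bounded_score : poly_bounded score.
Proof.
apply: poly_boundedM; first exact: poly_bounded_phi.
apply: poly_boundedD; last exact: poly_bounded_cst.
by apply: poly_boundedX; exact: poly_bounded_id.
Qed.

Lemma score_odd z : good f1 df1 z -> score (- z) = - score z.
Proof. by move=> gz; rewrite /score (good_odd hf gz) sqrrN mulNr. Qed.

Lemma continuous_score z : {for z, continuous ph} -> {for z, continuous score}.
Proof.
move=> cz; apply: cvgM; first exact: cz.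
by apply: cvgB; [exact: exprn_continuous|exact: cvg_cst].
Qed.

Lemma intg_poly_f1 g : measurable_fun [set: R] g -> poly_bounded g ->
  intg leb (fun z => g z * f1 z).
Proof.
move=> mg [K [N [K0 HK]]]; have [C HC] := f1_decay hf (N + 2).
apply: (@intg_quadratic_decay _ (K * C)).
  by apply: measurable_funM => //; exact: measurable_f1 hf.
move=> z; rewrite normrM (ger0_norm (f1_ge0 hf z)).
apply: (@le_trans _ _ (K * ((2 + `|z|) ^+ (N + 2) * f1 z))).
  rewrite exprD.
  have -> : K * ((2 + `|z|) ^+ N * (2 + `|z|) ^+ 2 * f1 z) =
    (2 + `|z|) ^+ 2 * (K * (2 + `|z|) ^+ N * f1 z) by ring.
  by rewrite ler_wpM2l ?sqr_ge0// ler_wpM2r ?(f1_ge0 hf).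
by rewrite ler_wpM2l.
Qed.

Let mX n : measurable_fun [set: R] (fun z : R => z ^+ n).
Proof. exact: measurable_funX. Qed.

Let mph2 : measurable_fun [set: R] (fun z => ph z ^+ 2).
Proof. by apply: measurable_funX; exact: measurable_phi hf. Qed.

Let pbph2 : poly_bounded (fun z => ph z ^+ 2).
Proof. exact: poly_boundedX poly_bounded_phi. Qed.

Let pbX n : poly_bounded (fun z : R => z ^+ n).
Proof. exact: poly_boundedX poly_bounded_id. Qed.

Let iI : intg leb (fun z => ph z ^+ 2 * f1 z).
Proof. exact: intg_poly_f1. Qed.

Let iJ : intg leb (fun z => z ^+ 2 * ph z ^+ 2 * f1 z).
Proof. by apply: intg_poly_f1; [exact: measurable_funM|exact: poly_boundedM]. Qed.

Let iK : intg leb (fun z => z ^+ 4 * ph z ^+ 2 * f1 z).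
Proof. by apply: intg_poly_f1; [exact: measurable_funM|exact: poly_boundedM]. Qed.

Lemma Rint_gt0 (h : R -> R) (a m : R) : intg leb h -> (forall z, 0 <= h z) ->
  0 < m -> (forall z, a <= z <= a + 1 -> m <= h z) -> 0 < \int[leb]_z h z.
Proof.
move=> Ih h0 m0 hm; apply: (lt_le_trans m0).
have mA : measurable `[a, a + 1]%classic by [].
have lA : (leb `[a, (a + 1)%R] = 1)%E.
  rewrite /= lebesgue_measure_itv/= lte_fin ltrDl ltr01 -EFinD.
  by congr EFin; ring.
have Ii : intg leb (\1_(`[a, a + 1]%classic) : R -> R).
  apply: intg_ge0 => //.
  by rewrite integral_indic// setIT; have := ltry (1 : R); rewrite -lA.
have -> : m = \int[leb]_z (m * \1_(`[a, a + 1]%classic) z).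
  rewrite RintZ// /Rintegral integral_indic// setIT.
  by have /(congr1 fine) := lA; rewrite /= => ->; rewrite mulr1.
apply: le_Rint => //; first exact: intgZ.
move=> z; rewrite indicE; case: (boolP (z \in _)) => [|_]; last by rewrite mulr0.
by rewrite inE/= in_itv/= mulr1 => /hm.
Qed.

Lemma calI_gt0 : 0 < calI f1 df1.
Proof.
have [z0 [c [z01 c0 hc]]] := phi_pos_tail hf.
apply: (@Rint_gt0 _ z0 (c ^+ 2 * f1 (z0 + 1))) => //.
- by move=> z; rewrite mulr_ge0 ?sqr_ge0 ?(f1_ge0 hf).
- by rewrite mulr_gt0 ?exprn_gt0 ?(f1_gt0 hf).
- move=> z /andP[z0z z1]; rewrite ler_pM ?sqr_ge0 ?(f1_ge0 hf)//.
    by rewrite lerXn2r ?nnegrE ?(ltW c0) ?hc// (le_trans (ltW c0))// hc.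
  by apply: (f1_nonincreasing hf) => //; lra.
Qed.

Lemma kappaE : kap * calI f1 df1 = calJ f1 df1.
Proof. by rewrite /kappa divfK// gt_eqF// calI_gt0. Qed.

(** Expanding the square gives K - 2 kappa J + kappa^2 I, and kappa = J / I. *)
Lemma gammaE : gamma f1 df1 = \int[leb]_z (score z ^+ 2 * f1 z).
Proof.
have -> : \int[leb]_z (score z ^+ 2 * f1 z) =
    \int[leb]_z (z ^+ 4 * ph z ^+ 2 * f1 z +
    (- 2 * kap) * (z ^+ 2 * ph z ^+ 2 * f1 z) + kap ^+ 2 * (ph z ^+ 2 * f1 z)).
  by apply: eq_Rintegral => z _; rewrite /score; ring.
rewrite RintD; [|by apply: intgD => //; exact: intgZ|exact: intgZ].
rewrite RintD//; last exact: intgZ.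
rewrite RintZ// RintZ// -/(calK _ _) -/(calJ _ _) -/(calI _ _).
have I0 := calI_gt0.
by rewrite /gamma /kappa; field; rewrite gt_eqF.
Qed.

(* The choice of kappa makes the score orthogonal to the location score. *)
Lemma Rint_score_df1 : \int[leb]_z (score z * df1 z) = 0.
Proof.
have -> : \int[leb]_z (score z * df1 z) =
    \int[leb]_z (kap * (ph z ^+ 2 * f1 z) - z ^+ 2 * ph z ^+ 2 * f1 z).
  by apply: eq_Rintegral => z _; rewrite /score (df1E hf); ring.
by rewrite RintB//; [rewrite RintZ// -/(calJ _ _) -/(calI _ _) kappaE subrr|exact: intgZ].
Qed.

Lemma intg_scoreX n : intg leb (fun z => score z ^+ n * f1 z).
Proof.
apply: intg_poly_f1; last exact: poly_boundedX poly_bounded_score.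
by apply: measurable_funX; exact: measurable_score.
Qed.

Lemma gamma_gt0 : 0 < gamma f1 df1.
Proof.
rewrite gammaE; have [z0 [c [z01 c0 hc]]] := phi_pos_tail hf.
(* On [a + 1, a + 2] both phi >= c and z^2 - kappa >= 1 hold, so the score is at least c there. *)
pose a := z0 + `|kap|; have ka := ler_norm kap; have k0 := normr_ge0 kap.
apply: (@Rint_gt0 _ (a + 1) (c ^+ 2 * f1 (a + 2))).
- exact: intg_scoreX.
- by move=> z; rewrite mulr_ge0 ?sqr_ge0 ?(f1_ge0 hf).
- by rewrite mulr_gt0 ?exprn_gt0 ?(f1_gt0 hf).
- move=> z /andP[z0z z1]; rewrite ler_pM ?sqr_ge0 ?(f1_ge0 hf)//; last first.
    by apply: (f1_nonincreasing hf); rewrite /a in z0z z1 *; lra.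
  have hz : c <= ph z by apply: hc; rewrite /a in z0z; lra.
  have zk : 1 <= z ^+ 2 - kap by rewrite /a in z0z; nra.
  have cs : c <= score z.
    by rewrite /score (le_trans hz)// ler_peMr//; lra.
  by rewrite lerXn2r ?nnegrE//; lra.
Qed.

(** Under these bounds 2 + |z| <= 2 (2 + |b z + a|), which accounts for the factor 2^k. Uniformity
    in a and b is what dominated convergence along sequences requires. *)
Lemma f1_affine_decay k : exists2 D, 0 <= D & forall (a b z : R), `|a| <= 1 -> 2^-1 <= b ->
  (2 + `|z|) ^+ k * f1 (b * z + a) <= D.
Proof.
have [C HC] := f1_decay hf k.
have C0 : 0 <= C by apply: le_trans (HC 0); rewrite mulr_ge0 ?exprn_ge0 ?(f1_ge0 hf)// normr0; lra.
exists (2 ^+ k * C); first by rewrite mulr_ge0 ?exprn_ge0.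
move=> a b z a1 b2.
apply: (@le_trans _ _ (2 ^+ k * ((2 + `|b * z + a|) ^+ k * f1 (b * z + a)))); last first.
  by rewrite ler_wpM2l ?exprn_ge0.
rewrite mulrA -exprMn ler_wpM2r ?(f1_ge0 hf)//.
have bz : 2^-1 * `|z| <= `|b * z|.
  by rewrite normrM ler_wpM2r// ger0_norm; lra.
have tri : `|b * z| <= `|b * z + a| + `|a|.
  by rewrite -{1}(addrK a (b * z)) ler_normB.
have zn := normr_ge0 z; have wn := normr_ge0 (b * z + a).
by clear -a1 bz tri zn wn; rewrite lerXn2r ?nnegrE; lra.
Qed.

Lemma df1_affine_decay k : exists2 D, 0 <= D & forall (a b z : R), `|a| <= 1 -> 2^-1 <= b ->
  b <= 2 -> (2 + `|z|) ^+ k * `|df1 (b * z + a)| <= D.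
Proof.
have [K [N [K0 HK]]] := phi_growth hf.
have [D D0 HD] := f1_affine_decay (N + k).
exists (K * 2 ^+ N * D); first by rewrite !mulr_ge0 ?exprn_ge0.
move=> a b z a1 b2 bl; set u := b * z + a.
have ub : 2 + `|u| <= 2 * (2 + `|z|).
  have : `|u| <= `|b * z| + `|a| by exact: ler_normD.
  rewrite normrM (@ger0_norm _ b); last lra.
  by have := normr_ge0 z; nra.
have zn := normr_ge0 z; have un := normr_ge0 u.
rewrite (df1E hf) mulNr normrN normrM (ger0_norm (f1_ge0 hf u)).
apply: (@le_trans _ _ ((2 + `|z|) ^+ k * (K * (2 * (2 + `|z|)) ^+ N * f1 u))).
  rewrite ler_wpM2l ?exprn_ge0 ?addr_ge0//.
  rewrite ler_wpM2r ?(f1_ge0 hf)// (le_trans (HK u))// ler_wpM2l//.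
  by rewrite lerXn2r ?nnegrE; lra.
rewrite exprMn.
have -> : (2 + `|z|) ^+ k * (K * (2 ^+ N * (2 + `|z|) ^+ N) * f1 u) =
   K * 2 ^+ N * ((2 + `|z|) ^+ (N + k) * f1 u) by rewrite exprD; ring.
by rewrite ler_wpM2l ?mulr_ge0 ?exprn_ge0// HD.
Qed.

End score.

(** * Asymptotic linearity *)

Section linearity.
Context {R : realType}.
Variables (f1 df1 : R -> R).
Hypothesis hf : classF1 f1 df1.
Local Notation leb := (@lebesgue_measure R).
Local Notation ph := (phi f1 df1).
Local Notation score := (score f1 df1).

Lemma intg_decay (g h : R -> R) : measurable_fun [set: R] g -> measurable_fun [set: R] h ->
  poly_bounded g -> (forall k, exists D, forall z, (2 + `|z|) ^+ k * `|h z| <= D) ->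
  intg leb (fun z => g z * h z).
Proof.
move=> mg mh [K [N [K0 HK]]] hD; have [D HD] := hD (N + 2)%N.
apply: (@intg_quadratic_decay _ (K * D)); first exact: measurable_funM.
move=> z; rewrite normrM.
apply: (@le_trans _ _ (K * ((2 + `|z|) ^+ (N + 2) * `|h z|))); last by rewrite ler_wpM2l.
rewrite exprD.
have -> : K * ((2 + `|z|) ^+ N * (2 + `|z|) ^+ 2 * `|h z|) =
  (2 + `|z|) ^+ 2 * (K * (2 + `|z|) ^+ N * `|h z|) by ring.
by rewrite ler_wpM2l ?sqr_ge0// ler_wpM2r.
Qed.

Lemma f1_lipschitz u w M : (forall t, Num.min u w <= t <= Num.max u w -> `|df1 t| <= M) ->
  `|f1 w - f1 u| <= M * `|w - u|.
Proof.
wlog uw : u w / u <= w => [hw|].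
  case/orP: (le_total u w) => [/hw//|wu hM].
  rewrite distrC (distrC w u); apply: hw => // t.
  by rewrite minC maxC; exact: hM.
move=> hM; rewrite (@ger0_norm _ (w - u)) ?subr_ge0//.
have hM' t : u <= t <= w -> - M <= df1 t <= M.
  by move=> ut; rewrite -ler_norml hM// (min_idPl uw) (max_idPr uw).
rewrite ler_norml -mulNr; apply/andP; split.
  by apply: (f1_incr_ge hf) => // t /hM'/andP[].
by apply: (f1_incr_le hf) => // t /hM'/andP[].
Qed.

Lemma affine_arg_bound (z a b : R) : 2^-1 <= b -> `|(z - a) / b| <= 2 * (`|z| + `|a|).
Proof.
move=> b1; have bp : 0 < b by lra.
rewrite normrM normfV (gtr0_norm bp) ler_pdivrMr//.
have h := ler_normB z a; have h0 : 0 <= `|z| + `|a| by rewrite addr_ge0.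
have : (`|z| + `|a|) * 1 <= (`|z| + `|a|) * (2 * b) by rewrite ler_wpM2l//; lra.
by clear -h; lra.
Qed.

Lemma poly_bounded_score_affine a b : 2^-1 <= b ->
  poly_bounded (fun z => score ((z - a) / b)).
Proof.
move=> b1; have [K [N [K0 HK]]] := poly_bounded_score hf.
pose L := 2 + 2 * (`|a| + 1).
exists (K * L ^+ N), N; split => [|z].
  by rewrite mulr_ge0// exprn_ge0// /L !addr_ge0// mulr_ge0 ?addr_ge0.
rewrite (le_trans (HK _))// -mulrA -exprMn ler_wpM2l//.
have zn := normr_ge0 z; have an := normr_ge0 a.
rewrite lerXn2r ?nnegrE ?addr_ge0//.
  by rewrite /L mulr_ge0// ?addr_ge0// mulr_ge0 ?addr_ge0.
by have := affine_arg_bound z a b1; rewrite /L; nra.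
Qed.

Variables (a b : nat -> R) (C : R).
Hypothesis aC : forall n, Num.sqrt n%:R * `|a n| <= C.
Hypothesis bC : forall n, Num.sqrt n%:R * `|b n - 1| <= C.

Lemma cvg_sqrt_bounded (u : nat -> R) : (forall n, Num.sqrt n%:R * `|u n| <= C) ->
  u n @[n --> \oo] --> (0 : R).
Proof.
move=> uC; apply/norm_cvg0P.
apply: (@squeeze_cvgr _ _ _ _ (cst 0) (fun n => C * (Num.sqrt n%:R)^-1)).
- near=> n; rewrite normr_ge0/= ler_pdivlMr ?sqrtr_gt0 ?ltr0n; first by rewrite mulrC.
  by near: n; exact: nbhs_infty_gt.
- exact: cvg_cst.
- rewrite -[X in _ --> X](mulr0 C); apply: cvgM; [exact: cvg_cst|exact: cvg_sqrt_invn].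
Unshelve. all: by end_near. Qed.

Lemma local_near : \forall n \near \oo, [/\ `|a n| <= 1, 2^-1 <= b n & b n <= 2].
Proof.
have h2 : 0 < 2^-1 :> R by rewrite invr_gt0.
have h1 := @cvgr_dist_lt _ R^o _ _ _ _ _ (cvg_sqrt_bounded aC) _ h2.
have h3 := @cvgr_dist_lt _ R^o _ _ _ _ _ (cvg_sqrt_bounded bC) _ h2.
near=> n.
have : `|0 - a n| < 2^-1 by near: n; exact: h1.
have : `|0 - (b n - 1)| < 2^-1 by near: n; exact: h3.
rewrite !sub0r !normrN ltr_norml => /andP[b1 b2] an; split; lra.
Unshelve. all: by end_near. Qed.

Lemma cvg_b : b n @[n --> \oo] --> (1 : R).
Proof.
rewrite -[X in _ --> X](add0r 1); under eq_fun do rewrite -(subrK 1 (b _)).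
by apply: cvgD; [exact: cvg_sqrt_bounded|exact: cvg_cst].
Qed.

Lemma cvg_arg z : (z - a n) / b n @[n --> \oo] --> z.
Proof.
have {2}-> : z = (z - 0) / 1 by rewrite subr0 divr1.
apply: cvgM; first by apply: cvgB; [exact: cvg_cst|exact: cvg_sqrt_bounded].
by apply: cvgV; [exact: oner_neq0|exact: cvg_b].
Qed.

Lemma cvg_image z : b n * z + a n @[n --> \oo] --> z.
Proof.
have {2}-> : z = 1 * z + 0 by rewrite mul1r addr0.
apply: cvgD; last exact: cvg_sqrt_bounded.
by apply: cvgM; [exact: cvg_b|exact: cvg_cst].
Qed.

(** Dominated convergence: the score is continuous at good points, and polynomial growth bounds it
    uniformly over the local parameters. *)
Lemma score_shift_L2 :
  \int[leb]_z ((score ((z - a n) / b n) - score z) ^+ 2 * f1 z) @[n --> \oo]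
   --> (0 : R).
Proof.
have [K [N [K0 HK]]] := poly_bounded_score hf.
pose g z := (2 * (K * 2 ^+ N)) ^+ 2 * ((2 + `|z|) ^+ N) ^+ 2 * f1 z.
apply: (@dominated_Rint_cvg0 _ _ _ leb
  (fun n z => (score ((z - a n) / b n) - score z) ^+ 2 * f1 z) g).
- have p2 : poly_bounded (fun z : R => 2 + `|z|).
    by exists 1, 1%N; split => // z; rewrite mul1r expr1 ger0_norm// addr_ge0.
  apply: (intg_poly_f1 hf).
    apply: measurable_funM => //; apply: measurable_funX; apply: measurable_funX.
    exact: measurable_funD.
  apply: poly_boundedM; first exact: poly_bounded_cst.
  by apply: poly_boundedX; exact: poly_boundedX.
- near=> n.
  have [a1 b1 b2] : [/\ `|a n| <= 1, 2^-1 <= b n & b n <= 2].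
    by near: n; exact: local_near.
  split.
    apply: measurable_funM; last exact: measurable_f1 hf.
    apply: measurable_funX; apply: measurable_funB; last exact: measurable_score hf.
    by apply: measurableT_comp; [exact: measurable_score hf|exact: measurable_affine].
  move=> z; rewrite normrM normrX (ger0_norm (f1_ge0 hf z)).
  rewrite /g -exprMn ler_wpM2r ?(f1_ge0 hf)//.
  have zn := normr_ge0 z.
  have zu : 2 + `|(z - a n) / b n| <= 2 * (2 + `|z|).
    have := affine_arg_bound z (a n) b1.
    by lra.
  have k1 : `|score ((z - a n) / b n)| <= K * 2 ^+ N * (2 + `|z|) ^+ N.
    rewrite (le_trans (HK _))// -mulrA -exprMn ler_wpM2l//.
    by rewrite lerXn2r ?nnegrE ?addr_ge0// mulr_ge0 ?addr_ge0.
  have k2 : `|score z| <= K * 2 ^+ N * (2 + `|z|) ^+ N.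
    rewrite (le_trans (HK _))// -mulrA ler_wpM2l// ler_peMl ?exprn_ge0 ?addr_ge0//.
    by rewrite exprn_ege1// ler1n.
  rewrite lerXn2r ?nnegrE//.
    by rewrite !mulr_ge0 ?exprn_ge0 ?addr_ge0.
  rewrite (le_trans (ler_normB _ _))//.
  by rewrite (le_trans (lerD k1 k2))// le_eqVlt; apply/orP; left; apply/eqP; ring.
- apply: aeS (good_ae hf) => z [cz _].
  rewrite -[X in _ --> X](mul0r (f1 z)); apply: cvgM; last exact: cvg_cst.
  have u0 : score ((z - a n) / b n) - score z @[n --> \oo] --> (0 : R).
    rewrite -[X in _ --> X](subrr (score z)); apply: cvgB; last exact: cvg_cst.
    by apply: continuous_cvg; [exact: continuous_score|exact: cvg_arg].
  rewrite -[X in _ --> X](mul0r 0); under eq_fun do rewrite expr2.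
  exact: cvgM.
Unshelve. all: by end_near. Qed.

Let mul_measurable (c : R) : measurable_fun [set: R] (fun z => c * z).
Proof. by apply: (@measurable_funM _ _ _ _ (cst c) id). Qed.

(* The first-order effect of the shift [a] vanishes by [Rint_score_df1], and that
   of the scale [b] by parity. *)
Lemma score_shift_mean :
  Num.sqrt n%:R * \int[leb]_z (score ((z - a n) / b n) * f1 z) @[n --> \oo]
   --> (0 : R).
Proof.
have ms := measurable_score hf; have mf := measurable_f1 hf.
have ps := poly_bounded_score hf.
have mim (a' b' : R) : measurable_fun [set: R] (fun z => f1 (b' * z + a')).
  by apply: measurableT_comp => //; apply: measurable_funD => //.
have If a' b' : `|a'| <= 1 -> 2^-1 <= b' -> intg leb (fun z => score z * f1 (b' * z + a')).
  move=> a1 b1; apply: (@intg_decay score (fun z => f1 (b' * z + a'))) => // k.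
  have [D _ HD] := f1_affine_decay hf k.
  by exists D => z; rewrite (@ger0_norm _ (f1 _)) ?(f1_ge0 hf)// HD.
have Id : intg leb (fun z => score z * df1 z).
  apply: (@intg_decay score df1) => //; first exact: measurable_df1 hf.
  move=> k; have [D _ HD] := df1_affine_decay hf k.
  exists D => z; have := HD 0 1 z; rewrite mul1r addr0; apply; rewrite ?normr0//.
    by rewrite invf_le1// ler1n.
  by rewrite ler1n.
(* After the substitution z -> b z + a the perturbation sits on f1. Subtracting f1 (b z) and a * df1
   z changes nothing, since the score integrates to zero against the first by parity and against the
   second by the choice of kappa; what remains is a linearization error. *)
pose D n z := Num.sqrt n%:R * (f1 (b n * z + a n) - f1 (b n * z)) - Num.sqrt n%:R * a n * df1 z.
have E : \forall n \near \oo, b n * \int[leb]_z (score z * D n z) =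
    Num.sqrt n%:R * \int[leb]_z (score ((z - a n) / b n) * f1 z).
  near=> n.
  have [a1 b1 b2] : [/\ `|a n| <= 1, 2^-1 <= b n & b n <= 2].
    by near: n; exact: local_near.
  have bp : 0 < b n by apply: lt_le_trans b1; rewrite invr_gt0.
  have I1 := If _ _ a1 b1.
  have I2 : intg leb (fun z => score z * f1 (b n * z)).
    have := If 0 _ _ b1; rewrite normr0 => /(_ ler01).
    by under eq_fun do rewrite addr0.
  have I20 : \int[leb]_z (score z * f1 (b n * z)) = 0.
    apply: Rint_odd => //.
      by apply: measurable_funM => //; apply: measurableT_comp.
    apply: aeS (good_ae hf) => z gz.
    by rewrite (score_odd hf gz) mulrN (f1_even hf) mulNr.
  have eD : (fun z => score z * D n z) = (fun z => (Num.sqrt n%:R * (score z * f1 (b n * z + a n))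
     + - Num.sqrt n%:R * (score z * f1 (b n * z))) + (- (Num.sqrt n%:R * a n)) * (score z * df1 z)).
    by apply/funext => z; rewrite /D; ring.
  rewrite eD RintD; [|by apply: intgD; exact: intgZ|exact: intgZ].
  rewrite RintD; [|exact: intgZ|exact: intgZ].
  rewrite !RintZ// I20 (Rint_score_df1 hf) !mulr0 !addr0 mulrCA; congr (_ * _).
  rewrite -RintZ//.
  rewrite (@Rint_affine _ (a n) (b n) (fun x => b n * (score x * f1 (b n * x + a n))))//.
  - apply: eq_Rintegral => z _.
    have -> : b n * ((z - a n) / b n) + a n = z by field; exact: lt0r_neq0.
    by field; exact: lt0r_neq0.
  - by apply: measurable_funM => //; exact: measurable_funM.
  - have eI : (fun x => b n * (score ((x - a n) / b n) * f1 (b n * ((x - a n) / b n) + a n)) / b n)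
      = (fun x => score ((x - a n) / b n) * f1 x).
      apply/funext => z.
      have -> : b n * ((z - a n) / b n) + a n = z by field; exact: lt0r_neq0.
      by field; exact: lt0r_neq0.
    rewrite eI; apply: (intg_poly_f1 hf); last exact: poly_bounded_score_affine.
    by apply: measurableT_comp => //; exact: measurable_affine.
suff h : b n * \int[leb]_z (score z * D n z) @[n --> \oo] --> (1 * 0 : R).
  by rewrite mulr0 in h; exact: cvg_trans (near_eq_cvg E) h.
apply: cvgM; first exact: cvg_b.
have [K [N [K0 HK]]] := ps.
have [M M0 HM] := df1_affine_decay hf (N + 2).
have C0 : 0 <= C by apply: le_trans (aC 0); rewrite mulr_ge0 ?sqrtr_ge0.
apply: (@dominated_Rint_cvg0 _ _ _ leb (fun n z => score z * D n z) (fun z => (2 * K * M * C) * (1 + z ^+ 2)^-1)).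
- exact/intgZ/intg_inv_oneDsqr.
- near=> n.
  have [a1 b1 b2] : [/\ `|a n| <= 1, 2^-1 <= b n & b n <= 2].
    by near: n; exact: local_near.
  split.
    apply: measurable_funM => //; apply: measurable_funB; apply: measurable_funM => //.
      apply: measurable_funB; first exact: (mim (a n) (b n)).
      by apply: measurableT_comp; [exact: mf|exact: mul_measurable].
    exact: measurable_df1 hf.
  move=> z; have zn := normr_ge0 z; set q := 2 + `|z|.
  have q0 : 0 < q by rewrite /q; lra.
  have dM (a' b' : R) : `|a'| <= 1 -> 2^-1 <= b' -> b' <= 2 -> `|df1 (b' * z + a')| <= M / q ^+ (N + 2).
    by move=> ? ? ?; rewrite ler_pdivlMr ?exprn_gt0// mulrC; exact: HM.
  have D1 : `|f1 (b n * z + a n) - f1 (b n * z)| <= M / q ^+ (N + 2) * `|a n|.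
    have := @f1_lipschitz (b n * z) (b n * z + a n) (M / q ^+ (N + 2)).
    rewrite (addrC (b n * z)) addrK; apply => t tb.
    (* A point between b z and b z + a is b z + a' with |a'| <= |a n| <= 1, so the uniform bound on
       [df1] applies to it. *)
    have -> : t = b n * z + (t - b n * z) by ring.
    apply: dM => //; apply: le_trans a1; move: tb.
    set w := b n * z; rewrite minEle maxEle.
    by case: ifPn; rewrite -?ltNge => h /andP[h1 h2]; rewrite ler_norml; have := ler_norm (a n);
      have := ler_norm (- a n); rewrite normrN; lra.
  have D2 : `|df1 z| <= M / q ^+ (N + 2).
    have := dM 0 1; rewrite mul1r addr0; apply; rewrite ?normr0//.
      by rewrite invf_le1// ler1n.
    by rewrite ler1n.
  have DD : `|D n z| <= 2 * C * (M / q ^+ (N + 2)).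
    rewrite /D (le_trans (ler_normB _ _))// !normrM (ger0_norm (sqrtr_ge0 _)).
    have s0 := sqrtr_ge0 (n%:R : R); have an := aC n.
    move: D1 D2; set m := M / _ => D1 D2.
    have m0 : 0 <= m by apply: le_trans D2.
    have := ler_wpM2l s0 D1.
    have := ler_wpM2r (normr_ge0 (df1 z)) an.
    have := ler_wpM2l C0 D2.
    have := ler_wpM2r m0 an.
    by lra.
  rewrite normrM (le_trans (ler_pM _ _ (HK z) DD))// -/q.
  have -> : K * q ^+ N * (2 * C * (M / q ^+ (N + 2))) = 2 * K * M * C / q ^+ 2.
    by rewrite exprD; field; apply/andP; split; rewrite ?expf_neq0// gt_eqF.
  rewrite ler_wpM2l ?mulr_ge0// lef_pV2 ?posrE ?exprn_gt0//; last first.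
    by rewrite ltr_pwDl// sqr_ge0.
  have -> : z ^+ 2 = `|z| ^+ 2 by rewrite real_normK ?num_real.
  by rewrite /q; nra.
- apply: aeS (good_ae hf) => z [cz _].
  rewrite -[X in _ --> X](mulr0 (score z)); apply: cvgM; first exact: cvg_cst.
  apply/cvgrPdist_le => /= e e0.
  (* The linearization error is multiplied by sqrt n |a n| <= C. *)
  have e1 : 0 < e / (C + 1) by rewrite divr_gt0// ltr_wpDl.
  have [del d0 Hd] := f1_strict_derivative hf cz e1.
  have h1 := @cvgr_dist_lt _ R^o _ _ _ _ _ (@cvg_image z) _ d0.
  have bz : b n * z @[n --> \oo] --> 1 * z by apply: cvgM; [exact: cvg_b|exact: cvg_cst].
  have h2 := @cvgr_dist_lt _ R^o _ _ _ _ _ bz _ d0.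
  near=> n.
  have w1 : `|(b n * z + a n) - z| < del by rewrite distrC; near: n; exact: h1.
  have w2 : `|b n * z - z| < del.
    by rewrite distrC -{1}(mul1r z); near: n; exact: h2.
  have := Hd _ _ w2 w1; rewrite (addrC (b n * z) (a n)) addrK (addrC (a n)) => H.
  have := ler_wpM2l (sqrtr_ge0 (n%:R : R)) H.
  rewrite sub0r normrN -{1}(ger0_norm (sqrtr_ge0 (n%:R : R))) -normrM.
  rewrite /D mulrBr mulrA => /le_trans; apply.
  rewrite mulrCA mulrAC ler_pdivrMr ?ltr_wpDl//.
  rewrite ler_wpM2l ?(ltW e0)// (le_trans (aC n))//; lra.
Unshelve. all: by end_near. Qed.

End linearity.

(* Lebesgue measure lives on [measurableTypeR R], whose display differs from
   the default one of [R] used for samples. *)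
Definition default_display {R : realType} : measurableTypeR R -> R := id.

Lemma measurable_default_display (R : realType) :
  measurable_fun [set: measurableTypeR R] (@default_display R).
Proof. by move=> _ Y mY; rewrite setTI. Qed.

HB.instance Definition _ (R : realType) :=
  isMeasurableFun.Build _ _ (measurableTypeR R) R (@default_display R)
    (@measurable_default_display R).

(** The inverse is continuous off 0 and constant on {0}. The point 0 matters because an estimator of
    sigma may vanish. *)
Lemma measurable_inv (R : realType) : measurable_fun [set: R] (fun x : R => x^-1).
Proof.
rewrite -(setvU [set 0]); apply/measurable_funU => //.
  exact: measurableC.
split; last exact: measurable_fun_set1.
apply: open_continuous_measurable_fun; first exact/closed_openC/accessible_closed_set1/hausdorff_accessible/norm_hausdorff.
by move=> x; rewrite inE/= => x0; apply: inv_continuous; exact/eqP.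
Qed.

Section real_density.
Context {R : realType}.
Local Notation leb := (@lebesgue_measure R).
Variable f : R -> R.
Hypotheses (mf : measurable_fun [set: R] f) (f0 : forall x, 0 <= f x).

Lemma exists_real_density_prob : (\int[leb]_x (f x)%:E = 1)%E ->
  exists P : probability R R,
    forall A, measurable A -> (P A = \int[leb]_(x in A) (f x)%:E)%E.
Proof.
move=> f1; have [nu nuE] := @exists_density_prob _ (measurableTypeR R) R leb f mf f0 f1.
exists (distribution nu (@default_display R)) => A mA.
by rewrite /= /distribution /pushforward nuE.
Qed.

Variable P : probability R R.
Hypothesis PE : forall A, measurable A -> (P A = \int[leb]_(x in A) (f x)%:E)%E.

Lemma ge0_integral_real_density (h : R -> R) :
  measurable_fun [set: R] h -> (forall x, 0 <= h x) ->
  (\int[P]_x (h x)%:E = \int[leb]_x (h x * f x)%:E)%E.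
Proof.
move=> mh h0.
have fi : (\int[leb]_x (f x)%:E = 1)%E by rewrite -PE//; exact: probability_setT.
have [nu nuE] := @exists_density_prob _ (measurableTypeR R) R leb f mf f0 fi.
have mhE : measurable_fun [set: R] (EFin \o h) by exact/measurable_EFinP.
transitivity (\int[nu]_x (h x)%:E)%E.
  rewrite (eq_measure_integral (distribution nu (@default_display R))).
    by rewrite ge0_integral_pushforward ?preimage_setT// => y _; rewrite lee_fin.
  by move=> A mA _; exact: etrans (PE mA) (esym (nuE A mA)).
rewrite (@ge0_integral_density _ (measurableTypeR R) R leb nu f mf f0 nuE)//.
Qed.

End real_density.

(** * Null laws in standardized coordinates and linearity of T *)

Section null_law.
Context {R : realType}.
Variables (f1 df1 : R -> R).
Hypothesis hf : classF1 f1 df1.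
Variables (theta sigma : R).
Hypothesis s0 : 0 < sigma.
Local Notation leb := (@lebesgue_measure R).
Local Notation sc := (score f1 df1).
Local Notation gam := (gamma f1 df1).

Definition null_density x := sigma^-1 * f1 ((x - theta) / sigma).

Lemma measurable_null_density : measurable_fun [set: R] null_density.
Proof.
apply: measurable_funM => //; apply: measurableT_comp; first exact: measurable_f1 hf.
exact: measurable_affine.
Qed.

Lemma null_density_ge0 x : 0 <= null_density x.
Proof. by rewrite mulr_ge0 ?invr_ge0 ?(ltW s0)// (f1_ge0 hf). Qed.

Definition null_score x := sc ((x - theta) / sigma).

Lemma measurable_null_score : measurable_fun [set: R] null_score.
Proof. by apply: measurableT_comp; [exact: measurable_score hf|exact: measurable_affine]. Qed.

Lemma integral_null_density : (\int[leb]_x (null_density x)%:E = 1)%E.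
Proof.
have [[_ _ <-] _ _] := F1_F0 hf.
rewrite (ge0_integral_lebesgue_affine theta s0); [|exact: measurable_f1 hf|exact: f1_ge0 hf].
by apply: eq_integral => x _; rewrite mulrC.
Qed.

Variable P0 : probability R R.
Hypothesis P0E : forall A, measurable A ->
  (P0 A = \int[leb]_(x in A) (null_density x)%:E)%E.

Let maff : measurable_fun [set: R] (fun z => sigma * z + theta).
Proof.
by apply: measurable_funD.
Qed.

Let nullE (h : R -> R) : measurable_fun [set: R] h -> (forall x, 0 <= h x) ->
  (\int[P0]_x (h x)%:E = \int[leb]_z (h (sigma * z + theta) * f1 z)%:E)%E.
Proof.
move=> mh h0.
rewrite (ge0_integral_real_density measurable_null_density null_density_ge0 P0E mh h0).
rewrite (@ge0_integral_lebesgue_affine _ (- theta / sigma) sigma^-1) ?invr_gt0//.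
- apply: eq_integral => z _; congr EFin; rewrite /null_density.
    have -> : (z - - theta / sigma) / sigma^-1 = sigma * z + theta.
      by field; exact: lt0r_neq0.
    have -> : (sigma * z + theta - theta) / sigma = z by field; exact: lt0r_neq0.
    by field; exact: lt0r_neq0.
- by apply: measurable_funM => //; exact: measurable_null_density.
- by move=> x; rewrite mulr_ge0 ?null_density_ge0.
Qed.

Let unaff z : (sigma * z + theta - theta) / sigma = z.
Proof. by field; exact: lt0r_neq0. Qed.

Lemma intg_null (G : R -> R) : measurable_fun [set: R] G ->
  intg leb (fun z => G z * f1 z) -> intg P0 (fun x => G ((x - theta) / sigma)).
Proof.
move=> mG IG; apply: (@intg_transfer _ _ R (measurableTypeR R) R P0 leb
  (fun z => sigma * z + theta) f1 (f1_ge0 hf) nullE (fun x => G ((x - theta) / sigma))).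
  by apply: measurableT_comp => //; exact: measurable_affine.
by under eq_fun do rewrite unaff.
Qed.

Lemma Rint_null (G : R -> R) : measurable_fun [set: R] G ->
  intg leb (fun z => G z * f1 z) ->
  \int[P0]_x G ((x - theta) / sigma) = \int[leb]_z (G z * f1 z).
Proof.
move=> mG IG.
rewrite (@Rint_transfer _ _ R (measurableTypeR R) R P0 leb (fun z => sigma * z + theta)
  f1 maff (measurable_f1 hf) (f1_ge0 hf) nullE (fun x => G ((x - theta) / sigma))).
- by apply: eq_Rintegral => z _; rewrite unaff.
- by apply: measurableT_comp => //; exact: measurable_affine.
- by under eq_fun do rewrite unaff.
Qed.

Let mscX n : measurable_fun [set: R] (fun z => sc z ^+ n).
Proof. by apply: measurable_funX; exact: measurable_score hf. Qed.

Lemma intg_null_scoreX n : intg P0 (fun x => null_score x ^+ n).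
Proof. exact: (intg_null (mscX n) (intg_scoreX hf n)). Qed.

Lemma Rint_score_f1 : \int[leb]_z (sc z * f1 z) = 0.
Proof.
apply: Rint_odd; first by apply: measurable_funM; [exact: measurable_score hf|exact: measurable_f1 hf].
  exact: (intg_scoreX hf 1).
apply: aeS (good_ae hf) => z gz.
by rewrite (score_odd hf gz) (f1_even hf) mulNr.
Qed.

Lemma Rint_null_score : \int[P0]_x null_score x = 0.
Proof. by rewrite (Rint_null (mscX 1) (intg_scoreX hf 1)) Rint_score_f1. Qed.

Lemma Rint_null_score2 : \int[P0]_x null_score x ^+ 2 = gam.
Proof. by rewrite (Rint_null (mscX 2) (intg_scoreX hf 2)) -gammaE. Qed.

Lemma TnE n (x : n.-tuple R) : Tn f1 df1 x theta sigma = scaled_sum P0 null_score x.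
Proof.
rewrite /scaled_sum Rint_null_score2; congr (_ * _); apply: eq_bigr => i _.
by rewrite /null_score /score (mulrC _ sigma^-1).
Qed.

Lemma measurable_Tn n (t s : n.-tuple R -> R) : measurable_fun [set: n.-tuple R] t ->
  measurable_fun [set: n.-tuple R] s ->
  measurable_fun [set: n.-tuple R] (fun x => Tn f1 df1 x (t x) (s x)).
Proof.
move=> mt ms; apply: measurable_funM => //; apply: measurable_sum => i.
apply: (@measurableT_comp _ _ _ _ _ _ sc).
  exact: measurable_score hf.
apply: measurable_funM.
  by apply: measurableT_comp => //; exact: measurable_inv.
by apply: measurable_funB => //; exact: measurable_tnth.
Qed.

(** In standardized form the perturbation is z -> (z - a) / b with a = (th - theta) / sigma and b =
    sg / sigma. Chebyshev's inequality then gives (v + (sqrt n m)^2) / (e^2 gamma), where v and m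
    are the quantities of [score_shift_L2] and [score_shift_mean]. *)
Lemma Tn_linear (th sg : nat -> R) (C : R) :
  (forall n, Num.sqrt n%:R * `|th n - theta| <= C) ->
  (forall n, Num.sqrt n%:R * `|sg n - sigma| <= C) ->
  forall e, 0 < e -> pr (iid P0 n)
    [set x | e < `|Tn f1 df1 x (th n) (sg n) - Tn f1 df1 x theta sigma|]
    @[n --> \oo] --> (0 : R).
Proof.
move=> thC sgC e e0.
pose a n := (th n - theta) / sigma; pose b n := sg n / sigma.
have aC n : Num.sqrt n%:R * `|a n| <= C / sigma.
  by rewrite normrM normfV (gtr0_norm s0) mulrA ler_pM2r ?invr_gt0.
have bC n : Num.sqrt n%:R * `|b n - 1| <= C / sigma.
  have -> : b n - 1 = (sg n - sigma) / sigma by rewrite /b; field; exact: lt0r_neq0.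
  by rewrite normrM normfV (gtr0_norm s0) mulrA ler_pM2r ?invr_gt0.
pose g n x := sc ((sg n)^-1 * (x - th n)) - null_score x.
pose G n z := sc ((z - a n) / b n) - sc z.
have gG n x : g n x = G n ((x - theta) / sigma).
  rewrite /g /G; congr (sc _ - _); rewrite /a /b invfM invrK.
  have -> : (x - theta) / sigma - (th n - theta) / sigma = (x - th n) / sigma by ring.
  (* For sg n = 0 both arguments are 0, the inverse of 0 being 0. *)
  have [->|sn] := eqVneq (sg n) 0; first by rewrite invr0 !(mul0r, mulr0).
  by field; rewrite sn lt0r_neq0.
have mG n : measurable_fun [set: R] (G n).
  apply: measurable_funB; last exact: measurable_score hf.
  by apply: measurableT_comp; [exact: measurable_score hf|exact: measurable_affine].
have g0 := gamma_gt0 hf.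
pose m n := \int[leb]_z (sc ((z - a n) / b n) * f1 z).
pose v n := \int[leb]_z ((sc ((z - a n) / b n) - sc z) ^+ 2 * f1 z).
have m0 : Num.sqrt n%:R * m n @[n --> \oo] --> (0 : R) := score_shift_mean hf aC bC.
have v0 : v n @[n --> \oo] --> (0 : R) := score_shift_L2 hf aC bC.
apply: (@squeeze_cvgr _ _ _ _ (cst 0)
  (fun n => (v n + (Num.sqrt n%:R * m n) * (Num.sqrt n%:R * m n)) / (e ^+ 2 * gam))); last 2 first.
- exact: cvg_cst.
- rewrite -(mul0r (e ^+ 2 * gam)^-1); apply: cvgM; last exact: cvg_cst.
  rewrite -[X in _ --> X](addr0 0); apply: cvgD => //.
  by rewrite -[X in _ --> X](mulr0 0); apply: cvgM.
near=> n; rewrite pr_ge0/=.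
have n0 : (0 < n)%N by near: n; exact: nbhs_infty_gt.
have [_ b1 _] : [/\ `|a n| <= 1, 2^-1 <= b n & b n <= 2].
  by near: n; exact: (local_near aC bC).
have pbG : poly_bounded (G n).
  apply: poly_boundedD; first exact: poly_bounded_score_affine.
  have := poly_boundedM (poly_bounded_cst (-1)) (poly_bounded_score hf).
  by under eq_fun do rewrite mulN1r.
have IG : intg leb (fun z => G n z * f1 z) by exact: (intg_poly_f1 hf (mG n) pbG).
have IG2 : intg leb (fun z => G n z ^+ 2 * f1 z).
  by apply: (intg_poly_f1 hf); [exact: measurable_funX|exact: poly_boundedX].
have mG2 : measurable_fun [set: R] (fun z => G n z ^+ 2) by exact: measurable_funX.
have gE : g n = fun x => G n ((x - theta) / sigma) by apply/funext => x; exact: gG.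
have Ig : intg P0 (g n) by rewrite gE; exact: (intg_null (mG n)).
have Ig2 : intg P0 (fun x => g n x ^+ 2).
  by rewrite gE; exact: (intg_null mG2 IG2).
have en : 0 < e * Num.sqrt (n%:R * gam).
  by rewrite mulr_gt0// sqrtr_gt0 mulr_gt0// ltr0n.
have mE : measurable [set x : n.-tuple R | e < `|Tn f1 df1 x (th n) (sg n) - Tn f1 df1 x theta sigma|].
  apply: (@measurable_gt_cst _ (fun n => n.-tuple R) _ n).
  by apply: measurableT_comp => //; apply: measurable_funB; exact: measurable_Tn.
apply: (le_trans (chebyshev_iid Ig Ig2 en mE _)).
  move=> z /= /ltW; rewrite /Tn -mulrBr normrM ger0_norm ?invr_ge0 ?sqrtr_ge0//.
  rewrite mulrC ler_pdivlMr ?sqrtr_gt0 ?mulr_gt0 ?ltr0n// -sumrB.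
  move=> /le_trans; apply; rewrite le_eqVlt; apply/orP; left; apply/eqP; congr `|_|.
  by apply: eq_bigr => i _; rewrite /g /null_score /= (mulrC sigma^-1).
have -> : \int[P0]_x g n x = m n.
  rewrite -[m n]subr0 -Rint_score_f1 -RintB; last 2 first.
  - apply: (intg_poly_f1 hf); last exact: poly_bounded_score_affine.
    by apply: measurableT_comp; [exact: measurable_score hf|exact: measurable_affine].
  - exact: (intg_scoreX hf 1).
  under eq_Rintegral => x _ do rewrite gG.
  by rewrite (Rint_null (mG n) IG); apply: eq_Rintegral => z _; rewrite /G mulrBl.
have -> : \int[P0]_x g n x ^+ 2 = v n.
  under eq_Rintegral => x _ do rewrite gG.
  by rewrite (Rint_null mG2 IG2).
have nn : Num.sqrt (n%:R : R) * Num.sqrt n%:R = n%:R by rewrite -expr2 sqr_sqrtr.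
have -> : (e * Num.sqrt (n%:R * gam)) ^+ 2 = n%:R * (e ^+ 2 * gam).
  by rewrite exprMn sqr_sqrtr ?mulr_ge0 ?(ltW g0)//; ring.
rewrite le_eqVlt; apply/orP; left; apply/eqP.
have -> : Num.sqrt n%:R * m n * (Num.sqrt n%:R * m n) = n%:R * m n ^+ 2.
  by rewrite -[in RHS]nn; ring.
have n00 : (n%:R : R) != 0 by rewrite pnatr_eq0 -lt0n.
by field; rewrite n00 !lt0r_neq0.
Unshelve. all: by end_near. Qed.

End null_law.

Lemma pr_bigsetU d (T : measurableType d) (R : realType) (P : probability T R)
    (A : nat -> set T) m : (forall j, measurable (A j)) ->
  pr P (\big[setU/set0]_(j < m) A j) <= \sum_(j < m) pr P (A j).
Proof.
move=> mA; elim: m => [|m IH].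
  by rewrite !big_ord0 /pr measure0.
rewrite !big_ord_recr/=; apply: le_trans (_ : pr P (\big[setU/set0]_(j < m) A j) + pr P (A m) <= _); last by rewrite lerD2r.
by apply: pr_setU => //; [apply: measurableU => //|]; exact: bigsetU_measurable.
Qed.

Lemma cvg0_sum (R : realType) (f : nat -> nat -> R) m :
  (forall j, f j n @[n --> \oo] --> (0 : R)) ->
  \sum_(j < m) f j n @[n --> \oo] --> (0 : R).
Proof.
move=> f0; elim: m => [|m IH].
  by under eq_fun do rewrite big_ord0; exact: cvg_cst.
under eq_fun do rewrite big_ord_recr/=.
have h := cvgD IH (f0 m); rewrite addr0 in h; exact: h.
Qed.

(** * Discretized estimators *)

Section discretization.
Context {R : realType}.
Implicit Types est : @estimator R.

(* Within the root-n ball the estimator takes its values among finitely many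
   deterministic sequences. *)
Lemma discrete_enum est (target c : R) : 0 < c -> asymptotically_discrete est target ->
  exists m (u : nat -> nat -> R),
    (forall j n, Num.sqrt n%:R * `|u j n - target| <= c) /\
    \forall n \near \oo, forall x, Num.sqrt n%:R * `|est n x - target| <= c ->
      exists2 j, (j < m)%N & est n x = u j n.
Proof.
move=> c0 /(_ c c0)[m hm].
pose A n := range (est n) `&` [set t | `|t - target| <= c / Num.sqrt n%:R]%R.
have /choice[g Hg] : forall n, exists g : nat -> R,
    (forall j, Num.sqrt n%:R * `|g j - target| <= c) /\
    ((A n #<= `I_m)%card -> forall t, A n t ->
      Num.sqrt n%:R * `|t - target| <= c -> exists2 j, (j < m)%N & t = g j).
  move=> n; have [/pcard_surjP[g gA]|nA] := pselect (A n #<= `I_m)%card; last first.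
    (* The value [target] serves as filler, here and for values outside the ball, so that the root-n
       bound holds for every j and n and not only eventually. *)
    by exists (fun=> target); split => // j; rewrite subrr normr0 mulr0 ltW.
  exists (fun j => if Num.sqrt n%:R * `|g j - target| <= c then g j else target).
  split=> [j|_ t /gA[j jm <-] tc]; last by exists j => //; rewrite tc.
  by case: ifPn => // _; rewrite subrr normr0 mulr0 ltW.
exists m, (fun j n => g n j); split=> [j n|]; first by have [] := Hg n.
near=> n => x xc.
have n0 : 0 < Num.sqrt (n%:R : R).
  by rewrite sqrtr_gt0 ltr0n; near: n; exact: nbhs_infty_gt.
have [_] := Hg n; apply => //; first by near: n; exact: hm.
by split; [exists x|rewrite /= ler_pdivlMr// mulrC].
Unshelve. all: by end_near. Qed.

Variables (Q : forall n, probability (n.-tuple R) R) (D : forall n, n.-tuple R -> R -> R -> R).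
Hypothesis mD : forall n (t s : n.-tuple R -> R),
  measurable_fun [set: n.-tuple R] t -> measurable_fun [set: n.-tuple R] s ->
  measurable_fun [set: n.-tuple R] (fun x => D x (t x) (s x)).
Variables theta sigma : R.
Hypothesis HD : forall (th sg : nat -> R) (C : R),
  (forall n, Num.sqrt n%:R * `|th n - theta| <= C) ->
  (forall n, Num.sqrt n%:R * `|sg n - sigma| <= C) ->
  forall e, 0 < e ->
  pr (Q n) [set x | e < `|D x (th n) (sg n)|] @[n --> \oo] --> (0 : R).

Let msqrt est target c n : measurable [set x | c < Num.sqrt n%:R * `|est n x - target|].
Proof.
apply: (@measurable_gt_cst _ (fun n => n.-tuple R) _ n).
apply: measurable_funM => //; apply: measurableT_comp => //.
exact: measurable_funB.
Qed.

Let consistent_pr est target c e M : M <= c ->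
  (\forall n \near \oo,
    (Q n [set x | (M < Num.sqrt n%:R * `|est n x - target|)%R] <= e%:E)%E) ->
  \forall n \near \oo, pr (Q n) [set x | c < Num.sqrt n%:R * `|est n x - target|] <= e.
Proof.
move=> Mc; apply: filterS => n; rewrite (prE (Q n) (@msqrt est target M n)) lee_fin; apply: le_trans.
by apply: le_pr; [exact: msqrt|exact: msqrt|move=> x /=; exact: le_lt_trans].
Qed.

(** Off two events of probability at most eps / 3, both estimators are in their balls, and the event
    is covered by m1 * m2 events with deterministic arguments, whose probabilities tend to 0 by
    [HD]. *)
Lemma discretization (t s : @estimator R) :
  root_n_consistent Q t theta -> asymptotically_discrete t theta ->
  root_n_consistent Q s sigma -> asymptotically_discrete s sigma ->
  forall e, 0 < e ->
  pr (Q n) [set x | e < `|D x (t n x) (s n x)|] @[n --> \oo] --> (0 : R).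
Proof.
move=> ct dt cs ds e e0; apply/cvgrPdist_le => /= eps eps0.
have eps3 : 0 < eps / 3 by rewrite divr_gt0.
have [M1 HM1] := ct _ eps3; have [M2 HM2] := cs _ eps3.
pose c := `|M1| + `|M2| + 1.
have c0 : 0 < c by rewrite ltr_wpDl// addr_ge0.
have M1c : M1 <= c by rewrite (le_trans (ler_norm _))// /c -addrA lerDl addr_ge0.
have M2c : M2 <= c by rewrite (le_trans (ler_norm _))// /c addrAC lerDr addr_ge0.
have [m1 [u [uc Hu]]] := discrete_enum c0 dt.
have [m2 [v [vc Hv]]] := discrete_enum c0 ds.
pose E n j k := [set x : n.-tuple R | e < `|D x (u j n) (v k n)|].
have mE n j k : measurable (E n j k).
  apply: (@measurable_gt_cst _ (fun n => n.-tuple R) _ n).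
  by apply: measurableT_comp => //; exact: mD.
have sum0 : \sum_(j < m1) \sum_(k < m2) pr (Q n) (E n j k) @[n --> \oo] --> (0 : R).
  apply: (cvg0_sum _ (f := fun j n => \sum_(k < m2) pr (Q n) (E n j k))) => j.
  apply: (cvg0_sum _ (f := fun k n => pr (Q n) (E n j k))) => k.
  exact: HD (uc j) (vc k) _ e0.
move/cvgrPdist_le : sum0 => /(_ _ eps3) sum0.
have p1 := consistent_pr M1c HM1; have p2 := consistent_pr M2c HM2.
near=> n; rewrite sub0r normrN (ger0_norm (pr_ge0 _ _)).
have Hun := near Hu n; have Hvn := near Hv n.
have mU2 : measurable (\big[setU/set0]_(j < m1) \big[setU/set0]_(k < m2) E n j k).
  by apply: bigsetU_measurable => j _; apply: bigsetU_measurable => k _; exact: mE.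
have mA : measurable [set x | e < `|D x (t n x) (s n x)|].
  apply: (@measurable_gt_cst _ (fun n => n.-tuple R) _ n).
  by apply: measurableT_comp => //; exact: mD.
have mU3 := measurableU _ _ (@msqrt s sigma c n) mU2.
apply: (@le_trans _ _ (pr (Q n) [set x | c < Num.sqrt n%:R * `|t n x - theta|] +
  pr (Q n) ([set x | c < Num.sqrt n%:R * `|s n x - sigma|] `|`
  \big[setU/set0]_(j < m1) \big[setU/set0]_(k < m2) E n j k))).
  apply: pr_setU; [exact: mA|exact: msqrt|exact: mU3|move=> x /= xe].
  have [tc|] := leP (Num.sqrt n%:R * `|t n x - theta|) c; last by left.
  right; have [sc|] := leP (Num.sqrt n%:R * `|s n x - sigma|) c; last by left.
  have [j jm tj] : exists2 j, (j < m1)%N & t n x = u j n by exact: Hun.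
  have [k km sk] : exists2 k, (k < m2)%N & s n x = v k n by exact: Hvn.
  right; rewrite -(bigcup_mkord m1 (fun j => \big[setU/set0]_(k < m2) E n j k)).
  by exists j => //; rewrite -(bigcup_mkord m2 (E n j)); exists k => //; rewrite /E/= -tj -sk.
have -> : eps = eps / 3 + (eps / 3 + eps / 3) by field.
apply: lerD; first by near: n; exact: p1.
apply: (@le_trans _ _ (pr (Q n) [set x | c < Num.sqrt n%:R * `|s n x - sigma|] +
  pr (Q n) (\big[setU/set0]_(j < m1) \big[setU/set0]_(k < m2) E n j k))).
  by apply: pr_setU; [exact: mU3|exact: msqrt|exact: mU2|].
apply: lerD; first by near: n; exact: p2.
apply: (@le_trans _ _ (\sum_(j < m1) \sum_(k < m2) pr (Q n) (E n j k))).
  apply: le_trans (_ : \sum_(j < m1) pr (Q n) (\big[setU/set0]_(k < m2) E n j k) <= _).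
    apply: (@pr_bigsetU _ _ _ _ (fun j => \big[setU/set0]_(k < m2) E n j k)) => j.
    by apply: bigsetU_measurable => k _; exact: mE.
  by apply: ler_sum => j _; apply: (@pr_bigsetU _ _ _ _ (E n j)) => k; exact: mE.
apply: le_trans (ler_norm _) _.
by rewrite -normrN -sub0r; near: n; exact: sum0.
Unshelve. all: by end_near. Qed.

(** A known location is treated as a constant estimator, which puts the two tests of (ii) under one
    statement. *)
Lemma cst_root_n_consistent (theta0 : R) :
  root_n_consistent Q (fun n => cst theta0 : {mfun n.-tuple R >-> R}) theta0.
Proof.
move=> e e0; exists 0; apply: nearW => n.
rewrite (_ : [set _ | _] = set0) ?measure0 ?lee_fin ?(ltW e0)//.
by apply/seteqP; split => // x /=; rewrite subrr normr0 mulr0 ltxx.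
Qed.

Lemma cst_asymptotically_discrete (theta0 : R) :
  asymptotically_discrete (fun n => cst theta0 : {mfun n.-tuple R >-> R}) theta0.
Proof.
move=> c c0; exists 1%N; apply: nearW => n.
apply: card_le_trans (_ : [set theta0] #<= _)%card.
  by apply: subset_card_le => _ [[x _ <-] _].
by apply/pcard_surjP; exists (fun=> theta0) => _ ->; exists 0%N.
Qed.

End discretization.

(** * Likelihood ratio of the skewed densities *)

Lemma measurable_natbool d (T : measurableType d) (R : realType) (A : T -> bool) :
  measurable [set x | A x] -> measurable_fun [set: T] (fun x => (A x)%:R : R).
Proof.
move=> mA; rewrite (_ : (fun x => _) = \1_[set x | A x]); first exact: measurable_indic.
by apply/funext => x; rewrite indicE; case: (boolP (A x)) => Ax; [rewrite mem_set|rewrite memNset//; exact/negP].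
Qed.

(** The law [iid Q n] shows that the choice behind [Pn] has a candidate, and [iid_unique] that any
    candidate agrees with it on measurable sets. *)
Lemma Pn_iid (R : realType) (f1 df1 : R -> R) n (theta sigma xi : R) (Q : probability R R) :
  (forall A, measurable A ->
    (Q A = \int[lebesgue_measure]_(x in A) (skew_density f1 df1 theta sigma xi x)%:E)%E) ->
  forall A, measurable A -> Pn f1 df1 n theta sigma xi A = iid Q n A.
Proof.
move=> QE; apply: iid_unique => A mA.
have : iid_with_density (skew_density f1 df1 theta sigma xi) (Pn f1 df1 n theta sigma xi).
  apply: xgetPex; exists (iid Q n) => B mB.
  by rewrite iid_rect//; apply: eq_bigr => i _; rewrite QE.
by move=> /(_ _ mA) ->; apply: eq_bigr => i _; rewrite QE.
Qed.

Definition clamp {R : realType} (u : R) : R := Num.max (-1) (Num.min 1 u).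

Section clamp.
Context {R : realType}.
Implicit Types u : R.

Lemma clampN u : clamp (- u) = - clamp u.
Proof.
rewrite /clamp !minEle !maxEle.
by repeat case: ifPn; rewrite -?ltNge; lra.
Qed.

Lemma clamp_ge u : 0 <= 1 + clamp u.
Proof.
by rewrite /clamp !minEle !maxEle; repeat case: ifPn; rewrite -?ltNge; lra.
Qed.

Lemma clamp_id u : `|u| <= 1 -> clamp u = u.
Proof.
rewrite ler_norml => /andP[u1 u2].
by rewrite /clamp !minEle !maxEle; repeat case: ifPn; rewrite -?ltNge; lra.
Qed.

Lemma clamp_out u : 1 <= `|u| -> clamp u = Num.sg u.
Proof.
rewrite ler_normr => /orP[] u1.
  rewrite gtr0_sg; last lra.
  by rewrite /clamp !minEle !maxEle; repeat case: ifPn; rewrite -?ltNge; lra.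
rewrite ltr0_sg; last lra.
by rewrite /clamp !minEle !maxEle; repeat case: ifPn; rewrite -?ltNge; lra.
Qed.

Lemma norm_clamp u : `|clamp u| <= `|u|.
Proof.
have [u1|/ltW u1] := leP `|u| 1; first by rewrite clamp_id.
by rewrite clamp_out// (le_trans _ u1)// normr_sg; case: (u != 0).
Qed.

Lemma norm_clamp_le1 u : `|clamp u| <= 1.
Proof.
have [u1|/ltW u1] := leP `|u| 1; first by rewrite clamp_id.
by rewrite clamp_out// normr_sg; case: (u != 0).
Qed.

End clamp.

Section skew.
Context {R : realType}.
Variables (f1 df1 : R -> R).
Hypothesis hf : classF1 f1 df1.
Local Notation leb := (@lebesgue_measure R).
Local Notation ph := (phi f1 df1).
Local Notation kap := (kappa f1 df1).
Local Notation sc := (score f1 df1).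


(** Only z is assumed good: w will be [zstar], where phi may jump and oddness may fail. Monotonicity
    alone compares phi w with phi (- |z|) and phi |z|, which are opposite to each other. *)
Lemma score_compare z w : good f1 df1 z -> z != 0 -> kap < w ^+ 2 ->
  (`|z| < `|w| -> kap <= z ^+ 2 -> `|sc z| <= `|sc w|) /\
  (`|w| < `|z| -> `|sc w| <= `|sc z|).
Proof.
move=> gz z0 kw.
have nz : 0 < `|z| by rewrite normr_gt0.
have pz : `|ph z| = ph `|z| /\ ph (- `|z|) = - ph `|z|.
  have pp := phi_ge0 hf nz; have gE := good_odd hf gz.
  have [z1|z1] := ltP z 0.
    move: pp; rewrite (ltr0_norm z1) opprK gE opprK => pp; split=> //.
    by rewrite -normrN ger0_norm.
  by move: pp; rewrite (ger0_norm z1) gE => pp; rewrite ger0_norm.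
have [pz1 pz2] := pz; have mono := F1_monotone hf.
have z2 : z ^+ 2 = `|z| ^+ 2 by rewrite real_normK ?num_real.
have w2 : w ^+ 2 = `|w| ^+ 2 by rewrite real_normK ?num_real.
have wl := ler_norm w; have wl' := ler_norm (- w); rewrite normrN in wl'.
split=> [zw kz|wz]; rewrite /score (normrM (ph z)) (normrM (ph w)).
  rewrite ler_pM//.
    rewrite pz1; have [w0|w0] := ltP w 0.
      have : ph w <= ph (- `|z|) by apply: mono; rewrite (ltr0_norm w0) in zw; lra.
      by rewrite pz2 => h; have := ler_norm (- ph w); rewrite normrN; clear -h; lra.
    apply: le_trans (ler_norm _); apply: mono.
    by rewrite (ger0_norm w0) in zw; exact: ltW.
  rewrite !ger0_norm ?subr_ge0 ?(ltW kw)// lerD2r z2 w2.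
  by rewrite lerXn2r ?nnegrE ?(ltW zw).
rewrite ler_pM//.
  rewrite pz1 ler_norml -pz2; apply/andP; split; apply: mono; lra.
have wz2 : w ^+ 2 <= z ^+ 2 by rewrite z2 w2 lerXn2r ?nnegrE ?(ltW wz).
rewrite !ger0_norm ?subr_ge0 ?(ltW kw) ?(le_trans (ltW kw))//.
by rewrite lerD2r.
Qed.

Lemma score_bounded : exists2 B, 0 < B & forall z, z ^+ 2 <= kap -> `|sc z| <= B.
Proof.
have [K [N [K0 HK]]] := poly_bounded_score hf.
have k0 := normr_ge0 kap.
exists (K * (3 + `|kap|) ^+ N + 1); first by rewrite ltr_wpDl// mulr_ge0// exprn_ge0//; lra.
move=> z zk; apply: (le_trans (HK z)); rewrite ler_wpDr// ler_wpM2l//.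
have z2 : `|z| ^+ 2 <= `|kap| by rewrite real_normK ?num_real// (le_trans zk)// ler_norm.
have zn := normr_ge0 z.
by rewrite lerXn2r ?nnegrE; nra.
Qed.

(** This is the equation of [zstar] divided by f1, which is positive, with df1 = - phi f1. *)
Lemma zstar_score xi : admissible f1 df1 xi -> xi != 0 ->
  xi * sc (zstar f1 df1 xi) = -1.
Proof.
move=> [->|[z [zP _]]] x0; first by rewrite eqxx in x0.
have : zstar_set f1 df1 xi (zstar f1 df1 xi) by apply: getPex; exists z.
rewrite /zstar_set/= (df1E hf); set w := zstar _ _ _ => wE.
have f0 := f1_gt0 hf w.
apply: (mulIf (lt0r_neq0 f0)); rewrite mulN1r [in RHS]wE /score; ring.
Qed.

Section likelihood_ratio.
Variables (theta sigma : R).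
Hypothesis s0 : 0 < sigma.
Local Notation f0 := (null_density f1 theta sigma).
Local Notation psi := (null_score f1 df1 theta sigma).

Definition lik_ratio xi x := 1 + clamp (xi * psi x).

Lemma measurable_lik_ratio xi : measurable_fun [set: R] (lik_ratio xi).
Proof.
apply: measurable_funD => //; apply: measurable_maxr => //; apply: measurable_minr => //.
by apply: measurable_funM => //; exact: measurable_null_score.
Qed.

Lemma countable_exceptional (c : R) : countable
  [set x | ~ (good f1 df1 ((x - theta) / sigma) /\ `|(x - theta) / sigma| <> c
    /\ (x - theta) / sigma <> 0)].
Proof.
apply: (@sub_countable _ _ _ ((fun z => sigma * z + theta) @`
  ([set z | ~ good f1 df1 z] `|` [set 0; c; - c]))).
  apply: subset_card_le => x /=; set z := (x - theta) / sigma => h.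
  exists z; last by rewrite /z; field; exact: lt0r_neq0.
  apply: contrapT => /not_orP[/contrapT gz /not_orP[/not_orP[z0 zc] zc']]; apply: h.
  split=> //; split=> // zE; move: zc zc'; rewrite /= -zE.
  by case: (ltP z 0) => [/ltr0_norm ->|/ger0_norm -> //]; rewrite opprK.
apply: sub_countable (card_image_le _ _) _.
rewrite -bigcup2E; apply: bigcup_countable => // -[|[|n]] _ /=.
- exact: countable_not_good hf.
- exact: finite_set_countable.
- exact: countable0.
Qed.

Lemma exceptional_ae (c : R) : {ae leb, forall x,
  good f1 df1 ((x - theta) / sigma) /\ `|(x - theta) / sigma| <> c
    /\ (x - theta) / sigma <> 0}.
Proof.
have h := countable_exceptional c; exists (~` [set x | good f1 df1 ((x - theta) / sigma) /\
   `|(x - theta) / sigma| <> c /\ (x - theta) / sigma <> 0]); split => //.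
  exact: countable_measurable h.
exact: countable_lebesgue_measure0 h.
Qed.

Lemma skew_density_null x : skew_density f1 df1 theta sigma 0 x = f0 x.
Proof. by rewrite /skew_density sgr0 !mul0r subr0 addr0. Qed.

(* [B] bounds the score on [z ^+ 2 <= kap], so that [`|xi| * B < 1] forces
   [zstar ^+ 2 > kap], a region where the absolute score increases with [`|z|]:
   hence [`|xi * score|] crosses 1 exactly at [`|zstar|]. *)
Lemma skew_density_lik_ratio B xi : (forall z, z ^+ 2 <= kap -> `|sc z| <= B) ->
  admissible f1 df1 xi -> xi != 0 -> `|xi| * B < 1 ->
  {ae leb, forall x, skew_density f1 df1 theta sigma xi x = f0 x * lik_ratio xi x}.
Proof.
move=> HB adm x0 xB; pose w := zstar f1 df1 xi.
have wE : xi * sc w = -1 := zstar_score adm x0.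
have w1 : `|xi| * `|sc w| = 1 by rewrite -normrM wE normrN1.
have xp : 0 < `|xi| by rewrite normr_gt0.
have kw : kap < w ^+ 2.
  rewrite ltNge; apply/negP => /HB hw.
  by move: xB; rewrite ltNge -w1 ler_pM2l// hw.
(* Excluded are the jumps of phi with their opposites, the center, and the two points |z| = |w|,
   where the formula of the density may disagree with the ratio. *)
apply: aeS (exceptional_ae `|w|) => x; set z := (x - theta) / sigma.
move=> [gz [zw /eqP z0]].
have xz : x - theta = sigma * z by rewrite /z; field; exact: lt0r_neq0.
have [cmp1 cmp2] := score_compare gz z0 kw.
have cle (a b : R) : (sigma * a < sigma * b) = (a < b) by rewrite ltr_pM2l.
have eD : df1 z = - ph z * f1 z := df1E hf z.
rewrite /skew_density -/z -/w /lik_ratio /null_score -/z /null_density -/z.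
clearbody z; rewrite xz normrM (gtr0_norm s0) ler_pM2l//.
have -> : (Num.sg (- xi) * (sigma * `|w|) < sigma * z) = (Num.sg (- xi) * `|w| < z).
  by rewrite mulrCA cle.
have -> : (sigma * z < Num.sg xi * (sigma * `|w|)) = (z < Num.sg xi * `|w|).
  by rewrite mulrCA cle.
rewrite eD sgrN.
have sv : sigma^-1 != 0 by rewrite invr_eq0 lt0r_neq0.
(* For |z| < |w| the two indicators in the sign term are equal and cancel, leaving 1 + xi psi. For
   |z| > |w| their difference is the sign of z, and xi psi has the sign of xi z, so both sides are 0
   or twice the null density. *)
have [zl|zl|//] := ltgtP `|z| `|w|.
- have le1 : `|xi * sc z| <= 1.
    rewrite normrM; have [kz|/ltW kz] := leP kap (z ^+ 2).
      by rewrite -w1 ler_pM2l// cmp1.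
    by rewrite (le_trans _ (ltW xB))// ler_pM2l// HB.
  rewrite clamp_id//; move: zl; rewrite ltr_norml => /andP[zl1 zl2].
  have [xneg|xpos|xe] := ltgtP xi 0; last by rewrite xe eqxx in x0.
    rewrite (ltr0_sg xneg) opprK !mul1r !mulN1r.
    rewrite (ltNge `|w|) (ltW zl2) (ltNge z) (ltW zl1)/= /score; ring.
  rewrite (gtr0_sg xpos) !mul1r !mulN1r zl1 zl2/= /score; ring.
- have ge1 : 1 <= `|xi * sc z| by rewrite normrM -w1 ler_pM2l// cmp2.
  have scn : xi * sc z != 0.
    by apply/eqP => h; move: ge1; rewrite h normr0 ler10.
  have sgz : Num.sg (xi * sc z) = Num.sg xi * Num.sg z.
    have zk : 0 < z ^+ 2 - kap.
      rewrite subr_gt0 (lt_trans kw)// -(real_normK (num_real w)) -(real_normK (num_real z)).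
      by rewrite ltrXn2r.
    have : ph z != 0 by apply: contraNneq scn => h; rewrite /score h mul0r mulr0.
    rewrite /score (sgrM xi) (sgrM (ph z)) (gtr0_sg zk) mulr1 => pz; congr (_ * _).
    have [zn|zp|ze] := ltgtP z 0; last by rewrite ze eqxx in z0.
      rewrite -[ph z]opprK -(good_odd hf gz) sgrN gtr0_sg ?ltr0_sg//.
      by rewrite lt0r (phi_ge0 hf) ?oppr_gt0// (good_odd hf gz) oppr_eq0 pz.
    by rewrite !gtr0_sg// lt0r pz (phi_ge0 hf).
  rewrite clamp_out// sgz.
  have wn := normr_ge0 w.
  have [zn|zp|ze] := ltgtP z 0; last by rewrite ze eqxx in z0.
    rewrite (ltr0_sg zn); rewrite (ltr0_norm zn) in zl *.
    have [xneg|xpos|xe] := ltgtP xi 0; last by rewrite xe eqxx in x0.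
      rewrite (ltr0_sg xneg) opprK !mul1r !mulN1r.
      have -> : (`|w| < z) = false by apply/negbTE; rewrite -leNgt; lra.
      have -> : (z < - `|w|) = true by lra.
      rewrite /=; ring.
    rewrite (gtr0_sg xpos) !mul1r !mulN1r.
    have -> : (- `|w| < z) = false by apply/negbTE; rewrite -leNgt; lra.
    have -> : (z < `|w|) = true by lra.
    rewrite /=; ring.
  rewrite (gtr0_sg zp); rewrite (gtr0_norm zp) in zl *.
  have [xneg|xpos|xe] := ltgtP xi 0; last by rewrite xe eqxx in x0.
    rewrite (ltr0_sg xneg) opprK !mul1r !mulN1r zl.
    have -> : (z < - `|w|) = false by apply/negbTE; rewrite -leNgt; lra.
    rewrite /=; ring.
  rewrite (gtr0_sg xpos) !mul1r !mulN1r.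
  have -> : (- `|w| < z) = true by lra.
  have -> : (z < `|w|) = false by apply/negbTE; rewrite -leNgt; lra.
  rewrite /=; ring.
Qed.

Lemma measurable_skew_density xi :
  measurable_fun [set: R] (skew_density f1 df1 theta sigma xi).
Proof.
have mz : measurable_fun [set: R] (fun x => (x - theta) / sigma) by exact: measurable_affine.
have mt : measurable_fun [set: R] (fun x => x - theta) by exact: measurable_funB.
have mf : measurable_fun [set: R] (fun x => f1 ((x - theta) / sigma)).
  by apply: measurableT_comp => //; exact: measurable_f1 hf.
have mI (h : R -> R) c : measurable_fun [set: R] h ->
    measurable_fun [set: R] (fun x => (c < h x)%R%:R : R).
  move=> mh; apply: measurable_natbool.
  exact: (@measurable_gt_cst _ (fun=> R) _ 0).
have mJ (h : R -> R) c : measurable_fun [set: R] h ->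
    measurable_fun [set: R] (fun x => (h x < c)%R%:R : R).
  move=> mh; under eq_fun do rewrite -ltrN2; apply: mI; exact: measurable_funN.
have mK (h : R -> R) c : measurable_fun [set: R] h ->
    measurable_fun [set: R] (fun x => (h x <= c)%R%:R : R).
  move=> mh; apply: measurable_natbool.
  exact: (@measurable_le_cst _ (fun=> R) _ 0).
apply: measurable_funD.
  apply: measurable_funB; first exact: measurable_funM.
  apply: measurable_funM; last by apply: mK; exact: measurableT_comp.
  apply: measurable_funM; last by apply: measurable_funB => //; exact: measurable_funX.
  by apply: measurable_funM => //; apply: measurableT_comp => //; exact: measurable_df1 hf.
apply: measurable_funM; first exact: measurable_funM.
by apply: measurable_funB; [exact: mI|exact: mJ].
Qed.

Variable P0 : probability R R.
Hypothesis P0E : forall A, measurable A -> (P0 A = \int[leb]_(x in A) (f0 x)%:E)%E.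

(** The symmetric truncation keeps the score odd, so its mean stays exactly 0 and the ratio needs no
    renormalization. *)
Lemma integral_lik_ratio xi : (\int[P0]_x (lik_ratio xi x)%:E = 1)%E.
Proof.
have mc : measurable_fun [set: R] (fun z => clamp (xi * sc z)).
  apply: measurable_maxr => //; apply: measurable_minr => //.
  by apply: measurable_funM => //; exact: measurable_score hf.
have Ic : intg leb (fun z => clamp (xi * sc z) * f1 z).
  apply: (intg_poly_f1 hf mc); exists 1, 0%N; split => // z.
  by rewrite expr0 mulr1 norm_clamp_le1.
have IP : intg P0 (fun x => clamp (xi * psi x)) := intg_null hf s0 P0E mc Ic.
have I1 : intg P0 (cst 1) by exact: intg_cst.
rewrite intg_EFin; last by apply: intgD.
congr EFin; rewrite RintD// (Rint_null hf s0 P0E mc Ic) (_ : \int[leb]_z _ = 0).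
  by rewrite addr0 Rint_cst.
apply: Rint_odd => //.
  by apply: measurable_funM => //; exact: measurable_f1 hf.
apply: aeS (good_ae hf) => z gz.
by rewrite (score_odd hf gz) mulrN clampN (f1_even hf) mulNr.
Qed.

Lemma skew_law B xi : (forall z, z ^+ 2 <= kap -> `|sc z| <= B) ->
  admissible f1 df1 xi -> xi != 0 -> `|xi| * B < 1 ->
  exists Q : probability R R,
    (forall A, measurable A -> (Q A = \int[P0]_(x in A) (lik_ratio xi x)%:E)%E) /\
    (forall n A, measurable A -> Pn f1 df1 n theta sigma xi A = iid Q n A).
Proof.
move=> HB adm x0 xB.
have mr := measurable_lik_ratio xi; have r0 x : 0 <= lik_ratio xi x by exact: clamp_ge.
have [Q QE] := exists_density_prob mr r0 (integral_lik_ratio xi).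
exists Q; split => // n; apply: Pn_iid => A mA; rewrite QE//.
have mf0 : measurable_fun [set: R] f0 by exact: measurable_null_density hf _ _.
have f0p x : 0 <= f0 x by exact: (null_density_ge0 hf _ s0).
transitivity (\int[leb]_(x in A) (f0 x * lik_ratio xi x)%:E)%E; last first.
  apply: ae_eq_integral => //.
  - apply/measurable_EFinP; apply: measurable_funTS; exact: measurable_funM.
  - apply/measurable_EFinP; apply: measurable_funTS; exact: measurable_skew_density.
  - by apply: aeS (skew_density_lik_ratio HB adm x0 xB) => x -> _.
have mrA : measurable_fun [set: R] (fun x => lik_ratio xi x * \1_A x).
  by apply: measurable_funM => //; exact: measurable_indic.
transitivity (\int[P0]_x (lik_ratio xi x * \1_A x)%:E)%E.
  rewrite integral_mkcond; apply: eq_integral => x _; rewrite patchE indicE.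
  by case: ifPn => _ /=; rewrite ?mulr1 ?mulr0.
rewrite (ge0_integral_real_density mf0 f0p P0E mrA); last by move=> x; rewrite mulr_ge0.
rewrite [RHS]integral_mkcond; apply: eq_integral => x _; rewrite patchE indicE.
by case: ifPn => _ /=; rewrite ?mulr1 ?mulr0 ?mul0r// mulrC.
Qed.

Lemma null_law n A : measurable A -> Pn f1 df1 n theta sigma 0 A = iid P0 n A.
Proof.
apply: Pn_iid => B mB; rewrite P0E//; apply: eq_integral => x _.
by rewrite skew_density_null.
Qed.

End likelihood_ratio.

End skew.

(** * Asymptotic normality and optimality *)

Lemma normal_prob_shift (R : realType) (m r : R) :
  (normal_prob m 1 `]-oo, r] = (gcdf (r - m))%:E)%E.
Proof.
rewrite -gcdfE /normal_prob.
pose h (x : R) := normal_pdf 0 1 x * \1_(`]-oo, r - m]%classic) x.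
have mh : measurable_fun [set: R] h.
  by apply: measurable_funM; [exact: measurable_normal_pdf|exact: measurable_indic].
have h0 x : 0 <= h x by rewrite mulr_ge0 ?normal_pdf_ge0.
transitivity (\int[lebesgue_measure]_x (h x)%:E)%E; last first.
  rewrite [RHS]integral_mkcond; apply: eq_integral => x _; rewrite patchE /h indicE.
  by case: ifPn => _ /=; rewrite ?mulr1 ?mulr0.
rewrite (ge0_integral_lebesgue_affine m (@ltr01 R) mh h0).
rewrite [LHS]integral_mkcond; apply: eq_integral => x _; rewrite patchE /h indicE.
rewrite invr1 !mulr1.
have -> : (x \in `]-oo, r]%classic) = (x - m \in `]-oo, r - m]%classic).
  by apply/idP/idP; rewrite !inE/= !in_itv/= lerD2r.
case: ifPn => _ /=; rewrite ?mulr1 ?mulr0//; congr EFin.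
by rewrite !normal_pdfE ?oner_neq0// /normal_fun subr0.
Qed.

Section limn_esup.
Context {R : realType}.
Implicit Types (u : nat -> \bar R) (l : R).

Lemma limn_esup_le u l :
  (forall e, 0 < e -> \forall n \near \oo, (u n <= (l + e)%:E)%E) ->
  (limn_esup u <= l%:E)%E.
Proof.
move=> h; apply/lee_addgt0Pr => e e0.
apply: (@le_trans _ _ (ereal_sup (u @` [set n | (u n <= (l + e)%:E)%E]))).
  apply: ereal_inf_lbound; exists [set n | (u n <= (l + e)%:E)%E] => //.
  exact: h.
by apply: ge_ereal_sup => _ [n /= un <-]; rewrite -EFinD.
Qed.

Lemma limn_esup_near u l e : (limn_esup u <= l%:E)%E -> 0 < e ->
  \forall n \near \oo, (u n <= (l + e)%:E)%E.
Proof.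
move=> ul e0.
have : (limn_esup u < (l + e)%:E)%E by rewrite (le_lt_trans ul)// lte_fin ltrDl.
move=> /ereal_inf_lt[_ [V FV <-] /ltW hV].
apply: filterS FV => n Vn; apply: le_trans hV.
by apply: ereal_sup_ubound; exists n.
Qed.

Lemma limn_esup_cvg u l : u n @[n --> \oo] --> l%:E -> limn_esup u = l%:E.
Proof.
move=> ul; rewrite is_cvg_limn_esupE; last by apply/cvg_ex; exists l%:E.
exact/cvg_lim.
Qed.

End limn_esup.

Lemma cvg_eq_EFin (R : realType) (u : nat -> \bar R) (v : nat -> R) l :
  (\forall n \near \oo, u n = (v n)%:E) -> v n @[n --> \oo] --> l ->
  u n @[n --> \oo] --> l%:E.
Proof.
move=> uv vl; apply: cvg_EFin.
  by apply: filterS uv => n ->.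
by apply: cvg_trans vl; apply: near_eq_cvg; apply: filterS uv => n /= ->.
Qed.

Section sample_law.
Context {R : realType} (n : nat).
Variables (M : probability (n.-tuple R) R) (Q : probability R R).
Hypothesis MQ : forall A, measurable A -> M A = iid Q n A.

Lemma sample_pr A : measurable A -> (M A = (pr (iid Q n) A)%:E)%E.
Proof. by move=> mA; rewrite MQ// prE. Qed.

Lemma sample_expectation (t : n.-tuple R -> R) : measurable_fun [set: n.-tuple R] t ->
  (forall z, 0 <= t z <= 1) -> ('E_M[t] = (\int[iid Q n]_z t z)%:E)%E.
Proof.
move=> mt t01; rewrite unlock (eq_measure_integral (iid Q n)); last first.
  by move=> A mA _; exact: MQ.
apply: intg_EFin; apply: (@intg_bounded _ _ _ _ _ 1) => // z.
by have /andP[t0 t1] := t01 z; rewrite ger0_norm.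
Qed.

End sample_law.

(** * Limit law and power of the estimated statistic *)

Section local_asymptotics.
Context {R : realType}.
Variables (f1 df1 : R -> R).
Hypothesis hf : classF1 f1 df1.
Variables (theta sigma : R).
Hypothesis s0 : 0 < sigma.
Local Notation leb := (@lebesgue_measure R).
Local Notation psi := (null_score f1 df1 theta sigma).
Local Notation gam := (gamma f1 df1).

Lemma exists_null_prob : exists P0 : probability R R, forall A, measurable A ->
  (P0 A = \int[leb]_(x in A) (null_density f1 theta sigma x)%:E)%E.
Proof.
apply: exists_real_density_prob; first exact: measurable_null_density hf _ _.
  exact: (null_density_ge0 hf _ s0).
exact: (integral_null_density hf _ s0).
Qed.

Variable P0 : probability R R.
Hypothesis P0E : forall A, measurable A ->
  (P0 A = \int[leb]_(x in A) (null_density f1 theta sigma x)%:E)%E.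

(** Eventually |xi| B < 1 and [skew_law] applies; the finitely many other n receive [P0]. Where xi =
    0, in particular for tau = 0, the law is [P0] itself, so the null case is included. *)
Lemma local_experiment tau : local_admissible f1 df1 tau ->
  exists Q : nat -> probability R R,
  likelihood_ratios P0 psi tau (fun n => lik_ratio f1 df1 theta sigma (local_xi tau n)) Q /\
  (\forall n \near \oo, forall A, measurable A ->
    Pn f1 df1 n theta sigma (local_xi tau n) A = iid (Q n) n A).
Proof.
move=> adm; have [B B0 HB] := score_bounded hf.
have /choice[Q HQ] : forall n, exists Qn : probability R R,
    admissible f1 df1 (local_xi tau n) -> `|local_xi tau n| * B < 1 ->
    (forall A, measurable A -> (Qn A =
      \int[P0]_(x in A) (lik_ratio f1 df1 theta sigma (local_xi tau n) x)%:E)%E) /\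
    (forall A, measurable A ->
      Pn f1 df1 n theta sigma (local_xi tau n) A = iid Qn n A).
  move=> n; have [[an xb]|nh] := pselect (admissible f1 df1 (local_xi tau n) /\
      `|local_xi tau n| * B < 1); last by exists P0 => a b; case: nh.
  have [->|x0] := eqVneq (local_xi tau n) 0.
    exists P0 => _ _; split=> [A mA|A mA]; last exact: (null_law df1 P0E).
    under eq_integral => x _ do rewrite /lik_ratio mul0r clamp_id ?normr0// addr0.
    by rewrite integral_cst// mul1e.
  have [Qn [Q1 Q2]] := skew_law hf s0 P0E HB an x0 xb.
  by exists Qn => _ _; split=> // A; exact: Q2.
exists Q; have B1 : 0 < B^-1 by rewrite invr_gt0.
have xi0 : \forall n \near \oo, `|0 - local_xi tau n| < B^-1 :=
  @cvgr_dist_lt _ R^o _ _ _ _ _ (@cvg_xi R tau) _ B1.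
have small : \forall n \near \oo, `|local_xi tau n| * B < 1.
  near=> n; have : `|0 - local_xi tau n| < B^-1 by near: n; exact: xi0.
  by rewrite sub0r normrN => h; rewrite -ltr_pdivlMr// mul1r.
split; last by apply: filterS2 small adm => n sn an; have [_] := HQ n an sn; exact.
apply: filterS2 small adm => n sn an; split.
- exact: measurable_lik_ratio hf _ _ _.
- by move=> x; exact: clamp_ge.
- by have [] := HQ n an sn.
- by move=> x; rewrite /lik_ratio addrAC subrr add0r norm_clamp.
- move=> x; rewrite /lik_ratio addrAC subrr add0r.
  by have [h|/ltW] := leP `|local_xi tau n * psi x| 1; [left; rewrite clamp_id|right].
Unshelve. all: by end_near. Qed.

Let mpsi : measurable_fun [set: R] psi := measurable_null_score hf theta sigma.
Let I4 : intg P0 (fun x => psi x ^+ 4) := intg_null_scoreX hf s0 P0E 4.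
Let psi0 : \int[P0]_x psi x = 0 := Rint_null_score hf s0 P0E.
Let gamE : \int[P0]_x (psi x ^+ 2) = gam := Rint_null_score2 hf s0 P0E.
Let gam0 : 0 < \int[P0]_x (psi x ^+ 2).
Proof. by rewrite gamE (gamma_gt0 hf). Qed.

Let nullE n (A : set (n.-tuple R)) : measurable A ->
  Pn f1 df1 n theta sigma 0 A = iid P0 n A.
Proof. exact: null_law. Qed.

Variables (that shat : @estimator R).
Local Notation Pnull := (fun n => Pn f1 df1 n theta sigma 0).
Hypothesis ct : root_n_consistent Pnull that theta.
Hypothesis dt : asymptotically_discrete that theta.
Hypothesis cs : root_n_consistent Pnull shat sigma.
Hypothesis ds : asymptotically_discrete shat sigma.

Let S n (x : n.-tuple R) := Tn f1 df1 x (that n x) (shat n x).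

Let mS n : measurable_fun [set: n.-tuple R] (@S n).
Proof. exact: measurable_Tn. Qed.

Let consistent_iid (est : @estimator R) target :
  root_n_consistent Pnull est target -> root_n_consistent (fun n => iid P0 n) est target.
Proof.
move=> c e e0; have [M HM] := c e e0; exists M; apply: filterS HM => n.
rewrite nullE//.
apply: (@measurable_gt_cst _ (fun n => n.-tuple R) _ n).
apply: measurable_funM => //; apply: measurableT_comp => //.
exact: measurable_funB.
Qed.

Lemma estimated_Tn_linear e : 0 < e ->
  pr (iid P0 n) [set x | e < `|Tn f1 df1 x (that n x) (shat n x) - Tn f1 df1 x theta sigma|]
  @[n --> \oo] --> (0 : R).
Proof.
apply: (@discretization R (fun n => iid P0 n)
  (fun n x t s => Tn f1 df1 x t s - Tn f1 df1 x theta sigma) _ theta sigma _ that shat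
  (consistent_iid ct) dt (consistent_iid cs) ds e).
  by move=> n t s mt ms; apply: measurable_funB; exact: measurable_Tn.
exact: (Tn_linear hf s0 P0E).
Qed.

Let linear e : 0 < e ->
  pr (iid P0 n) [set x | e < `|S x - scaled_sum P0 psi x|] @[n --> \oo] --> (0 : R).
Proof.
move=> e0; have := estimated_Tn_linear e0.
by under eq_fun => n do under eq_set => x do rewrite (TnE hf s0 P0E).
Qed.

Lemma estimated_Tn_oP1 : oP1 Pnull
  (fun n x => Tn f1 df1 x (that n x) (shat n x) - Tn f1 df1 x theta sigma).
Proof.
move=> e e0; apply: cvg_eq_EFin (estimated_Tn_linear e0); apply: nearW => n.
rewrite (@sample_pr R n _ P0 (@nullE n))//.
apply: (@measurable_gt_cst _ (fun n => n.-tuple R) _ n).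
by apply: measurableT_comp => //; apply: measurable_funB; exact: measurable_Tn.
Qed.

(** The estimators are controlled under the null laws only; contiguity carries the negligible
    remainder to the alternative, where Slutsky's lemma combines it with [clt_experiment]. *)
Lemma estimated_Tn_normal tau : local_admissible f1 df1 tau ->
  asymptotically_normal (fun n => Pn f1 df1 n theta sigma (local_xi tau n))
    (fun n x => Tn f1 df1 x (that n x) (shat n x)) (tau * Num.sqrt gam) 1.
Proof.
move=> /local_experiment[Q [lP QE]] r; rewrite normal_prob_shift.
have h : pr (iid (Q n) n) [set x | S x <= r] @[n --> \oo]
    --> gcdf (r - tau * Num.sqrt gam).
  apply: (@slutsky _ (fun n => n.-tuple R) R (fun n => iid (Q n) n)
    (fun n => @scaled_sum _ _ _ P0 psi n) S (measurable_scaled_sum P0 mpsi) mS).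
    by move=> r'; rewrite -gamE; exact: (clt_experiment mpsi I4 psi0 gam0 lP).
  move=> e e0; apply: (contiguity mpsi I4 gam0 lP _ (linear e0)).
  apply: nearW => n; apply: (@measurable_gt_cst _ (fun n => n.-tuple R) _ n).
  apply: measurableT_comp; first exact: normr_measurable.
  by apply: measurable_funB; [exact: mS|exact: (measurable_scaled_sum P0 mpsi)].
apply: cvg_eq_EFin h.
apply: filterS QE => n QE; rewrite (sample_pr QE)//.
exact: (@measurable_le_cst _ (fun n => n.-tuple R) _ n _ _ (@mS n)).
Qed.

Variable za : R.
Local Notation phi := (fun n (x : n.-tuple R) => (za < S x)%R%:R : R).

Let mphi n : measurable_fun [set: n.-tuple R] (phi n).
Proof.
apply: measurable_natbool.
exact: (@measurable_gt_cst _ (fun n => n.-tuple R) _ n _ _ (@mS n)).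
Qed.

Let phi01 n (x : n.-tuple R) : 0 <= phi n x <= 1.
Proof. by rewrite ler0n (ler_nat R _ 1) leq_b1. Qed.

Let admissible0 : local_admissible f1 df1 0.
Proof. by apply: nearW => n; left; rewrite /local_xi mul0r. Qed.

Lemma null_rejection : \int[iid P0 n]_x phi n x @[n --> \oo] --> 1 - gcdf za.
Proof.
have h : pr (iid P0 n) [set x | S x <= za] @[n --> \oo] --> gcdf za.
  have := @estimated_Tn_normal 0 admissible0 za.
  rewrite normal_prob_shift mul0r subr0 => /fine_cvg; apply: cvg_trans; apply: near_eq_cvg.
  apply: nearW => n; rewrite /= /local_xi mul0r (@sample_pr R n _ P0 (@nullE n))//.
  exact: (@measurable_le_cst _ (fun n => n.-tuple R) _ n _ _ (@mS n)).
have h' : 1 - pr (iid P0 n) [set x | S x <= za] @[n --> \oo] --> 1 - gcdf za.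
  by apply: cvgB h; exact: cvg_cst.
apply: cvg_trans h'; apply: near_eq_cvg; apply: nearW => n.
have mA : measurable [set x : n.-tuple R | S x <= za].
  exact: (@measurable_le_cst _ (fun n => n.-tuple R) _ n _ _ (@mS n)).
rewrite /= -pr_setC// pr_Rint; last exact: measurableC.
apply: eq_Rintegral => x _; rewrite indicE; congr (nat_of_bool _)%:R.
by apply/idP/idP; rewrite inE/= ltNge => /negP.
Qed.

Lemma null_rejection_expectation :
  ('E_(Pnull n)[phi n])%E @[n --> \oo] --> (1 - gcdf za)%:E.
Proof.
apply: cvg_eq_EFin null_rejection; apply: nearW => n.
by rewrite (@sample_expectation R n _ P0 (@nullE n)).
Qed.

Lemma local_power tau (t : forall n, n.-tuple R -> R) : is_test t ->
  (limn_esup (fun n => 'E_(Pnull n)[t n]) <= (1 - gcdf za)%:E)%E ->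
  0 < tau -> local_admissible f1 df1 tau ->
  (limn_esup (fun n => 'E_(Pn f1 df1 n theta sigma (local_xi tau n))[t n]
    - 'E_(Pn f1 df1 n theta sigma (local_xi tau n))[phi n]) <= 0)%E.
Proof.
move=> tP tl tau0 /local_experiment[Q [lP QE]].
have [k k0 Hk] := neyman_pearson mpsi I4 gam0 lP za tau0 mS linear tP.
apply: limn_esup_le => e e0; rewrite add0r.
have e2 : 0 < e / 2 by rewrite divr_gt0.
(* The sizes of both tests are within d of their bounds, so the size difference is at most 2 d and k
   times it at most e / 2. *)
pose d := e / 2 / (2 * (k + 1)).
have d0 : 0 < d by rewrite divr_gt0// mulr_gt0// ltr_wpDl.
have near_t := limn_esup_near tl d0.
have near_phi := @cvgr_dist_lt _ R^o _ _ _ _ _ null_rejection _ d0.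
have near_np := Hk _ e2.
near=> n.
have tn : \int[iid P0 n]_x t n x <= 1 - gcdf za + d.
  rewrite -lee_fin -(@sample_expectation R n _ P0 (@nullE n) _ (tP n).1 (tP n).2).
  by near: n; exact: near_t.
have pn : `|(1 - gcdf za) - \int[iid P0 n]_x phi n x| < d by near: n; exact: near_phi.
have np : \int[iid (Q n) n]_z t n z - \int[iid (Q n) n]_z phi n z <=
    k * (\int[iid P0 n]_z t n z - \int[iid P0 n]_z phi n z) + e / 2.
  by near: n; exact: near_np.
have QEn : forall A, measurable A ->
    Pn f1 df1 n theta sigma (local_xi tau n) A = iid (Q n) n A by near: n; exact: QE.
rewrite (sample_expectation QEn (tP n).1 (tP n).2) (sample_expectation QEn (@mphi n) (@phi01 n)).
rewrite -EFinB lee_fin (le_trans np)//.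
move: tn pn; set a := \int[_]_x t n x; set b := \int[_]_x _; set g := gcdf za.
rewrite ltr_norml => tn /andP[_ pn].
have ab : a - b <= 2 * d by move: tn pn; lra.
have : k * (a - b) <= k * (2 * d) by rewrite ler_wpM2l.
have : k * (2 * d) <= e / 2.
  have -> : e / 2 = (k + 1) * (2 * d).
    by rewrite /d; field; rewrite gt_eqF// ltr_wpDl.
  by apply: ler_wpM2r; [rewrite mulr_ge0// ltW|rewrite lerDl].
by lra.
Unshelve. all: by end_near. Qed.

End local_asymptotics.

Theorem proposition3p1 (R : realType) (f1 df1 : R -> R)
    (hf1 : classF1 f1 df1) :
  (* (i) *)
  (forall that shat : @estimator R,
    C1C2 f1 df1 fst params that -> C1C2 f1 df1 snd params shat ->
    forall theta sigma : R, 0 < sigma ->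
    [/\ oP1 (fun n => Pn f1 df1 n theta sigma 0)
          (fun n x => Tn f1 df1 x (that n x) (shat n x)
                      - Tn f1 df1 x theta sigma),
        asymptotically_normal (fun n => Pn f1 df1 n theta sigma 0)
          (fun n x => Tn f1 df1 x (that n x) (shat n x)) 0 1
      & forall tau : R, local_admissible f1 df1 tau ->
        asymptotically_normal
          (fun n => Pn f1 df1 n theta sigma (local_xi tau n))
          (fun n x => Tn f1 df1 x (that n x) (shat n x))
          (tau * Num.sqrt (gamma f1 df1)) 1]) /\
  (* (ii) *)
  (forall alpha zalpha : R, 0 < alpha < 1 ->
    normal_prob 0 1 `]-oo, zalpha] = (1 - alpha)%:E ->
      (forall (theta : R) (shat : @estimator R),
      C1C2 f1 df1 snd (params_at theta) shat ->
      locally_asymptotically_most_powerful f1 df1 (params_at theta) alpha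
        (fun n x => (zalpha < Tn f1 df1 x theta (shat n x))%R%:R)) /\
      (forall that shat : @estimator R,
      C1C2 f1 df1 fst params that -> C1C2 f1 df1 snd params shat ->
      locally_asymptotically_most_powerful f1 df1 params alpha
        (fun n x => (zalpha < Tn f1 df1 x (that n x) (shat n x))%R%:R))).
Proof.
have params_c (est : @estimator R) tgt theta sigma : C1C2 f1 df1 tgt params est -> 0 < sigma ->
    root_n_consistent (fun n => Pn f1 df1 n theta sigma 0) est (tgt (theta, sigma)) /\
    asymptotically_discrete est (tgt (theta, sigma)).
  by move=> h s0; exact: (h (theta, sigma) s0).
split=> [that shat Ct Cs theta sigma s0|alpha za a01 zaE].
  have [P0 P0E] := exists_null_prob hf1 theta s0.
  have [ct dt] := params_c _ _ theta _ Ct s0; have [cs ds] := params_c _ _ theta _ Cs s0.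
  have normal := estimated_Tn_normal hf1 s0 P0E ct dt cs ds.
  split; [exact: (estimated_Tn_oP1 hf1 s0 P0E)| |exact: normal].
  have adm0 : local_admissible f1 df1 0 by apply: nearW => n; left; rewrite /local_xi mul0r.
  move=> r; have := @normal 0 adm0 r; rewrite mul0r; apply: cvg_trans.
  by apply: near_eq_cvg; apply: nearW => n; rewrite /local_xi mul0r.
have alphaE : 1 - gcdf za = alpha.
  by rewrite /gcdf zaE/= opprB addrC subrK.
(* Level and local power are checked at one parameter at a time, so a single argument serves any
   parameter set on which the estimators behave well. *)
have lamp (Theta : set (R * R)) (that shat : @estimator R) :
    (forall p, Theta p -> [/\ 0 < p.2,
      root_n_consistent (fun n => Pn f1 df1 n p.1 p.2 0) that p.1,
      asymptotically_discrete that p.1,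
      root_n_consistent (fun n => Pn f1 df1 n p.1 p.2 0) shat p.2 &
      asymptotically_discrete shat p.2]) ->
    locally_asymptotically_most_powerful f1 df1 Theta alpha
      (fun n x => (za < Tn f1 df1 x (that n x) (shat n x))%R%:R).
  move=> H; split=> [|psi [psiT psil] [theta sigma] tau Tp tau0 adm].
    split=> [n|[theta sigma] /H/=[s0 ct dt cs ds]].
      split=> [|x]; last by rewrite ler0n (ler_nat R _ 1) leq_b1.
      apply: measurable_natbool.
      apply: (@measurable_gt_cst _ (fun n => n.-tuple R) _ n).
      exact: measurable_Tn.
    have [P0 P0E] := exists_null_prob hf1 theta s0.
    have h := null_rejection_expectation hf1 s0 P0E ct dt cs ds (za := za).
    by rewrite (limn_esup_cvg h) alphaE.
  have /=[s0 ct dt cs ds] := H _ Tp; have [P0 P0E] := exists_null_prob hf1 theta s0.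
  apply: (local_power hf1 s0 P0E ct dt cs ds) => //.
  by rewrite alphaE; exact: psil Tp.
split=> [theta shat Cs|that shat Ct Cs].
  apply: (lamp _ (fun n => cst theta : {mfun n.-tuple R >-> R}) shat) => -[th sigma] [/= -> s0].
  have [cs ds] := Cs (theta, sigma) (conj erefl s0); split => //.
    exact: cst_root_n_consistent.
  exact: cst_asymptotically_discrete.
apply: lamp => -[theta sigma] /= s0.
by have [ct dt] := params_c _ _ theta _ Ct s0; have [cs ds] := params_c _ _ theta _ Cs s0.
Qed.
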